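(* Let $\mathbb{B}_1=\{(x,y)\in\mathbb{R}^2: x^2+y^2<1\}$ be the unit disc. For a real-valued Dirichlet eigenfunction $u$ of the Laplacian on $\mathbb{B}_1$ with eigenvalue $\lambda$, let $\mathcal{N}(u)=\{x\in\mathbb{B}_1: u(x)=0\}$ be its nodal set in the interior and $\mathcal{H}^1$ the $1$-dimensional Hausdorff measure. Then, with the liminf and limsup taken over all such eigenfunctions as $\lambda\to\infty$, $$H_1(\mathbb{B}_1)=\liminf_{\lambda\to\infty}\frac{\mathcal{H}^1(\mathcal{N}(u))}{\sqrt\lambda}=1,$$ and this limit is achieved by the eigenfunctions $u_{0,s}$ as $s\to\infty$, i.e. $\lim_{s\to\infty}\mathcal{H}^1(\mathcal{N}(u_{0,s}))/\sqrt{\lambda_{0,s}}=1$; and $$H_2(\mathbb{B}_1)=\limsup_{\lambda\to\infty}\frac{\mathcal{H}^1(\mathcal{N}(u))}{\sqrt\lambda}=2,$$ and this limit is achieved by the eigenfunctions $u_{k,1}$ as $k\to\infty$, i.e. $\lim_{k\to\infty}\mathcal{H}^1(\mathcal{N}(u_{k,1}))/\sqrt{\lambda_{k,1}}=2$.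
   Context: A Dirichlet eigenfunction with eigenvalue $\lambda$ is a function $u\not\equiv 0$ with $-\Delta u=\lambda u$ in the disc and $u=0$ on the boundary circle. The liminf over all eigenfunctions means $\lim_{\Lambda\to\infty}\inf\{\mathcal{H}^1(\mathcal{N}(u))/\sqrt\lambda\}$, the infimum being over all real-valued Dirichlet eigenfunctions $u$ with eigenvalue $\lambda\ge\Lambda$; the limsup is defined analogously with the supremum. In polar coordinates $(r,\theta)$, for $k=0,1,2,\dots$ and $s=1,2,3,\dots$, let $$u_{k,s}(r,\theta)=J_k\left(\sqrt{\lambda_{k,s}}\,r\right)\sin(k\theta+\theta_0),\qquad \lambda_{k,s}=j_{k,s}^2,$$ where $J_k$ is the Bessel function of the first kind of order $k$, $j_{k,s}$ is the $s$-th positive zero of $J_k$, and $\theta_0\in[0,2\pi)$ is arbitrary (with $\sin\theta_0\ne0$ when $k=0$, so that $u_{0,s}\not\equiv 0$). These are Dirichlet eigenfunctions of $\mathbb{B}_1$ with eigenvalue $\lambda_{k,s}$; the nodal length does not depend on $\theta_0$. *)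

(* Defs.v *)
From HB Require Import structures.
From mathcomp Require Import all_boot all_order all_algebra.
From mathcomp Require Import all_classical all_reals all_analysis.

Set Implicit Arguments.
Unset Strict Implicit.
Unset Printing Implicit Defensive.

Import Order.TTheory GRing.Theory Num.Theory.
Import numFieldNormedType.Exports.

Local Open Scope classical_set_scope.
Local Open Scope ring_scope.

(* The plane is R * R.  The library's norm on a product is the sup norm, so it
   is used only for its topology and for differentiation; lengths are measured
   with the Euclidean norm below. *)
Section plane.
Context {R : realType}.
Implicit Types (p q : R * R) (A : set (R * R)).

Definition enorm p : R := Num.sqrt (p.1 ^+ 2 + p.2 ^+ 2).

Definition unit_disc : set (R * R) := [set p | p.1 ^+ 2 + p.2 ^+ 2 < 1].
Definition closed_unit_disc : set (R * R) := [set p | p.1 ^+ 2 + p.2 ^+ 2 <= 1].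
Definition unit_circle : set (R * R) := [set p | p.1 ^+ 2 + p.2 ^+ 2 = 1].

(* The maximum with 0 gives the empty set diameter 0 rather than -oo. *)
Definition ediam A : \bar R :=
  maxe 0%E (ereal_sup [set (enorm (z.1 - z.2))%:E | z in A `*` A]).

Definition hausdorff1_pre (delta : R) A : \bar R :=
  ereal_inf [set (\sum_(0 <= n <oo) ediam (F n))%E | F in
    [set F : (set (R * R))^nat |
      (forall n, (ediam (F n) <= delta%:E)%E) /\ A `<=` \bigcup_n F n]].

Definition hausdorff1 A : \bar R :=
  ereal_sup [set hausdorff1_pre delta A | delta in [set delta : R | 0 < delta]].

End plane.

Section eigenfunctions.
Context {R : realType}.
Implicit Types (u f : R * R -> R) (U : set (R * R)) (lam : R).

Definition dir_x : R * R := (1, 0).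
Definition dir_y : R * R := (0, 1).

Definition C1_on U f := forall p, U p -> forall e, e = dir_x \/ e = dir_y ->
  derivable f p e /\ {for p, continuous ('D_e f)}.

Definition C2_on U f := [/\ C1_on U f, C1_on U ('D_dir_x f) & C1_on U ('D_dir_y f)].

Definition laplacian f : R * R -> R :=
  fun p => 'D_dir_x ('D_dir_x f) p + 'D_dir_y ('D_dir_y f) p.

(* Classical solutions.  The values of u outside the closed disc are
   irrelevant. *)
Definition dirichlet_eigenfunction lam u :=
  [/\ C2_on unit_disc u,
      {within closed_unit_disc, continuous u},
      forall p, unit_disc p -> - laplacian u p = lam * u p,
      forall p, unit_circle p -> u p = 0
    & exists2 p, unit_disc p & u p != 0].

Definition nodal_set u : set (R * R) := unit_disc `&` [set p | u p = 0].

Definition nodal_ratio lam u : \bar R :=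
  (hausdorff1 (nodal_set u) * ((Num.sqrt lam)^-1)%:E)%E.

Definition nodal_ratios_from (Lam : R) : set (\bar R) :=
  [set x | exists lam u,
    [/\ Lam <= lam, dirichlet_eigenfunction lam u & x = nodal_ratio lam u]].

End eigenfunctions.

Section bessel.
Context {R : realType}.
Implicit Types (k s : nat) (x : R).

Definition besselJ_coeff k x : R^nat := fun m =>
  (-1) ^+ m / (m`! * (m + k)`!)%N%:R * (x / 2) ^+ (2 * m + k)%N.

Definition besselJ k x : R := limn (series (besselJ_coeff k x)).

(* x is the s-th positive zero of J_k (zeros counted from 1): it is a positive
   zero, and ]0, x] contains exactly s zeros. *)
Definition is_bessel_zero k s x :=
  [/\ 0 < x, besselJ k x = 0
    & ([set y | 0 < y <= x /\ besselJ k y = 0] #= `I_s)%card].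

(* For s = 0 there is no such x and the value is the default 0. *)
Definition bessel_zero k s : R := xget 0 [set x | is_bessel_zero k s x].

Definition disc_eigenvalue k s : R := bessel_zero k s ^+ 2.

(* At the origin every angle qualifies and xget makes an arbitrary choice. *)
Definition polar_angle (p : R * R) : R :=
  xget 0 [set t | 0 <= t < 2 * pi /\
                  p = (enorm p * cos t, enorm p * sin t)].

(* The value at the origin does not depend on the angle, because J_k(0) = 0
   when k > 0. *)
Definition disc_eigenfunction k s (theta0 : R) (p : R * R) : R :=
  besselJ k (Num.sqrt (disc_eigenvalue k s) * enorm p)
  * sin (k%:R * polar_angle p + theta0).

End bessel.

(* Main.v *)
Require Import Defs.
From HB Require Import structures.
From mathcomp Require Import all_boot all_order all_algebra perm.
From mathcomp Require Import all_classical all_reals all_analysis.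
From mathcomp Require Import ring lra zify.
Set Implicit Arguments.
Unset Strict Implicit.
Unset Printing Implicit Defensive.
Import Order.TTheory GRing.Theory Num.Theory.
Import numFieldNormedType.Exports.
Local Open Scope classical_set_scope.
Local Open Scope ring_scope.

(* The angular Fourier coefficients of an eigenfunction satisfy Bessel's equation and
   stay bounded at the origin, so they are multiples of J_k(mu r) with mu^2 = lambda.
   The boundary condition and Bourget's hypothesis (J_k and J_l have no common positive
   zero when k <> l) leave a single k, so that
     u = (a cos(k t) + b sin(k t)) J_k(mu r),   mu = j_{k,s+1},
   and the nodal set consists of s circles of radii j_{k,i}/mu and 2k radii of the disc.
   Hence the nodal length divided by mu is
     (2 pi sum_{i <= s} j_{k,i} + 2 k mu) / mu^2.
   Sturm comparison with sin(w ln x) gives pi j_{k,i} <= mu (j_{k,i+1} - j_{k,i}), whence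
   the bound 2, and (j_{k,i} - k) (j_{k,i+1} - j_{k,i}) <= pi j_{k,i+1}, whence the
   lower bound 1 - o(1), the limit 1 for k = 0, and j_{k,1} ~ k.

   Bourget's hypothesis follows Siegel: by Lommel's recurrence a common zero would be
   algebraic, whereas the positive zeros xi of z |-> J_k(2z) are transcendental.  A form
   sum_i P_i(z) J_k(2z)^i J_{k+1}(2z)^(N-i) with small integer coefficients vanishes to
   high order at 0, hence is small together with its derivatives at xi; there only the
   term i = 0 survives, and Liouville's inequality bounds it from below. *)

(** All pairs (k, s) with mu large compete, k ranging from 0 up to mu, so asymptotics of the zeros
    for fixed k would not do: the gap estimates are inequalities explicit in k. Summing them
    produces the two constants. As j_{k,i+1} <= mu and j_{k,1} > k, the first one gives 2 pi sum
    j_{k,i} <= 2 mu (mu - k), and adding 2 k mu gives exactly 2 mu^2. The second one telescopes to 2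
    pi sum j_{k,i} >= (mu - k)^2 - o(mu^2), uniformly in k, and (mu - k)^2 + 2 k mu = mu^2 + k^2 >=
    mu^2. Thus 1 is approached at k = 0, and 2 with k close to mu. Without Bourget's hypothesis an
    eigenspace could mix angular orders, and its nodal sets would no longer consist of circles and
    radii. The transcendence argument stays on the real line: the usual appeal to the maximum
    principle is replaced by dividing the power series by 1 - z / xi, with control of the
    coefficients. Working with J_k(2 z) makes the Taylor coefficients integers once multiplied by
    m!. *)

Section pointwise_derivation.
Context {R : realType}.
Implicit Types (f g : R -> R) (x a b k : R) (n : nat).

(* The library's rules, for functions given as lambda terms. *)
Lemma dcst k x : is_derive x 1 (fun=> k) (0 : R).
Proof. exact: is_derive_cst. Qed.

Lemma did x : is_derive x 1 (fun y : R => y) (1 : R).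
Proof. exact: is_derive_id. Qed.

Lemma dadd f g x a b : is_derive x 1 f a -> is_derive x 1 g b ->
  is_derive x 1 (fun y => f y + g y) (a + b).
Proof. exact: is_deriveD. Qed.

Lemma dopp f x a : is_derive x 1 f a -> is_derive x 1 (fun y => - f y) (- a).
Proof. exact: is_deriveN. Qed.

Lemma dsub f g x a b : is_derive x 1 f a -> is_derive x 1 g b ->
  is_derive x 1 (fun y => f y - g y) (a - b).
Proof. exact: is_deriveB. Qed.

Lemma dmul f g x a b : is_derive x 1 f a -> is_derive x 1 g b ->
  is_derive x 1 (fun y => f y * g y) (a * g x + f x * b).
Proof.
move=> fa gb; have := is_deriveM fa gb.
by rewrite /GRing.scale/= addrC [g x * a]mulrC.
Qed.

Lemma dscale k f x a : is_derive x 1 f a -> is_derive x 1 (fun y => k * f y) (k * a).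
Proof.
move=> fa; apply: (is_derive_eq (dmul (dcst k x) fa)).
by rewrite mul0r add0r.
Qed.

Lemma dpow n f x a : is_derive x 1 f a ->
  is_derive x 1 (fun y => f y ^+ n) (n%:R * f x ^+ n.-1 * a).
Proof.
elim: n => [|n IH] fa; first by rewrite !mul0r; exact: dcst.
have -> : (fun y => f y ^+ n.+1) = (fun y => f y * f y ^+ n).
  by apply/funext => y; rewrite exprS.
apply: (is_derive_eq (dmul fa (IH fa))) => /=.
by case: n {IH} => [|n]; rewrite -natr1 ?exprS/=; ring.
Qed.

Lemma dcomp f g x a b : is_derive (g x) 1 f a -> is_derive x 1 g b ->
  is_derive x 1 (fun y => f (g y)) (a * b).
Proof. exact: is_derive1_comp. Qed.

Lemma dinv f x a : f x != 0 -> is_derive x 1 f a ->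
  is_derive x 1 (fun y => (f y)^-1) (- a / f x ^+ 2).
Proof.
move=> fx0 fa; have := is_deriveV fx0 fa.
by rewrite /GRing.scale/= mulNr mulrC -mulNr.
Qed.

Lemma dsum n (F : nat -> R -> R) (dF : nat -> R) x :
  (forall i, (i < n)%N -> is_derive x 1 (F i) (dF i)) ->
  is_derive x 1 (fun y => \sum_(i < n) F i y) (\sum_(i < n) dF i).
Proof.
elim: n => [|n IH] h.
  rewrite big_ord0 (_ : (fun y => _) = fun=> 0); first exact: dcst.
  by apply/funext => y; rewrite big_ord0.
rewrite big_ord_recr (_ : (fun y => _) = fun y => \sum_(i < n) F i y + F n y).
  by apply: dadd; [apply: IH => i ni; apply: h; exact: ltnW|exact: h].
by apply/funext => y; rewrite big_ord_recr.
Qed.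

Lemma is_derive_unique f x a b : is_derive x 1 f a -> is_derive x 1 f b -> a = b.
Proof. by move=> [_ <-] [_ <-]. Qed.

Lemma is_derive_continuous f x a : is_derive x 1 f a -> {for x, continuous f}.
Proof. by move=> [fd _]; exact/differentiable_continuous/derivable1_diffP. Qed.

End pointwise_derivation.

Section epsilon_forms.
Context {R : realType}.
Implicit Types (f g : R -> R) (x a e : R).

Lemma is_derive_epsilon f x a : is_derive x 1 f a -> forall e, 0 < e ->
  exists2 d, 0 < d & forall h, h != 0 -> `|h| < d -> `|(f (x + h) - f x) / h - a| < e.
Proof.
move=> [df <-] e e0; move: df => /(@cvgrPdist_lt _ R^o) /(_ e e0).
rewrite /= => -[d /= d0 hd]; exists d => // h h0 hd'.
have := hd h; rewrite /= sub0r normrN => /(_ hd' h0).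
by rewrite distrC [_%:A]mulr1 /GRing.scale/= [h + x]addrC mulrC.
Qed.

Lemma continuous_epsilon f x : {for x, continuous f} -> forall e, 0 < e ->
  exists2 d, 0 < d & forall y, `|y - x| < d -> `|f y - f x| < e.
Proof.
move=> fx e e0; move: fx => /(@cvgrPdist_lt _ R^o) /(_ e e0) /= /nbhs_ballP[d /= d0 hd]; exists d => // y yd.
by rewrite distrC; apply: hd; rewrite /ball/= distrC.
Qed.

Lemma isolated_zero f x a : is_derive x 1 f a -> a != 0 -> f x = 0 ->
  exists2 d, 0 < d & forall y, y != x -> `|y - x| < d -> f y != 0.
Proof.
move=> fa a0 fx0; have [|d d0 hd] := is_derive_epsilon fa (e := `|a|).
  by rewrite normr_gt0.
exists d => // y yx yd; apply/eqP => fy0.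
have := hd (y - x); rewrite subr_eq0 => /(_ yx yd).
by rewrite [x + _]addrC subrK fy0 fx0 subrr mul0r sub0r normrN ltxx.
Qed.

End epsilon_forms.

(** * Exponential generating functions and Bessel functions *)

Section cauchy_product.
Context {R : realType}.
Implicit Types u v : R^nat.

Lemma sum_triangle u v N :
  \sum_(0 <= n < N) \sum_(0 <= i < n.+1) u i * v (n - i)%N =
  \sum_(0 <= i < N) \sum_(0 <= j < N - i) u i * v j.
Proof.
elim: N => [|N IH]; first by rewrite !big_geq.
rewrite big_nat_recr//= IH [RHS](_ : _ = \sum_(0 <= i < N.+1)
   (\sum_(0 <= j < N - i) u i * v j + u i * v (N - i)%N)); last first.
  apply: eq_big_nat => i /andP[_ iN].
  by rewrite subSn// big_nat_recr.
by rewrite big_split/= [in RHS]big_nat_recr//= subnn [X in _ + X + _]big_geq// addr0.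
Qed.

Lemma sum_square u v N :
  (\sum_(0 <= i < N) u i) * (\sum_(0 <= j < N) v j)
  = \sum_(0 <= i < N) \sum_(0 <= j < N) u i * v j.
Proof. by rewrite mulr_suml; apply: eq_bigr => i _; rewrite mulr_sumr. Qed.

Lemma sum_square_triangle u v N :
  (\sum_(0 <= i < N) u i) * (\sum_(0 <= j < N) v j) =
  \sum_(0 <= n < N) \sum_(0 <= i < n.+1) u i * v (n - i)%N +
  \sum_(0 <= i < N) \sum_(N - i <= j < N) u i * v j.
Proof.
rewrite sum_square sum_triangle -big_split/=; apply: eq_bigr => i _.
by rewrite -big_cat_nat//= leq_subr.
Qed.

(** The square partial sum and the triangular one differ by at most the same difference for the
    absolute values, [P n - C n]. Since [C n <= P n <= C (n + n)] and [C] converges, this tends to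
    0. *)
Lemma cvg_cauchy_product u v :
  cvgn [normed series u] -> cvgn [normed series v] ->
  series (fun n => \sum_(0 <= i < n.+1) u i * v (n - i)%N) @ \oo -->
  limn (series u) * limn (series v).
Proof.
move=> nu nv.
have cu := normed_cvg nu; have cv := normed_cvg nv.
pose C n : R := \sum_(0 <= k < n) \sum_(0 <= i < k.+1) `|u i| * `|v (k - i)%N|.
pose P n : R := (\sum_(0 <= i < n) `|u i|) * (\sum_(0 <= j < n) `|v j|).
have CP n : C n <= P n.
  rewrite /P (sum_square_triangle (fun i => `|u i|) (fun j => `|v j|)) lerDl.
  by apply: sumr_ge0 => i _; apply: sumr_ge0 => j _; rewrite mulr_ge0.
have PC n : P n <= C (n + n)%N.
  rewrite /P sum_square /C (sum_triangle (fun i => `|u i|) (fun j => `|v j|)).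
  rewrite [leRHS](@big_cat_nat _ _ _ n) ?leq_addr//=.
  rewrite -[leLHS]addr0 lerD//; last first.
    by apply: sumr_ge0 => i _; apply: sumr_ge0 => j _; rewrite mulr_ge0.
  apply: ler_sum_nat => i /andP[_ iN].
  have h : (n <= n + n - i)%N by rewrite -addnBA ?leq_addr// ltnW.
  rewrite [leRHS](@big_cat_nat _ _ _ n)//= lerDl.
  by apply: sumr_ge0 => j _; rewrite mulr_ge0.
have cP : P @ \oo --> limn [normed series u] * limn [normed series v].
  exact: cvgM.
have ndC : nondecreasing_seq C.
  apply/nondecreasing_seqP => n; rewrite /C big_nat_recr//= lerDl.
  by apply: sumr_ge0 => i _; rewrite mulr_ge0.
have cC : cvgn C.
  apply: nondecreasing_is_cvgn => //.
  exists (limn [normed series u] * limn [normed series v]) => _ [n _ <-].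
  have ndP : nondecreasing_seq P.
    apply/nondecreasing_seqP => m; rewrite /P ler_pM ?sumr_ge0//.
      by rewrite big_nat_recr//= lerDl.
    by rewrite big_nat_recr//= lerDl.
  apply: le_trans (CP n) _.
  have -> : limn [normed series u] * limn [normed series v] = limn P.
    by apply/esym/cvg_lim.
  by apply: nondecreasing_cvgn_le => //; apply/cvg_ex; eexists; exact: cP.
have cC2 : (fun n => C (n + n)%N) @ \oo --> limn C.
  apply: (@cvg_comp _ _ _ (fun n : nat => (n + n)%N) C _ \oo _ _ cC).
  by move=> A [N _ NA]; exists N => // n /= Nn; apply: NA => /=; rewrite (leq_trans Nn)// leq_addr.
have dif0 : (fun n => C (n + n)%N - C n) @ \oo --> 0.
  by rewrite -(subrr (limn C)); apply: cvgB.
pose S : R^nat := fun n => (\sum_(0 <= i < n) u i) * (\sum_(0 <= j < n) v j).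
have cS : S @ \oo --> limn (series u) * limn (series v) by exact: cvgM.
rewrite -[X in _ --> X]addr0.
rewrite [X in X @ _ --> _](_ : _ = S + (fun n => - (\sum_(0 <= i < n) \sum_(n - i <= j < n) u i * v j))); last first.
  by apply/funext => n; rewrite /S fctE sum_square_triangle addrK.
apply: cvgD; first exact: cS.
rewrite -[X in _ --> X]oppr0; apply: cvgN.
apply/cvgrPdist_lt => e e0.
move/cvgrPdist_lt : dif0 => /(_ e e0); apply: filterS => n.
rewrite sub0r normrN sub0r normrN; apply: le_lt_trans.
have : `|\sum_(0 <= i < n) \sum_(n - i <= j < n) u i * v j| <= P n - C n.
  rewrite /P (sum_square_triangle (fun i => `|u i|) (fun j => `|v j|)) addrAC subrr add0r.
  apply: (le_trans (ler_norm_sum _ _ _)); apply: ler_sum => i _.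
  apply: (le_trans (ler_norm_sum _ _ _)); apply: ler_sum => j _.
  by rewrite normrM.
move=> h
; apply: (le_trans h).
by apply: le_trans (ler_norm _); rewrite lerD2r.
Qed.

End cauchy_product.

Lemma cvg_seriesMl {R : realType} (k : R) (u : R^nat) : cvgn (series u) ->
  series (fun m => k * u m) @ \oo --> k * limn (series u).
Proof.
move=> cu; rewrite (_ : series _ = (fun n => k * series u n)); last first.
  by apply/funext => n; rewrite /series/= mulr_sumr.
by apply: cvgM => //; exact: cvg_cst.
Qed.

Lemma is_cvg_seriesMl {R : realType} (k : R) (u : R^nat) : cvgn (series u) ->
  cvgn (series (fun m => k * u m)).
Proof. by move=> cu; apply/cvg_ex; exists (k * limn (series u)); exact: cvg_seriesMl. Qed.

Lemma lim_seriesMl {R : realType} (k : R) (u : R^nat) : cvgn (series u) ->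
  limn (series (fun m => k * u m)) = k * limn (series u).
Proof. by move=> cu; apply/cvg_lim => //; exact: cvg_seriesMl. Qed.

(** * Series sum a_m x^m / m! with geometrically bounded a_m *)

Section exponential_generating_functions.
Context {R : realType}.
Implicit Types (a b : R^nat) (B c x : R).

(** The constants are kept explicit because the transcendence argument compares sizes of
    coefficients. *)
Definition ebnd B c a := forall m, `|a m| <= B * c ^+ m.

Definition egf a x : R := limn (pseries (fun m => a m / m`!%:R) x).

Definition econv a b : R^nat :=
  fun m => \sum_(0 <= i < m.+1) 'C(m, i)%:R * (a i * b (m - i)%N).

Lemma ebnd_ge0 B c a : ebnd B c a -> 0 <= B.
Proof. by move=> /(_ 0%N); rewrite expr0 mulr1; exact: le_trans. Qed.

Lemma ebnd_term B c a x m : ebnd B c a ->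
  `|a m / m`!%:R * x ^+ m| <= B * exp_coeff (c * `|x|) m.
Proof.
move=> aB; rewrite /exp_coeff/= !normrM normrX normfV normr_nat exprMn.
rewrite (_ : B * (c ^+ m * `|x| ^+ m / m`!%:R) = B * c ^+ m * (m`!%:R)^-1 * `|x| ^+ m); last by ring.
by rewrite ler_wpM2r ?exprn_ge0// ler_wpM2r// invr_ge0.
Qed.

Lemma is_cvg_egf_norm B c a x : 0 <= c -> ebnd B c a ->
  cvgn [normed pseries (fun m => a m / m`!%:R) x].
Proof.
move=> c0 aB; have B0 := ebnd_ge0 aB.
apply: (@series_le_cvg _ _ (fun m => B * exp_coeff (c * `|x|) m)) => //.
- by move=> n /=.
- by move=> n; apply: mulr_ge0 => //; apply: exp_coeff_ge0; apply: mulr_ge0.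
- by move=> n; exact: ebnd_term.
- exact/is_cvg_seriesMl/is_cvg_series_exp_coeff.
Qed.

Lemma is_cvg_egf B c a x : 0 <= c -> ebnd B c a ->
  cvgn (pseries (fun m => a m / m`!%:R) x).
Proof. by move=> c0 aB; apply: normed_cvg; exact: is_cvg_egf_norm c0 aB. Qed.

Lemma normr_egf_le B c a x : 0 <= c -> ebnd B c a ->
  `|egf a x| <= B * expR (c * `|x|).
Proof.
move=> c0 aB; have B0 := ebnd_ge0 aB.
rewrite /egf /pseries.
have h := @lim_series_norm R R^o _ (is_cvg_egf_norm (x:=x) c0 aB).
apply: (le_trans h).
rewrite /expR -lim_seriesMl; last exact: is_cvg_series_exp_coeff.
apply: lim_series_le; first exact: is_cvg_egf_norm c0 aB.
  exact/is_cvg_seriesMl/is_cvg_series_exp_coeff.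
by move=> n; exact: ebnd_term.
Qed.

Lemma ebnd_shift B c a : ebnd B c a -> ebnd (B * c) c (fun m => a m.+1).
Proof. by move=> aB m; rewrite -mulrA -exprS; exact: aB. Qed.

Lemma ebnd_shiftn B c a n : ebnd B c a -> ebnd (B * c ^+ n) c (fun m => a (m + n)%N).
Proof. by move=> aB m; rewrite -mulrA -exprD addnC; exact: aB. Qed.

Lemma pseries_diffs_egf a :
  pseries_diffs (fun m => a m / m`!%:R) = (fun m => a m.+1 / m`!%:R) :> R^nat.
Proof.
apply/funext => m; rewrite /pseries_diffs factS natrM invfM.
by rewrite mulrCA mulVKf// pnatr_eq0.
Qed.

Lemma is_derive_egf B c a x : 0 <= c -> ebnd B c a ->
  is_derive x 1 (egf a) (egf (fun m => a m.+1) x).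
Proof.
move=> c0 aB.
rewrite /egf -pseries_diffs_egf; apply: (@pseries_snd_diffs _ _ (`|x| + 1)).
- exact: is_cvg_egf c0 aB.
- rewrite pseries_diffs_egf; exact: is_cvg_egf c0 (ebnd_shift aB).
- rewrite pseries_diffs_egf (pseries_diffs_egf (fun m => a m.+1)).
  exact: is_cvg_egf c0 (ebnd_shift (ebnd_shift aB)).
- by rewrite [ltRHS]ger0_norm ?addr_ge0// ltrDl.
Qed.

Lemma egfM B1 c1 B2 c2 a b x : 0 <= c1 -> 0 <= c2 -> ebnd B1 c1 a -> ebnd B2 c2 b ->
  egf (econv a b) x = egf a x * egf b x.
Proof.
move=> c10 c20 aB bB; apply/cvg_lim => //.
have := cvg_cauchy_product (is_cvg_egf_norm (x:=x) c10 aB) (is_cvg_egf_norm (x:=x) c20 bB).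
rewrite /pseries.
set s := (X in series X @ _ --> _ -> _); set t := (X in _ -> series X @ _ --> _).
suff -> : s = t by [].
apply/funext => m; rewrite /s /t /econv/= !mulr_suml !big_mkord; apply: eq_bigr => i _.
have im : (i <= m)%N by rewrite -ltnS.
have -> : x ^+ m = x ^+ i * x ^+ (m - i) by rewrite -exprD subnKC.
have -> : (binomial m i)%:R = m`!%:R / (i`!%:R * (m - i)`!%:R) :> R.
  rewrite -(bin_fact im) !natrM mulfK// mulf_neq0//;
   by rewrite pnatr_eq0 -lt0n fact_gt0.
have h n : n`!%:R != 0 :> R by rewrite pnatr_eq0 -lt0n fact_gt0.
by field; rewrite !h.
Qed.

Lemma egfD B1 c1 B2 c2 a b x : 0 <= c1 -> 0 <= c2 -> ebnd B1 c1 a -> ebnd B2 c2 b ->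
  egf (fun m => a m + b m) x = egf a x + egf b x.
Proof.
move=> c10 c20 aB bB; rewrite /egf /pseries -lim_seriesD.
- congr (limn (series _)); apply/funext => m /=.
  by rewrite [in RHS]/GRing.add/= -mulrDl -mulrDl.
- exact: is_cvg_egf c10 aB.
- exact: is_cvg_egf c20 bB.
Qed.

Lemma egfZ B c a k x : 0 <= c -> ebnd B c a ->
  egf (fun m => k * a m) x = k * egf a x.
Proof.
move=> c0 aB; rewrite /egf /pseries -[RHS]lim_seriesMl; last exact: is_cvg_egf c0 aB.
congr (limn (series _)); apply/funext => m /=.
by rewrite !mulrA.
Qed.

Lemma egf_finite a n x : (forall m, (n <= m)%N -> a m = 0) ->
  egf a x = \sum_(0 <= m < n) a m / m`!%:R * x ^+ m.
Proof.
move=> a0; apply: lim_near_cst => //; exists n => // N /= nN.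
rewrite /pseries/series/= (@big_cat_nat _ _ _ n)//=.
rewrite [X in _ + X]big_nat_cond [X in _ + X]big1 ?addr0// => i /andP[/andP[ni _] _].
by rewrite a0// !mul0r.
Qed.

End exponential_generating_functions.

(** * Bessel functions of integer order *)

Section bessel_functions.
Context {R : realType}.
Implicit Types (k m n : nat) (x z t : R).

Definition bh_coeff k : R^nat := fun m => (-1) ^+ m / (m + k)`!%:R.

(* [J_k(2 z) = z^k bh k (z^2)], which avoids square roots and divisions. *)
Definition bh k t : R := egf (bh_coeff k) t.

Lemma fact_neq0 n : n`!%:R != 0 :> R.
Proof. by rewrite pnatr_eq0 -lt0n fact_gt0. Qed.

Lemma ebnd_bh k : ebnd 1 1 (bh_coeff k).
Proof.
move=> m; rewrite expr1n mulr1 /bh_coeff normrM normrX normrN1 expr1n mul1r.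
rewrite normfV normr_nat invf_le1 ?ltr0n ?fact_gt0//.
by rewrite ler1n fact_gt0.
Qed.

Lemma cvg_bh k t : cvgn (pseries (fun m => bh_coeff k m / m`!%:R) t).
Proof. exact: (is_cvg_egf (c := 1) _ (ebnd_bh k)). Qed.

Lemma is_derive_bh k t : is_derive t 1 (bh k) (- bh k.+1 t).
Proof.
have h := is_derive_egf t ler01 (ebnd_bh k).
apply: (is_derive_eq (f' := egf (fun m => bh_coeff k m.+1) t)); rewrite -mulN1r /bh -(egfZ _ _ ler01 (ebnd_bh k.+1)).
congr (egf _ t); apply: funext => m.
by rewrite /bh_coeff/= exprS addSnnS mulrA.
Qed.

Lemma egf_mulX (B c : R) (a : R^nat) x : 0 <= c -> ebnd B c a ->
  x * egf a x = egf (fun m => m%:R * a m.-1) x.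
Proof.
move=> c0 aB; apply/esym/cvg_lim => //; rewrite -cvg_shiftS.
have := cvg_seriesMl (k := x) (is_cvg_egf (x := x) c0 aB).
set s := (X in X @ _ --> _ -> _); set t := (X in _ -> X @ _ --> _).
suff -> : s = t by [].
apply/funext => n; rewrite /s /t /pseries/series/= big_nat_recl//= mul0r mul0r mul0r add0r.
apply: eq_big_nat => m _.
rewrite factS natrM exprS.
have := fact_neq0 m; have : m.+1%:R != 0 :> R by rewrite pnatr_eq0.
by move=> h1 h2; field; rewrite h2 addrC natr1 h1.
Qed.

(** This is the recurrence J_k(x) + J_{k+2}(x) = (2 (k + 1) / x) J_{k+1}(x) with x = 2 z and t =
    z^2, checked on coefficients. *)
Lemma bh_rec k t : t * bh k.+2 t = k.+1%:R * bh k.+1 t - bh k t.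
Proof.
rewrite /bh (egf_mulX _ ler01 (ebnd_bh k.+2)).
rewrite -(egfZ _ _ ler01 (ebnd_bh k.+1)) -[- egf _ t]mulN1r.
rewrite -(egfZ _ _ ler01 (ebnd_bh k)).
rewrite -(@egfD _ k.+1%:R 1 1 1)//; last 2 first.
- move=> m; rewrite normrM normr_nat expr1n mulr1 -[leRHS]mulr1 ler_wpM2l//.
  by have := ebnd_bh k.+1 m; rewrite mul1r expr1n.
- by move=> m; rewrite mulN1r normrN; exact: ebnd_bh.
congr (egf _ t); apply/funext => -[|m]; rewrite /bh_coeff/=.
  rewrite mul0r !add0n !expr0 factS natrM.
  have := fact_neq0 k; have : k.+1%:R != 0 :> R by rewrite pnatr_eq0.
  by move=> h1 h2; field; rewrite h2 addrC natr1 h1.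
rewrite !addSn !addnS !factS !natrM exprS.
have := fact_neq0 (m + k)%N.
have : (m + k).+2%:R != 0 :> R by rewrite pnatr_eq0.
have : (m + k).+1%:R != 0 :> R by rewrite pnatr_eq0.
rewrite -!natr1 natrD => h1 h2 h3.
by field; rewrite h3 h1 h2.
Qed.

Definition jz k z : R := z ^+ k * bh k (z ^+ 2).

Lemma besselJE k x : besselJ k x = jz k (x / 2).
Proof.
rewrite /besselJ /jz /bh -lim_seriesMl; last exact: cvg_bh.
congr (limn (series _)); apply/funext => m.
rewrite /besselJ_coeff /bh_coeff natrM exprD exprM.
have := fact_neq0 m; have := fact_neq0 (m + k)%N => h1 h2; rewrite /=.
set A := (_ ^+ 2) ^+ m; set B := _ ^+ k; set s := (-1) ^+ m.
by field; rewrite h1 h2.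
Qed.

Lemma jz_rec k z : z * jz k.+2 z = k.+1%:R * jz k.+1 z - z * jz k z.
Proof.
rewrite /jz; move: (bh_rec k (z ^+ 2)).
set h2 := bh k.+2 _; set h1 := bh k.+1 _; set h0 := bh k _ => E.
rewrite !exprS; transitivity (z ^+ k * z * (z ^+ 2 * h2)); first by ring.
by rewrite E; ring.
Qed.

Lemma is_derive_jz0 z : is_derive z 1 (jz 0) (- 2 * jz 1 z).
Proof.
have h2 := dcomp (f := bh 0) (g := fun y => y ^+ 2) (is_derive_bh 0 _) (dpow 2 (did z)).
have h : is_derive z 1 (jz 0) _ := dmul (dpow 0 (did z)) h2.
apply: (is_derive_eq h).
by rewrite /jz /= expr1 expr0; ring.
Qed.

Lemma is_derive_jzS k z :
  is_derive z 1 (jz k.+1) (jz k z - jz k.+2 z).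
Proof.
have h2 := dcomp (f := bh k.+1) (g := fun y => y ^+ 2) (is_derive_bh k.+1 _) (dpow 2 (did z)).
have h : is_derive z 1 (jz k.+1) _ := dmul (dpow k.+1 (did z)) h2.
apply: (is_derive_eq h).
rewrite /jz /=; move: (bh_rec k (z ^+ 2)).
set b2 := bh k.+2 _; set b1 := bh k.+1 _; set b0 := bh k _ => E.
have {}E : b0 = k.+1%:R * b1 - z ^+ 2 * b2 by rewrite E; ring.
by rewrite E !exprS; ring.
Qed.

Lemma is_derive_jz k z : z != 0 ->
  is_derive z 1 (jz k) (k%:R / z * jz k z - 2 * jz k.+1 z).
Proof.
move=> z0; case: k => [|k].
  by apply: (is_derive_eq (is_derive_jz0 z)); rewrite mul0r mul0r add0r mulNr.
apply: (is_derive_eq (is_derive_jzS k z)); apply: (mulfI z0).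
rewrite (_ : z * (_ - 2 * _) = k.+1%:R * jz k.+1 z - 2 * (z * jz k.+2 z)); last by field.
by rewrite mulrBr jz_rec; ring.
Qed.

(** m! times the m-th Taylor coefficient of J_k(2 z): for m = k + 2 j it is (-1)^j m! / (j! (k +
    j)!), a signed binomial coefficient. The factor 2 in the argument is what makes it an
    integer. *)
Definition jz_coeff k m : int :=
  if (k <= m)%N && ~~ odd (m - k) then (-1) ^+ (m - k)./2 * 'C(m, (m - k)./2)%:Z
  else 0.

Lemma jz_coeff_le k m : `|jz_coeff k m| <= (2 ^ m)%N%:Z.
Proof.
rewrite /jz_coeff; case: ifP => _; last by rewrite normr0.
rewrite normrM normrX normrN1 expr1n mul1r lez_nat.
rewrite -[2%N]/(1 + 1)%N expnDn.
have h : ((m - k)./2 < m.+1)%N.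
  by rewrite ltnS (leq_trans _ (leq_subr k m))// -{2}(odd_double_half (m - k)) -addnn; lia.
by rewrite (bigD1 (Ordinal h))//= !exp1n !muln1 leq_addr.
Qed.

(** [w] is [u] spread over the indices k + 2 j; below [n] there are [(n.+1 - k)./2] of these. *)
Lemma series_stretch k (u w : R^nat) n :
  (forall j, w (k + j.*2)%N = u j) ->
  (forall m, ~~ ((k <= m)%N && ~~ odd (m - k)) -> w m = 0) ->
  series w n = series u ((n.+1 - k)./2).
Proof.
move=> wu w0; rewrite /series/=; elim: n => [|n IH].
  by rewrite !big_geq//; case: k {wu w0} => // k; rewrite subSS sub0n.
rewrite big_nat_recr//= IH.
have [kn|nk] := leqP k n; last first.
  rewrite w0 ?addr0; last by rewrite leqNgt nk.
  by have [-> ->] : (n.+1 - k = 0 /\ (n.+2 - k)./2 = 0)%N by split; lia.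
rewrite (subSn kn) (subSn (leqW kn)) (subSn kn).
case odd_nk : (odd (n - k)).
  rewrite w0 ?addr0 ?odd_nk ?andbF//; congr (\sum_(0 <= i < _) _); lia.
have -> : ((n - k).+2)./2 = ((n - k).+1)./2.+1 by lia.
rewrite big_nat_recr//= -wu; congr (_ + w _); lia.
Qed.

Lemma jz_egf k z : jz k z = egf (fun m => (jz_coeff k m)%:~R) z.
Proof.
have h := cvg_seriesMl (k := z ^+ k) (@cvg_bh k (z ^+ 2)).
apply/esym/cvg_lim => //.
rewrite /pseries; set w := (X in series X @ _ --> _).
set u := (X in series X @ _ --> _) in h.
have wu j : w (k + j.*2)%N = u j.
  rewrite /w /u /jz_coeff /= leq_addr addnC addnK odd_double doubleK /= /bh_coeff.
  have jk : (j <= j.*2 + k)%N by lia.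
  rewrite rmorphM/= rmorphXn/= rmorphN1 -[_%:~R]/('C(j.*2 + k, j)%:R).
  have -> : 'C(j.*2 + k, j)%:R = (j.*2 + k)`!%:R / (j`!%:R * (j + k)`!%:R) :> R.
    have e : (j.*2 + k - j = j + k)%N by lia.
    rewrite -(bin_fact jk) e !natrM mulfK// mulf_neq0//; exact: fact_neq0.
  rewrite exprD -exprM -mul2n.
  have := fact_neq0 j; have := fact_neq0 (j + k)%N; have := fact_neq0 (2 * j + k)%N.
  by move=> h1 h2 h3; field; rewrite h1 h2 h3.
have w0 m : ~~ ((k <= m)%N && ~~ odd (m - k)) -> w m = 0.
  by move=> /negbTE hm; rewrite /w /jz_coeff /= hm mul0r mul0r.
rewrite (_ : series w = series u \o (fun n => (n.+1 - k)./2)); last first.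
  by apply/funext => n /=; rewrite (series_stretch n wu w0).
apply: cvg_comp h => A [N _ NA]; exists (N.*2 + k)%N => // n /= hn.
by apply: NA => /=; lia.
Qed.

End bessel_functions.

(** * Transcendence of the zeros of Bessel functions *)

(** Pigeonhole principle on the vectors with entries in 0..Q, Q = 2 U A. Each of the M forms takes
    its values in an interval of length 2 U A Q = Q^2, and (Q^2 + 1)^M < (Q + 1)^(2 M) <= (Q + 1)^U;
    two vectors with the same image are subtracted. *)
Lemma siegel_lemma (M A : nat) (T : finType) (c : 'I_M -> T -> int) :
  (0 < M)%N -> (2 * M <= #|T|)%N -> (0 < A)%N -> (forall i j, `|c i j| <= A%:Z) ->
  exists q : T -> int, [/\ exists j, q j != 0,
    forall j, `|q j| <= (2 * #|T| * A)%N%:Z & forall i, \sum_j c i j * q j = 0].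
Proof.
move=> M0 MU A0 cA; set U := #|T| in MU *.
pose Q := (2 * U * A)%N.
have U0 : (0 < U)%N by rewrite (leq_trans _ MU)// muln_gt0.
pose val (x : {ffun T -> 'I_Q.+1}) i : int := \sum_j c i j * (x j : nat)%:Z.
have val_le x i : `|val x i| <= (U * A * Q)%N%:Z.
  apply: le_trans (ler_norm_sum _ _ _) _.
  apply: (@le_trans _ _ (\sum_(j : T) (A * Q)%N%:Z)).
    apply: ler_sum => j _; rewrite normrM PoszM ler_pM//.
    by rewrite ger0_norm// lez_nat -ltnS.
  by rewrite sumr_const -/U -mulnA !PoszM -mulr_natl natz.
pose F (x : {ffun T -> 'I_Q.+1}) : {ffun 'I_M -> 'I_(Q * Q).+1} :=
  [ffun i => inord (absz (val x i + (U * A * Q)%N%:Z))].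
have shift_ge0 x i : 0 <= val x i + (U * A * Q)%N%:Z.
  by have := val_le x i; rewrite ler_norml => /andP[h _]; rewrite -lerBlDr sub0r.
have F_inj x y : F x = F y -> forall i, val x i = val y i.
  move=> /ffunP FE i; have := FE i; rewrite !ffunE => /(congr1 (@nat_of_ord _)).
  have hb z : (absz (val z i + (U * A * Q)%N%:Z)%R < (Q * Q).+1)%N.
    rewrite ltnS -lez_nat gez0_abs//.
    have -> : (Q * Q)%N = (U * A * Q + U * A * Q)%N by rewrite /Q; lia.
    rewrite PoszD lerD2r.
    by have := val_le z i; rewrite ler_norml => /andP[_].
  rewrite !inordK// => /(congr1 Posz); rewrite !gez0_abs//.
  by move/addIr.
have /injectivePn[x [y xy Fxy]] : ~~ injectiveb F.
  apply/negP => /injectiveP /leq_card.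
  rewrite !card_ffun !card_ord -/U leqNgt => /negP; apply.
  apply: (@leq_trans ((Q.+1 ^ 2) ^ M)).
    by rewrite ltn_exp2r//; lia.
  by rewrite -expnM leq_exp2l// ltnS /Q !muln_gt0 U0.
exists (fun j => (x j : nat)%:Z - (y j : nat)%:Z); split.
- apply: contrapT => h; move/eqP: xy; apply; apply/ffunP => j.
  apply/val_inj/eqP => /=; rewrite -eqz_nat -subr_eq0.
  by apply/negPn/negP => hj; apply: h; exists j.
- move=> j; have := ltn_ord (x j); have := ltn_ord (y j).
  rewrite !ltnS -/Q => h1 h2; rewrite ler_norml; lia.
- move=> i; under eq_bigr do rewrite mulrBr.
  by rewrite sumrB -/(val x i) -/(val y i) (F_inj _ _ Fxy) subrr.
Qed.

Lemma normr_det_le (R : numDomainType) n (A : 'M[R]_n) (b : R) :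
  (forall i j, `|A i j| <= b) -> `|\det A| <= n`!%:R * b ^+ n.
Proof.
move=> Ab; rewrite /determinant; apply: le_trans (ler_norm_sum _ _ _) _.
apply: (@le_trans _ _ (\sum_(s : 'S_n) b ^+ n)).
  apply: ler_sum => s _; rewrite normrM normr_sign mul1r normr_prod.
  apply: (@le_trans _ _ (\prod_(i < n) b)).
    by apply: ler_prod => i _; rewrite normr_ge0 Ab.
  by rewrite prodr_const card_ord.
by rewrite sumr_const card_Sn mulr_natl.
Qed.

Lemma normr_adj_le (R : numDomainType) n (A : 'M[R]_n.+1) (b : R) i j :
  (forall i j, `|A i j| <= b) -> `|(\adj A) i j| <= n`!%:R * b ^+ n.
Proof.
move=> Ab; rewrite mxE /cofactor normrM normr_sign mul1r.
by apply: normr_det_le => k l; rewrite !mxE Ab.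
Qed.

Lemma normr_exprmx_le (R : numDomainType) n (A : 'M[R]_n.+1) (b : R) :
  (forall i j, `|A i j| <= b) ->
  forall l i j, `|(A ^+ l) i j| <= (n.+1%:R * b) ^+ l.
Proof.
move=> Ab; elim=> [|l IH] i j.
  by rewrite !expr0 mxE; case: eqP => _; rewrite ?normr1 ?normr0.
rewrite exprS mxE; apply: le_trans (ler_norm_sum _ _ _) _.
apply: (@le_trans _ _ (\sum_(k < n.+1) b * (n.+1%:R * b) ^+ l)).
  by apply: ler_sum => k _; rewrite normrM ler_pM.
by rewrite sumr_const card_ord -[leLHS]mulr_natl exprS mulrA.
Qed.

Lemma denominator_mx n (A : 'M[rat]_n) : exists (q : nat) (N : 'M[int]_n),
  (0 < q)%N /\ q%:R *: A = map_mx intr N.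
Proof.
pose q := \prod_(ij : 'I_n * 'I_n) absz (denq (A ij.1 ij.2)).
have hq i j : exists z : int, q%:R * A i j = z%:~R.
  rewrite /q (bigD1 (i, j))//= natrM.
  set r := (X in _ * X%:R * _).
  exists (r%:Z * numq (A i j)).
  rewrite rmorphM/= numqE.
  have -> : (absz (denq (A i j)))%:R = (denq (A i j))%:~R :> rat.
    by rewrite -[in RHS](gez0_abs (ltW (denq_gt0 _))).
  by rewrite -[r%:~R]/(r%:R); ring.
exists q, (\matrix_(i, j) projT1 (cid (hq i j))); split.
  by rewrite /q prodn_gt0// => ij; rewrite absz_gt0 denq_eq0.
by apply/matrixP => i j; rewrite !mxE; case: cid.
Qed.

(* Multiplication by [p(xi)] on Z[xi] is an integer matrix up to denominators;
   its determinant is a nonzero integer, and by Cramer's rule [p(xi)] is a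
   factor of it. *)
Lemma liouville (R : realType) (xi : R) (p0 : {poly int}) :
  p0 != 0 -> root (map_poly intr p0) xi ->
  exists (K C : R) (e : nat), [/\ 0 < K, 1 <= C &
    forall (p : {poly int}) (d : nat) (H : R), (size p <= d)%N ->
      (forall l, `|p`_l|%:~R <= H) -> (map_poly intr p).[xi] != 0 ->
      1 <= K * `|(map_poly intr p).[xi]| * C ^+ d * H ^+ e].
Proof.
move=> p0N0 rp0.
have ratrZ : (ratr \o intr : int -> R) =1 intr by move=> z /=; rewrite ratr_int.
(* [g] is to be the monic minimal polynomial of xi over the rationals, obtained by minimality of its
   size. *)
pose P n := `[< exists g : {poly rat}, [/\ g != 0, size g = n & root (map_poly ratr g) xi] >].
have exP : exists n, P n.
  exists (size (map_poly intr p0 : {poly rat})); apply/asboolP.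
  exists (map_poly intr p0); split => //.
    by rewrite map_poly_eq0_id0 ?lead_coef_eq0// intr_eq0 lead_coef_eq0.
  by rewrite -map_poly_comp (eq_map_poly ratrZ).
case: (ex_minnP exP) => n /asboolP[g [gN0 sg rg]] gmin.
have gmin' (f : {poly rat}) : f != 0 -> root (map_poly ratr f) xi -> (n <= size f)%N.
  by move=> fN0 rf; apply: gmin; apply/asboolP; exists f.
wlog gmon : g gN0 sg rg / g \is monic.
  move=> /(_ ((lead_coef g)^-1 *: g)); apply.
  - by rewrite scaler_eq0 invr_eq0 lead_coef_eq0 negb_or gN0.
  - by rewrite size_scale// invr_eq0 lead_coef_eq0.
  - by rewrite map_polyZ/= rootE hornerZ (eqP rg) mulr0.
  - by rewrite monicE lead_coefZ mulVf// lead_coef_eq0.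
have n_gt1 : (1 < n)%N.
  rewrite -sg ltnNge; apply/negP => /size1_polyC gC.
  move: rg; rewrite gC map_polyC rootE hornerC /= fmorph_eq0 => /eqP g0.
  by move: gN0; rewrite gC g0 polyC0 eqxx.
case: n n_gt1 {exP} sg gmin gmin' => // -[//|D] _ sg gmin gmin'.
pose M0 := companionmx g.
have sg1 : (size g).-1 = D.+1 by rewrite sg.
pose M : 'M[rat]_D.+1 := castmx (sg1, sg1) M0.
have chM : char_poly M = g.
  have -> : char_poly M = char_poly M0.
    by rewrite /M; case: _ / (sg1).
  exact: companionmxK.
have [q [N [q0 qN]]] := denominator_mx M.
have qMR : q%:R *: (map_mx ratr M : 'M[R]_D.+1) = map_mx intr N.
  apply/matrixP => i j; move/matrixP/(_ i j): qN; rewrite !mxE => h.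
  by have := congr1 (@ratr R) h; rewrite rmorphM/= ratr_nat ratr_int.
(* The eigenvector [v] turns the matrix p(M) into the number p(xi). *)
have /eigenvalueP[v vM vN0] : eigenvalue (map_mx ratr M : 'M[R]_D.+1) xi.
  by rewrite eigenvalue_root_char -map_char_poly chM.
pose NR : 'M[R]_D.+1 := map_mx intr N.
have vN : v *m NR = (q%:R * xi) *: v.
  by rewrite /NR -qMR -scalemxAr vM scalerA.
have vNl l : v *m NR ^+ l = (q%:R * xi) ^+ l *: v.
  elim: l => [|l IH]; first by rewrite !expr0 mulmx1 scale1r.
  by rewrite exprSr -[_ * NR]/(_ *m NR) mulmxA IH -scalemxAl vN scalerA -exprSr.
have [i0 vi0] : exists i0, v 0 i0 != 0.
  apply: contrapT => h; move/eqP: vN0; apply; apply/rowP => i; rewrite mxE.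
  by apply/eqP/negPn/negP => hi; apply: h; exists i.
pose b : R := 1 + \sum_i \sum_j `|NR i j|.
have b1 : 1 <= b.
  by rewrite lerDl; apply: sumr_ge0 => i _; apply: sumr_ge0.
have Nb i j : `|NR i j| <= b.
  have h1 : `|NR i j| <= \sum_j `|NR i j| by rewrite (bigD1 j)//= lerDl sumr_ge0.
  have h2 : \sum_j `|NR i j| <= \sum_i \sum_j `|NR i j|.
    by rewrite [leRHS](bigD1 i)//= lerDl sumr_ge0// => ? _; rewrite sumr_ge0.
  by apply: (le_trans h1); apply: (le_trans h2); rewrite /b lerDr.
pose c0 : R := D.+1%:R * b.
have c01 : 1 <= c0 by rewrite /c0 -[leLHS]mulr1 ler_pM// ler1n.
pose S : R := \sum_j `|v 0 j|.
pose C1 : R := 2 * q%:R * c0.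
have q1 : 1 <= q%:R :> R by rewrite ler1n.
have C11 : 1 <= C1.
  by rewrite /C1 -[leLHS]mulr1 ler_pM// -[leLHS]mulr1 ler_pM// ler1n.
exists (S * D`!%:R / `|v 0 i0| + 1), (q%:R * C1 ^+ D), D; split.
- by rewrite ltr_wpDl// divr_ge0// mulr_ge0// sumr_ge0.
- by rewrite -[leLHS]mulr1 ler_pM// exprn_ege1.
move=> p d H pd pH pxi.
have H0 : 0 <= H by apply: le_trans (pH 0%N); rewrite ler0z.
(* Since N = q M, this is q^d p(M) written with integer entries. *)
pose Z : 'M[int]_D.+1 := \sum_(l < d) (p`_l * (q ^ (d - l))%N%:Z) *: N ^+ l.
pose ZR : 'M[R]_D.+1 := map_mx intr Z.
have ZRE : ZR = \sum_(l < d) ((p`_l)%:~R * q%:R ^+ (d - l)) *: NR ^+ l.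
  rewrite /ZR /Z raddf_sum/=; apply: eq_bigr => l _.
  rewrite map_mxZ rmorphM/=; congr (_ * _ *: _); last by rewrite rmorphXn.
  by rewrite -[LHS]/((q ^ (d - l))%N%:R) natrX.
have pxiE : (map_poly intr p).[xi] = \sum_(l < d) (p`_l)%:~R * xi ^+ l.
  rewrite (@horner_coef_wide _ d); last first.
    exact: leq_trans (size_poly _ _) pd.
  by apply: eq_bigr => l _; rewrite coef_map.
have vZ : v *m ZR = (q%:R ^+ d * (map_poly intr p).[xi]) *: v.
  rewrite ZRE mulmx_sumr pxiE mulr_sumr scaler_suml; apply: eq_bigr => l _.
  rewrite -scalemxAr vNl scalerA; congr (_ *: _).
  rewrite -[in q%:R ^+ d](subnK (ltnW (ltn_ord l))) exprD exprMn; ring.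
(* As [g] is minimal and p(xi) <> 0, [g] and [p] are coprime; Bezout and Cayley-Hamilton make p(M)
   invertible. *)
have detZ : \det Z != 0.
  pose pQ : {poly rat} := map_poly intr p.
  pose Mp := horner_mx M pQ.
  have pQE : pQ = \sum_(l < d) (p`_l)%:~R *: 'X^l.
    rewrite -(poly_def d (fun l => (p`_l)%:~R)); apply/polyP => l.
    rewrite /pQ coef_map coef_poly/=; case: ltnP => // dl.
    by rewrite nth_default// (leq_trans pd).
  have ZQ : map_mx intr Z = q%:R ^+ d *: Mp.
    rewrite /Mp pQE linear_sum/= scaler_sumr /Z raddf_sum/=; apply: eq_bigr => l _.
    have hX : horner_mx M 'X^l = M ^+ l by rewrite rmorphXn/= horner_mx_X.
    rewrite linearZ/= hX scalerA map_mxZ/= [map_mx _ (N ^+ l)]rmorphXn/= -qN exprZn scalerA.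
    congr (_ *: _); rewrite rmorphM/=.
    have -> : q%:R ^+ d = q%:R ^+ (d - l) * q%:R ^+ l :> rat.
      by rewrite -exprD subnK// ltnW.
    by rewrite -[((q ^ (d - l))%N)%:~R]/((q ^ (d - l))%N%:R) natrX; ring.
  have Mp_unit : Mp \in unitmx.
    have co : coprimep g pQ.
      have gN := gcdp_eq0 g pQ.
      have /dvdpP[s gE] := dvdp_gcdl g pQ.
      have gcdN0 : gcdp g pQ != 0 by rewrite gN negb_and gN0.
      have sN0 : s != 0 by apply: contraNneq gN0 => s0; rewrite gE s0 mul0r.
      have := rg; rewrite [X in map_poly _ X]gE rmorphM/= rootM => /orP[rs|rgcd].
        have := gmin' _ sN0 rs; rewrite -sg {1}gE size_mul// coprimep_def => h.
        have : (0 < size (gcdp g pQ))%N by rewrite lt0n size_poly_eq0.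
        have : (0 < size s)%N by rewrite lt0n size_poly_eq0.
        move: h; set A := size (gcdp g pQ); set B := size s => h h1 h2.
        by apply/eqP; clearbody A B; clear -h h1 h2; lia.
      have /dvdpP[r rE] := dvdp_gcdr g pQ.
      move: pxi; have -> : map_poly intr p = map_poly ratr pQ :> {poly R}.
        by rewrite -map_poly_comp (eq_map_poly ratrZ).
      by rewrite rE rmorphM/= hornerM (eqP rgcd) mulr0 eqxx.
    have /Bezout_eq1_coprimepP[[u w] /= uw] := co.
    have : horner_mx M (u * g + w * pQ) = 1 by rewrite uw rmorph1.
    rewrite rmorphD !rmorphM/= -{1}chM Cayley_Hamilton mulr0 add0r => wM.
    by case: (mulmx1_unit (wM : _ *m _ = 1%:M)).
  have : \det (map_mx intr Z : 'M[rat]_D.+1) != 0.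
    rewrite ZQ detZ; apply: mulf_neq0; last by rewrite -unitfE -unitmxE.
    by rewrite !expf_neq0// pnatr_eq0 -lt0n.
  by rewrite det_map_mx intr_eq0.
have Zb i j : `|ZR i j| <= H * C1 ^+ d.
  rewrite ZRE summxE; apply: le_trans (ler_norm_sum _ _ _) _.
  apply: (@le_trans _ _ (\sum_(l < d) H * (q%:R * c0) ^+ d)).
    apply: ler_sum => l _; rewrite mxE !normrM normrX normr_nat -mulrA ler_pM//.
      by rewrite -intr_norm.
    rewrite exprMn ler_pM// ?exprn_ge0//.
      by rewrite ler_weXn2l// leq_subr.
    apply: le_trans (normr_exprmx_le Nb _ _ _) _.
    by rewrite ler_weXn2l// ltnW.
  rewrite sumr_const card_ord -[leLHS]mulr_natl mulrCA ler_wpM2l//.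
  rewrite /C1 -mulrA [leRHS]exprMn ler_wpM2r//.
    by rewrite exprn_ge0// mulr_ge0// (le_trans _ c01).
  by rewrite -natrX ler_nat ltnW// ltn_expl.
(* Coordinate [i0] of q^d p(xi) v adj(Z) = det(Z) v bounds |p(xi)| from below, as |det Z| >= 1. *)
have : v *m (ZR *m \adj ZR) = \det ZR *: v by rewrite mul_mx_adj mul_mx_scalar.
rewrite mulmxA vZ -scalemxAl => /rowP/(_ i0); rewrite !mxE => /(congr1 Num.norm).
have det1 : 1 <= `|\det ZR|.
  by rewrite det_map_mx -intr_norm ler1z -gtz0_ge1 normr_gt0.
rewrite !normrM normrX normr_nat => E.
set X := `|(map_poly intr p).[xi]|.
have adjb : `|\sum_j v 0 j * (\adj ZR) j i0| <= S * (D`!%:R * (H * C1 ^+ d) ^+ D).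
  rewrite /S mulr_suml; apply: le_trans (ler_norm_sum _ _ _) _; apply: ler_sum => j _.
  by rewrite normrM ler_wpM2l//; apply: normr_adj_le.
have X0 : 0 <= X by exact: normr_ge0.
have vpos : 0 < `|v 0 i0| by rewrite normr_gt0.
have main : `|v 0 i0| <= q%:R ^+ d * X * (S * (D`!%:R * (H * C1 ^+ d) ^+ D)).
  apply: (@le_trans _ _ (`|\det ZR| * `|v 0 i0|)); first by rewrite ler_peMl.
  by rewrite -E ler_wpM2l// mulr_ge0// exprn_ge0.
have Y0 : 0 <= X * (q%:R * C1 ^+ D) ^+ d * H ^+ D.
  by rewrite !mulr_ge0// exprn_ge0// mulr_ge0// exprn_ge0// (le_trans _ C11).
set a := S * _ / _; set V := (q%:R * _) ^+ d; set W := H ^+ D.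
rewrite (_ : (a + 1) * X * V * W = a * (X * V * W) + X * V * W); last by ring.
apply: (@le_trans _ _ (a * (X * V * W))); last by rewrite lerDl.
rewrite /a /V /W.
rewrite mulrAC ler_pdivlMr// mul1r; apply: (le_trans main).
rewrite le_eqVlt; apply/orP; left; apply/eqP.
by rewrite !exprMn -!exprM [(d * D)%N]mulnC; ring.
Qed.

(** * High order of vanishing at 0 and at a second point *)

Section vanishing_order.
Context {R : realType}.
Implicit Types (a b : R^nat) (B c x xi : R) (j m n M T : nat).

Lemma normr_lim_le (u : R^nat) B : cvgn u ->
  (\forall n \near \oo, `|u n| <= B) -> `|limn u| <= B.
Proof.
move=> cu h; rewrite -(@lim_norm _ R^o)//; apply: limr_le => //.
exact: (@is_cvg_norm _ R^o).
Qed.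

Lemma sum_exp_coeff_le x n : 0 <= x -> \sum_(0 <= i < n) x ^+ i / i`!%:R <= expR x.
Proof.
move=> x0; apply: (@nondecreasing_cvgn_le _ (series (exp_coeff x))).
  apply: nondecreasing_series => i _ _; exact: exp_coeff_ge0.
exact: is_cvg_series_exp_coeff.
Qed.

Lemma fact_mul_le (a b : nat) : (a`! * b`! <= (a + b)`!)%N.
Proof.
by rewrite -(bin_fact (leq_addr b a)) addKn leq_pmull// bin_gt0 leq_addr.
Qed.

Lemma sum_exp_tail_le x j n m : 0 <= x ->
  \sum_(n <= i < n + m) x ^+ i / (i + j)`!%:R <= x ^+ n / (n + j)`!%:R * expR x.
Proof.
move=> x0; rewrite -[n in X in X <= _]add0n big_addn addnC addnK.
apply: le_trans (ler_wpM2l _ (sum_exp_coeff_le m x0)); last first.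
  by rewrite divr_ge0// exprn_ge0.
rewrite mulr_sumr; apply: ler_sum => i _.
rewrite mulrACA -exprD addnC ler_wpM2l ?exprn_ge0// -invfM -natrM lef_pV2 ?posrE ?ltr0n ?muln_gt0 ?fact_gt0//.
by rewrite ler_nat; apply: leq_trans (fact_mul_le _ _) _; rewrite leq_eqVlt; apply/orP; left; apply/eqP; congr (_`!); lia.
Qed.

(** Each division by 1 - x / xi raises [j] by one; the bound on a_m is better than geometric by the
    factor m! / (m + j)!. *)
Definition ebndj B c j a := forall m, `|a m| / m`!%:R <= B * c ^+ m / (m + j)`!%:R.

Lemma ebndj_ge0 B c j a : ebndj B c j a -> 0 <= B.
Proof.
move=> /(_ 0%N); rewrite expr0 mulr1 => h.
have : 0 <= B / (0 + j)`!%:R by apply: le_trans h; rewrite divr_ge0.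
by rewrite pmulr_lge0// invr_gt0 ltr0n fact_gt0.
Qed.

Lemma ebndj0 B c a : ebnd B c a -> ebndj B c 0 a.
Proof. by move=> aB m; rewrite addn0 ler_wpM2r ?invr_ge0. Qed.

Lemma ebndj_ebnd B c j a : 0 <= c -> ebndj B c j a -> ebnd B c a.
Proof.
move=> c0 aB m; have B0 := ebndj_ge0 aB.
have := aB m; rewrite ler_pdivrMr ?ltr0n ?fact_gt0// => h; apply: (le_trans h).
rewrite -[leLHS]mulrA; apply: ler_piMr; first by rewrite mulr_ge0 ?exprn_ge0.
by rewrite mulrC ler_pdivrMr ?ltr0n ?fact_gt0// mul1r ler_nat (leq_trans _ (fact_mul_le m j))// leq_pmulr ?fact_gt0.
Qed.

Lemma egf_tail B c a x n : 0 <= c -> ebnd B c a -> (forall m, (m < n)%N -> a m = 0) ->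
  `|egf a x| <= B * ((c * `|x|) ^+ n / n`!%:R * expR (c * `|x|)).
Proof.
move=> c0 aB a0; have B0 := ebnd_ge0 aB.
apply: normr_lim_le; first exact: is_cvg_egf c0 aB.
near=> N.
have nN : (n <= N)%N by near: N; exact: nbhs_infty_ge.
rewrite /pseries/series/= (@big_cat_nat _ _ _ n)//= big_nat_cond big1 ?add0r; last first.
  by move=> i /andP[/andP[_ iN] _]; rewrite a0// !mul0r.
apply: le_trans (ler_norm_sum _ _ _) _.
apply: (@le_trans _ _ (B * \sum_(n <= i < N) (c * `|x|) ^+ i / (i + 0)`!%:R)).
  by rewrite mulr_sumr; apply: ler_sum => i _; rewrite addn0; exact: ebnd_term.
have := @sum_exp_tail_le (c * `|x|) 0 n (N - n); rewrite subnKC// addn0 => h.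
by rewrite ler_wpM2l// h// mulr_ge0.
Unshelve. all: by end_near. Qed.

(* Dividing the series by [1 - x / xi] when it vanishes at [xi]: the quotient has
   partial sums as coefficients, and these are also tails, which gains a
   factor [m] in the size of the coefficients. *)
Lemma egf_divide B c j a xi : 0 <= c -> 0 < xi -> ebndj B c j a -> egf a xi = 0 ->
  exists b, [/\ b 0%N = a 0%N, forall m, a m.+1 = b m.+1 - m.+1%:R / xi * b m &
    ebndj (B * (c * xi * expR (c * xi))) c j.+1 b].
Proof.
move=> c0 xi0 aB a0; have B0 := ebndj_ge0 aB; have xiN0 := lt0r_neq0 xi0.
pose S m := \sum_(0 <= l < m.+1) a l / l`!%:R * xi ^+ l.
pose b m := m`!%:R / xi ^+ m * S m.
exists b; split.
- by rewrite /b /S big_nat1 fact0 expr0 !divr1 mul1r mulr1.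
- move=> m; rewrite /b /S [in X in X - _]big_nat_recr//= -/(S m) factS natrM exprS.
  have h1 : m.+1%:R != 0 :> R by rewrite pnatr_eq0.
  have h2 := @fact_neq0 R m.
  have h3 : xi ^+ m != 0 by rewrite expf_neq0.
  set s := S m; set y := xi ^+ m in h3 *; set f := m`!%:R in h2 *; set d := m.+1%:R in h1 *.
  by field; rewrite h3 xiN0 h2 addrC natr1 h1.
- have Sb m : `|S m| <= B * ((c * xi) ^+ m.+1 / (m.+1 + j)`!%:R * expR (c * xi)).
    have cS : (fun N => S m - \sum_(0 <= l < N) a l / l`!%:R * xi ^+ l) @ \oo --> S m - 0.
      apply: cvgB; first exact: cvg_cst.
      rewrite -[X in _ --> X]a0.
      by have h := is_cvg_egf (x := xi) c0 (ebndj_ebnd c0 aB); exact: h.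
    rewrite -[S m]subr0 -(cvg_lim _ cS)//; apply: normr_lim_le; first by apply/cvg_ex; eexists; exact: cS.
    near=> N.
    have mN : (m.+1 <= N)%N by near: N; exact: nbhs_infty_ge.
    rewrite (@big_cat_nat _ _ _ m.+1)//= opprD addrA subrr sub0r normrN.
    apply: le_trans (ler_norm_sum _ _ _) _.
    apply: (@le_trans _ _ (B * \sum_(m.+1 <= i < N) (c * xi) ^+ i / (i + j)`!%:R)).
      rewrite mulr_sumr; apply: ler_sum => i _.
      rewrite normrM normrX normrM normfV normr_nat (gtr0_norm xi0).
      apply: le_trans (ler_wpM2r _ (aB i)) _; first by rewrite exprn_ge0// ltW.
      by rewrite le_eqVlt; apply/orP; left; apply/eqP; rewrite exprMn; ring.
    have := @sum_exp_tail_le (c * xi) j m.+1 (N - m.+1); rewrite subnKC// => h.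
    by rewrite ler_wpM2l// h// mulr_ge0// ltW.
  move=> m; rewrite /b !normrM normr_nat normfV normrX (gtr0_norm xi0).
  have h2 := @fact_neq0 R m; have h3 : xi ^+ m != 0 by rewrite expf_neq0.
  rewrite (_ : _ * _ / _ = `|S m| / xi ^+ m); last by field; rewrite h2 h3.
  rewrite ler_pdivrMr ?exprn_gt0//; apply: (le_trans (Sb m)).
  rewrite addSnnS exprMn !exprS le_eqVlt; apply/orP; left; apply/eqP; ring.
Unshelve. all: by end_near. Qed.

(** The n-th derivative of [egf a], differentiation being a shift of the coefficients. *)
Definition egfn a n x := egf (fun m => a (m + n)%N) x.

(** Leibniz rule at xi for egf a = (1 - x / xi) egf b, carried out on the coefficients. *)
Lemma egfn_divide B c a b xi n : 0 <= c -> 0 < xi -> ebnd B c b ->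
  (forall m, a m.+1 = b m.+1 - m.+1%:R / xi * b m) ->
  egfn a n.+1 xi = - (n.+1%:R / xi) * egfn b n xi.
Proof.
move=> c0 xi0 bB ab; have xiN0 := lt0r_neq0 xi0.
have bB0 := ebnd_shiftn n bB; have bB1 := ebnd_shiftn n.+1 bB.
have e := @egf_mulX R _ _ _ xi c0 bB1.
have cv0 := is_cvg_egf (x := xi) c0 bB0.
have cv1 := is_cvg_egf (x := xi) c0 bB1.
have cvm : (fun N => xi^-1 * \sum_(0 <= m < N) m%:R * b (m.-1 + n.+1)%N / m`!%:R * xi ^+ m)
   @ \oo --> egfn b n.+1 xi.
  have -> : egfn b n.+1 xi = xi^-1 * (xi * egfn b n.+1 xi) by rewrite mulKf.
  apply: cvgM; first exact: cvg_cst.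
  rewrite /egfn e -cvg_shiftS.
  have := cvg_seriesMl (k := xi) cv1; rewrite -e /egf.
  set s := (X in X @ _ --> _ -> _); set t := (X in _ -> X @ _ --> _).
  suff -> : s = t by [].
  apply/funext => N; rewrite /s /t /series/= big_nat_recl//= !mul0r add0r.
  apply: eq_big_nat => m _; rewrite factS natrM exprS.
  have := @fact_neq0 R m; have : m.+1%:R != 0 :> R by rewrite pnatr_eq0.
  by move=> h1 h2; field; rewrite h2 addrC natr1 h1.
apply/cvg_lim => //.
have -> : - (n.+1%:R / xi) * egfn b n xi = egfn b n.+1 xi - egfn b n.+1 xi - n.+1%:R / xi * egfn b n xi by ring.
have cvn : (fun N => n.+1%:R / xi * \sum_(0 <= m < N) b (m + n)%N / m`!%:R * xi ^+ m) @ \oo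
   --> n.+1%:R / xi * egfn b n xi.
  by apply: cvgM; [exact: cvg_cst|exact: cv0].
pose s N := \sum_(0 <= m < N) b (m + n.+1)%N / m`!%:R * xi ^+ m
  - xi^-1 * \sum_(0 <= m < N) m%:R * b (m.-1 + n.+1)%N / m`!%:R * xi ^+ m
  - n.+1%:R / xi * \sum_(0 <= m < N) b (m + n)%N / m`!%:R * xi ^+ m.
have cs : s @ \oo --> egfn b n.+1 xi - egfn b n.+1 xi - n.+1%:R / xi * egfn b n xi.
  exact: (cvgB (cvgB cv1 cvm) cvn).
rewrite (_ : pseries _ _ = s)//.
apply/funext => N; rewrite /s /pseries /series /= !mulr_sumr -!sumrB.
apply: eq_bigr => -[|m] _.
  by rewrite !add0n ab fact0 expr0 !divr1 !mulr1 !mul0r mulr0 subr0.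
rewrite /= (_ : (m.+1 + n.+1)%N = (m + n.+1).+1)// (_ : (m.+1 + n)%N = (m + n.+1)%N) ?addSnnS// ab.
have := @fact_neq0 R m.+1.
have -> : (m + n.+1).+1%:R = m.+1%:R + n.+1%:R :> R by rewrite -natrD addSn.
by move: (xi ^+ m.+1) (m.+1`!%:R) (m.+1%:R) (n.+1%:R) => y f d d' h; field; rewrite xiN0 h.
Qed.

(** A real substitute for Schwarz's lemma. A zero of order at least T at xi is divided out in T
    steps, each gaining in [ebndj], while a_M keeps its value because all earlier coefficients
    vanish. *)
Lemma vanishing_bound B c j a xi M T : 0 <= c -> 0 < xi -> ebndj B c j a ->
  (forall n, (n < T)%N -> egfn a n xi = 0) -> (forall m, (m < M)%N -> a m = 0) ->
  `|a M| / M`!%:R <=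
    B * (c * xi * expR (c * xi)) ^+ T * c ^+ M / (M + (j + T))`!%:R.
Proof.
move=> c0 xi0; elim: T B j a => [|T IH] B j a aB aT aM.
  by rewrite expr0 mulr1 addn0; exact: aB.
have a0 : egf a xi = 0.
  have := aT 0%N isT; rewrite /egfn (_ : (fun m => _) = a)//.
  by apply/funext => m; rewrite addn0.
have [b [b0 ab bB]] := egf_divide c0 xi0 aB a0.
have bM m : (m <= M)%N -> b m = a m.
  elim: m => [//|m IHm] mM; rewrite ab IHm ?aM//; last exact: ltnW.
  by rewrite mulr0 subr0.
rewrite exprS mulrA -[in leRHS]addSnnS -(bM M (leqnn M)); apply: (IH _ _ _ bB).
  move=> n nT; have := aT n.+1 nT.
  rewrite (egfn_divide n c0 xi0 (ebndj_ebnd c0 bB) ab) => /eqP.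
  rewrite mulf_eq0 oppr_eq0 mulf_eq0 pnatr_eq0 invr_eq0 (gt_eqF xi0)/=.
  by move/eqP.
by move=> m mM; rewrite bM ?aM// ltnW.
Qed.

End vanishing_order.

(** * Siegel's auxiliary function *)

Section auxiliary_function.
Context {R : realType}.
Implicit Types (c d k n N : nat) (f g : R -> R) (z : R).

(** A class of E-functions with integral coefficients, in which products simply add the growth
    constants. *)
Definition int_egf c f := exists s : nat -> int,
  (forall m, `|s m| <= (c ^ m)%N%:Z) /\ forall z, egf (fun m => (s m)%:~R) z = f z.

Lemma ebnd_int B c (s : nat -> int) : (forall m, `|s m| <= (B * c ^ m)%N%:Z) ->
  ebnd B%:R c%:R (fun m => (s m)%:~R : R).
Proof.
move=> h m; rewrite -intr_norm -natrX -natrM.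
by rewrite -[_%:R]/((B * c ^ m)%N%:Z%:~R) ler_int.
Qed.

Lemma ebnd_int1 c (s : nat -> int) : (forall m, `|s m| <= (c ^ m)%N%:Z) ->
  ebnd 1 c%:R (fun m => (s m)%:~R : R).
Proof. by move=> h; apply: (@ebnd_int 1) => m; rewrite mul1n. Qed.

Lemma int_egf1 : int_egf 0 (fun=> 1).
Proof.
exists (fun m => (m == 0)%N%:Z); split.
  by case => [|m]; rewrite ?expn0 ?normr1 ?normr0.
move=> z; rewrite (@egf_finite _ _ 1); last by case.
by rewrite big_nat1 fact0 expr0 divr1 mulr1.
Qed.

Lemma int_egfM c d f g : int_egf c f -> int_egf d g ->
  int_egf (c + d) (fun z => f z * g z).
Proof.
move=> [s [sb sE]] [t [tb tE]].
exists (fun m => \sum_(0 <= i < m.+1) 'C(m, i)%:Z * (s i * t (m - i)%N)); split.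
  move=> m; apply: le_trans (ler_norm_sum _ _ _) _.
  rewrite addnC expnDn big_mkord -[X in _ <= X]natz natr_sum; apply: ler_sum => i _.
  rewrite !normrM natz !PoszM ler_pM// mulrC; apply: ler_pM => //.
move=> z; rewrite -sE -tE -(egfM _ _ _ (ebnd_int1 sb) (ebnd_int1 tb))//.
congr (egf _ z); apply/funext => m; rewrite /econv rmorph_sum/=.
by apply: eq_bigr => i _; rewrite !rmorphM.
Qed.

Lemma int_egfX c f n : int_egf c f -> int_egf (n * c) (fun z => f z ^+ n).
Proof.
move=> cf; elim: n => [|n IH].
  rewrite mul0n (_ : (fun z => _) = fun=> 1); first exact: int_egf1.
  by apply/funext => z; rewrite expr0.
rewrite mulSn (_ : (fun z => _) = fun z => f z * f z ^+ n); first exact: int_egfM.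
by apply/funext => z; rewrite exprS.
Qed.

Lemma int_egf_jz k : int_egf 2 (jz k).
Proof. by exists (jz_coeff k); split => [m|z]; [exact: jz_coeff_le|rewrite jz_egf]. Qed.

Lemma int_egf_monomial k N i : (i <= N)%N ->
  int_egf (2 * N) (fun z => jz k z ^+ i * jz k.+1 z ^+ (N - i)).
Proof.
move=> iN; have := int_egfM (int_egfX i (int_egf_jz k)) (int_egfX (N - i) (int_egf_jz k.+1)).
by rewrite -mulnDl subnKC// mulnC.
Qed.

Lemma egf_sum (I : Type) (r : seq I) (F : I -> R^nat) (B c : R) z : 0 <= c ->
  (forall i : I, ebnd B c (F i)) ->
  egf (fun m => \sum_(i <- r) F i m) z = \sum_(i <- r) egf (F i) z.
Proof.
move=> c0 FB; elim: r => [|i r IH].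
  rewrite big_nil (@egf_finite _ _ 0) ?big_geq// => m _; exact: big_nil.
rewrite big_cons -IH -(egfD _ c0 c0 (FB i) (b := fun m => \sum_(j <- r) F j m) (B2 := (size r)%:R * B)).
  by congr (egf _ z); apply/funext => m; rewrite big_cons.
move=> m {IH}; elim: r => [|j r IH]; first by rewrite big_nil normr0 !mul0r.
rewrite big_cons; apply: le_trans (ler_normD _ _) _.
by rewrite -[size _]/((size r).+1) -natr1 !mulrDl mul1r addrC lerD// FB.
Qed.

Lemma egf_shifted_monomial (s : R^nat) (B c : R) l z : 0 <= c -> ebnd B c s ->
  egf (fun m => 'C(m, l)%:R * s (m - l)%N) z = z ^+ l / l`!%:R * egf s z.
Proof.
move=> c0 sB; pose e : R^nat := fun m => (m == l)%:R.
have eb : ebnd 1 1 e.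
  by move=> m; rewrite expr1n mulr1 /e; case: eqP; rewrite ?normr1 ?normr0.
rewrite (_ : z ^+ l / l`!%:R = egf e z); last first.
  rewrite (@egf_finite _ _ l.+1); last by move=> m lm; rewrite /e gtn_eqF.
  rewrite big_nat_recr//= big_nat_cond big1 ?add0r; last first.
    by move=> i /andP[/andP[_ il] _]; rewrite /e ltn_eqF// !mul0r.
  by rewrite /e eqxx mul1r mulrC.
rewrite -(egfM _ ler01 c0 eb sB); congr (egf _ z); apply/funext => m.
rewrite /econv /e; have [lm|ml] := leqP l m.
  rewrite (@big_cat_nat _ _ _ l)//=; last exact: leqW.
  rewrite big_nat_cond big1 ?add0r; last first.
    by move=> i /andP[/andP[_ il] _]; rewrite ltn_eqF// mul0r mulr0.
  rewrite big_nat_recl//= eqxx mul1r big_nat_cond big1 ?addr0//.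
  by move=> i /andP[/andP[li _] _]; rewrite gtn_eqF ?ltnS// mul0r mulr0.
rewrite bin_small// mul0r big_nat_cond big1// => i /andP[/andP[_ im] _].
by rewrite ltn_eqF ?mul0r ?mulr0// (leq_ltn_trans _ ml).
Qed.

(** Siegel's lemma, with the N.+1 n numbers [q i l] as unknowns and the vanishing of the first M
    coefficients as equations. The basis z^l / l! keeps these coefficients integral: its product
    with a series of coefficients s(m) has the coefficients binomial(m, l) s(m - l), of size at most
    2^m (2 N + 2)^m = (4 N + 4)^m. *)
Lemma auxiliary_function k N n M : (0 < M)%N -> (2 * M <= N.+1 * n)%N ->
  exists (q : 'I_N.+1 -> 'I_n -> int) (a : nat -> int),
  [/\ exists i l, q i l != 0,
      forall i l, `|q i l| <= (2 * (N.+1 * n) * (4 * N + 4) ^ M)%N%:Z,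
      forall m, (m < M)%N -> a m = 0,
      forall m, `|a m| <=
        (N.+1 * n * (2 * (N.+1 * n) * (4 * N + 4) ^ M) * (4 * N + 4) ^ m)%N%:Z &
      forall z, egf (fun m => (a m)%:~R) z =
        \sum_(i < N.+1) (\sum_(l < n) (q i l)%:~R * (z ^+ l / l`!%:R)) *
           (jz k z ^+ i * jz k.+1 z ^+ (N - i)) ].
Proof.
move=> M0 MN; set c := (4 * N + 4)%N.
have sP (i : 'I_N.+1) := cid (@int_egf_monomial k N i (ltn_ord i)).
pose s i := projT1 (sP i).
have sb i m : `|s i m| <= ((2 * N) ^ m)%N%:Z by have [h _] := projT2 (sP i); exact: h.
have sE i z : egf (fun m => (s i m)%:~R) z = jz k z ^+ i * jz k.+1 z ^+ (N - i).
  by have [_ h] := projT2 (sP i); exact: h.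
pose T := ('I_N.+1 * 'I_n)%type.
have cT : #|{: T}| = (N.+1 * n)%N by rewrite card_prod !card_ord.
pose coef (m : nat) (t : T) : int := 'C(m, t.2)%:Z * s t.1 (m - t.2)%N.
have bin_le m l : ('C(m, l) <= 2 ^ m)%N.
  have [lm|ml] := leqP l m; last by rewrite bin_small.
  rewrite -[2%N]/(1 + 1)%N expnDn.
  have h : (l < m.+1)%N by rewrite ltnS.
  by rewrite (bigD1 (Ordinal h))//= !exp1n !muln1 leq_addr.
have coef_le m t : `|coef m t| <= (c ^ m)%N%:Z.
  rewrite /coef normrM.
  apply: (@le_trans _ _ ((2 ^ m) * (2 * N + 2) ^ m)%N%:Z).
    rewrite PoszM ler_pM//; first by rewrite ger0_norm// lez_nat.
    apply: (le_trans (sb _ _)); rewrite lez_nat.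
    apply: (@leq_trans ((2 * N + 2) ^ (m - t.2))); first by case: (m - t.2)%N => // e; rewrite leq_exp2r// leq_addr.
    by rewrite leq_exp2l ?leq_subr// addn2.
  by rewrite lez_nat -expnMn leq_eqVlt; apply/orP; left; apply/eqP; congr (_ ^ _)%N; rewrite /c; lia.
have cM0 : (0 < c ^ M)%N by rewrite expn_gt0 /c addn4.
have cMle (m : 'I_M) t : `|coef m t| <= (c ^ M)%N%:Z.
  apply: (le_trans (coef_le _ _)); rewrite lez_nat leq_exp2l; last by rewrite /c; lia.
  exact: ltnW.
have MT : (2 * M <= #|{: T}|)%N by rewrite cT.
have [q [[t qt] qb q0]] := siegel_lemma M0 MT cM0 cMle.
pose a m : int := \sum_(t : T) coef m t * q t.
exists (fun i l => q (i, l)), a; split.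
- by exists t.1, t.2; case: t qt.
- by move=> i l; rewrite -cT; exact: qb.
- by move=> m mM; have := q0 (Ordinal mM).
- move=> m; apply: le_trans (ler_norm_sum _ _ _) _.
  apply: (@le_trans _ _ (\sum_(t : T) (2 * (N.+1 * n) * c ^ M * c ^ m)%N%:Z)).
    apply: ler_sum => t' _; rewrite normrM mulrC [X in _ <= X]PoszM ler_pM//.
    by rewrite -cT; exact: qb.
  by rewrite sumr_const -mulr_natl cT natz -PoszM mulnA.
- move=> z.
  pose F (t : T) : R^nat := fun m => (q t)%:~R * ('C(m, t.2)%:R * (s t.1 (m - t.2)%N)%:~R).
  have sB i := ebnd_int1 (sb i).
  have cb (t' : T) : ebnd 1 c%:R (fun m => 'C(m, t'.2)%:R * (s t'.1 (m - t'.2)%N)%:~R : R).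
    have := ebnd_int1 (fun m => coef_le m t').
    by congr ebnd; apply/funext => m; rewrite /coef rmorphM.
  have FB t' : ebnd (2 * (N.+1 * n) * c ^ M)%N%:R c%:R (F t').
    move=> m; rewrite /F normrM ler_pM//.
      by rewrite -intr_norm -[X in _ <= X]/((2 * (N.+1 * n) * c ^ M)%N%:Z%:~R) ler_int -cT.
    by have := cb t' m; rewrite mul1r.
  rewrite (_ : (fun m => _) = fun m => \sum_(t <- index_enum T) F t m); last first.
    apply/funext => m; rewrite /a rmorph_sum/=; apply: eq_bigr => t' _.
    by rewrite /F /coef !rmorphM/= mulrC.
  rewrite (egf_sum _ _ _ FB)//.
  under eq_bigr => t' _ do rewrite (egfZ _ _ _ (cb t'))// (egf_shifted_monomial _ _ _ (sB t'.1))// sE mulrA.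
  under [RHS]eq_bigr => i _ do rewrite mulr_suml.
  by rewrite pair_big/=; apply: eq_bigr => -[i l] _.
Qed.

End auxiliary_function.

(** * Derivatives of forms in J_k(2 z) and J_{k+1}(2 z) *)

Section derived_forms.
Context {R : realType}.
Variables (N k : nat).
Implicit Types (P : nat -> {poly int}) (z : R) (t T i l : nat).

Definition jz_form P z : R :=
  \sum_(i < N.+1) (map_poly intr (P i)).[z] * (jz k z ^+ i * jz k.+1 z ^+ (N - i)).

(* Coefficients of [(z d/dz - t)] applied to the form with coefficients [P]. *)
Definition dstep t P : nat -> {poly int} := fun i =>
  'X * (P i)^`() + ((i * k)%:Z - ((N - i) * k.+1)%:Z - t%:Z) *: P i
  - (2 * i.+1)%:Z *: ('X * P i.+1)
  + (if i is i'.+1 then (2 * (N - i'))%:Z *: ('X * P i') else 0).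

(** The operators z d/dz - t for t < T compose to z^T (d/dz)^T, which unlike (d/dz)^T keeps the
    coefficients polynomial. *)
Fixpoint dsteps P T := if T is T'.+1 then dstep T' (dsteps P T') else P.

Definition supported P := forall i, (N < i)%N -> P i = 0.

Lemma dstep_supported t P : supported P -> supported (dstep t P).
Proof.
move=> P0 i Ni; rewrite /dstep !P0//; last exact: ltnW.
rewrite deriv0 !mulr0 !scaler0 subr0 !add0r; case: i Ni => // i.
rewrite ltnS leq_eqVlt => /orP[/eqP <-|Ni]; first by rewrite subnn muln0 scale0r.
by rewrite P0// mulr0 scaler0.
Qed.

Definition djz j z : R := if j is j'.+1 then jz j' z - jz j'.+2 z else - 2 * jz 1 z.

Lemma is_derive_djz j z : is_derive z 1 (jz j) (djz j z).
Proof. by case: j => [|j]; [exact: is_derive_jz0|exact: is_derive_jzS]. Qed.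

Lemma djzE j z : z * djz j z = j%:R * jz j z - 2 * z * jz j.+1 z.
Proof.
case: j => [|j] /=; first by ring.
have := jz_rec j z => E.
have -> : z * (jz j z - jz j.+2 z) = z * jz j z + z * jz j.+2 z - 2 * (z * jz j.+2 z) by ring.
by rewrite -[2 * z * _]mulrA E; ring.
Qed.

Lemma djzSE j z : z * djz j.+1 z = 2 * z * jz j z - j.+1%:R * jz j.+1 z.
Proof. by rewrite /= mulrBr jz_rec; ring. Qed.

(** With J = J_k(2 z) and K = J_{k+1}(2 z), z J' = k J - 2 z K and z K' = 2 z J - (k + 1) K. So z
    d/dz preserves forms of degree N in J and K, moving the exponent of J by at most one. *)
Lemma dstep_form t P z : supported P ->
  exists2 D, is_derive z 1 (jz_form P) D & z * D - t%:R * jz_form P z = jz_form (dstep t P) z.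
Proof.
move=> P0; pose J := jz k z; pose K := jz k.+1 z.
pose ev (q : {poly int}) : R := (map_poly intr q).[z].
pose p i := ev (P i); pose p' i := ev (P i)^`().
pose dphi i := i%:R * J ^+ i.-1 * djz k z * K ^+ (N - i) +
  J ^+ i * ((N - i)%:R * K ^+ (N - i).-1 * djz k.+1 z).
exists (\sum_(i < N.+1) (p' i * (J ^+ i * K ^+ (N - i)) + p i * dphi i)).
  apply: (@dsum R N.+1 (fun i y => (map_poly intr (P i)).[y] * (jz k y ^+ i * jz k.+1 y ^+ (N - i)))
     (fun i => p' i * (J ^+ i * K ^+ (N - i)) + p i * dphi i)) => i _.
  apply: dmul; last by apply: dmul; apply: dpow; exact: is_derive_djz.
  by rewrite /p' /ev -deriv_map; exact: is_derive_poly.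
have zdphi i : z * dphi i = (i * k)%:R * (J ^+ i * K ^+ (N - i)) - ((N - i) * k.+1)%:R * (J ^+ i * K ^+ (N - i))
   - 2 * z * (i%:R * (J ^+ i.-1 * K ^+ (N - i).+1)) + 2 * z * ((N - i)%:R * (J ^+ i.+1 * K ^+ (N - i).-1)).
  have -> : z * dphi i = i%:R * J ^+ i.-1 * (z * djz k z) * K ^+ (N - i) +
     J ^+ i * ((N - i)%:R * K ^+ (N - i).-1 * (z * djz k.+1 z)) by rewrite /dphi; ring.
  rewrite djzE djzSE -/J -/K !natrM !exprS.
  have h1 : i%:R * J ^+ i.-1 * J = i%:R * J ^+ i.
    by case: i => [|i]; rewrite ?mul0r//= exprSr mulrA.
  have h2 : (N - i)%:R * K ^+ (N - i).-1 * K = (N - i)%:R * K ^+ (N - i).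
    by case: (N - i)%N => [|j]; rewrite ?mul0r//= exprSr mulrA.
  have e1 : i%:R * k%:R * (J ^+ i * K ^+ (N - i)) = k%:R * K ^+ (N - i) * (i%:R * J ^+ i.-1 * J).
    by rewrite h1; ring.
  have e2 : (N - i)%:R * k.+1%:R * (J ^+ i * K ^+ (N - i)) =
      k.+1%:R * J ^+ i * ((N - i)%:R * K ^+ (N - i).-1 * K).
    by rewrite h2; ring.
  by rewrite e1 e2; ring.
have evD q r : ev (q + r) = ev q + ev r by rewrite /ev rmorphD hornerD.
have ev0 : ev 0 = 0 by rewrite /ev map_poly0 horner0.
have evN q : ev (- q) = - ev q by rewrite /ev rmorphN hornerN.
have evZ (x : int) q : ev (x *: q) = x%:~R * ev q by rewrite /ev map_polyZ hornerZ.
have evX q : ev ('X * q) = z * ev q by rewrite /ev rmorphM/= map_polyX hornerM hornerX.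
have dE i : ev (dstep t P i) =
   z * p' i + ((i * k)%:R - ((N - i) * k.+1)%:R - t%:R) * p i
   - 2 * z * (i.+1%:R * p i.+1)
   + 2 * z * (if i is i'.+1 then (N - i')%:R * p i' else 0).
  rewrite /dstep !evD evN !evZ !evX -/(p i) -/(p i.+1) -/(p' i).
  rewrite !rmorphB/= -!pmulrn.
  case: i => [|i]; first by rewrite ev0 !natrM -/(p' 0%N); ring.
  by rewrite evZ evX -/(p i) -/(p' i.+1) -pmulrn !natrM; ring.
rewrite /jz_form; under [RHS]eq_bigr => i _ do rewrite -/(ev _) dE.
rewrite !mulr_sumr -sumrB.
pose phi i := J ^+ i * K ^+ (N - i).
have pN1 : p N.+1 = 0 by rewrite /p P0.
have s1 : \sum_(i < N.+1) i%:R * p i * (J ^+ i.-1 * K ^+ (N - i).+1) =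
    \sum_(i < N.+1) i.+1%:R * p i.+1 * phi i.
  rewrite big_ord_recl [RHS]big_ord_recr/= !mul0r add0r pN1.
  rewrite mulr0 mul0r addr0; apply: eq_bigr => i _.
  by rewrite /phi /bump /= ?add1n /= subnSK.
have s2 : \sum_(i < N.+1) (N - i)%:R * p i * (J ^+ i.+1 * K ^+ (N - i).-1) =
    \sum_(i < N.+1) (if nat_of_ord i is i'.+1 then (N - i')%:R * p i' else 0) * phi i.
  rewrite big_ord_recr [RHS]big_ord_recl/= subnn !mul0r addr0 add0r.
  by apply: eq_bigr => i _; rewrite /phi /bump /= ?add1n subnS.
pose b i : R := i.+1%:R * p i.+1 * phi i.
transitivity (\sum_(i < N.+1) ((z * p' i + ((i * k)%:R - ((N - i) * k.+1)%:R - t%:R) * p i) * phi i)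
   - 2 * z * (\sum_(i < N.+1) i%:R * p i * (J ^+ i.-1 * K ^+ (N - i).+1))
   + 2 * z * (\sum_(i < N.+1) (N - i)%:R * p i * (J ^+ i.+1 * K ^+ (N - i).-1))).
  rewrite !mulr_sumr -sumrB -big_split/=; apply: eq_bigr => i _.
  rewrite mulrDr [z * (p i * _)]mulrCA zdphi -/J -/K -/(ev _) -/(p i) /phi; ring.
rewrite s1 s2 !mulr_sumr -sumrB -big_split/=; apply: eq_bigr => i _.
by rewrite -/J -/K /phi; ring.
Qed.

Definition coef_bound (H : nat) P := forall i l, `|(P i)`_l| <= H%:Z.

Lemma dstep_size t P d : (forall i, size (P i) <= d)%N ->
  forall i, (size (dstep t P i) <= d.+1)%N.
Proof.
move=> Pd i; rewrite /dstep.
have hX j : (size ('X * P j)%R <= d.+1)%N.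
  by rewrite (leq_trans (size_polyMleq _ _))// size_polyX add2n ltnS.
have hD : (size ('X * (P i)^`())%R <= d.+1)%N.
  rewrite (leq_trans (size_polyMleq _ _))// size_polyX add2n ltnS.
  by rewrite (leq_trans (size_poly _ _))// (leq_trans (leq_pred _)).
have hZ (x : int) (q : {poly int}) : (size q <= d.+1)%N -> (size (x *: q)%R <= d.+1)%N.
  by apply: leq_trans; exact: size_scale_leq.
have hS (q r : {poly int}) : (size q <= d.+1)%N -> (size r <= d.+1)%N -> (size (q + r)%R <= d.+1)%N.
  by move=> h1 h2; rewrite (leq_trans (size_polyD _ _))// geq_max h1.
apply: (hS); last by case: (i) => [|i']; [rewrite size_poly0|exact: hZ].
apply: (hS); last by rewrite size_polyN; exact: hZ.
by apply: (hS) => //; apply: hZ; exact: leqW.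
Qed.

Lemma dstep_coef t P d H : (forall i, size (P i) <= d)%N -> supported P ->
  coef_bound H P ->
  coef_bound ((d + t + (N * k + N * k.+1 + (4 * N + 4))) * H)%N (dstep t P).
Proof.
move=> Pd P0 PH i l.
have [Ni|iN] := ltnP N i; first by rewrite dstep_supported// coef0 normr0.
rewrite /dstep !(coefD, coefN, coefZ).
have hX j : `|('X * P j)`_l| <= H%:Z.
  by rewrite coefXM; case: eqP => _; rewrite ?normr0.
have hD : `|('X * (P i)^`())`_l| <= (d * H)%N%:Z.
  rewrite coefXM; case: l {hX} => [|l]; rewrite ?normr0//= coef_deriv.
  have [dl|ld] := leqP d l.+1; first by rewrite nth_default ?mul0rn ?normr0// (leq_trans (Pd i)).
  by rewrite normrMn -mulr_natl natz PoszM ler_pM// lez_nat ltnW.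
have hS : `|((i * k)%:Z - ((N - i) * k.+1)%:Z - t%:Z) * (P i)`_l| <= ((N * k + N * k.+1 + t) * H)%N%:Z.
  rewrite normrM [leRHS]PoszM ler_pM//.
  have h1 : (i * k <= N * k)%N by rewrite leq_mul2r iN orbT.
  have h2 : ((N - i) * k.+1 <= N * k.+1)%N by rewrite leq_mul2r leq_subr orbT.
  rewrite ler_norml; lia.
have h3 : `|(2 * i.+1)%:Z * ('X * P i.+1)`_l| <= ((2 * N + 2) * H)%N%:Z.
  rewrite normrM [leRHS]PoszM ler_pM//; rewrite ger0_norm// lez_nat; lia.
have h4 : `|((if i is i'.+1 then (2 * (N - i'))%:Z *: ('X * P i') else 0) : {poly int})`_l| <= (2 * N * H)%N%:Z.
  case: (i) => [|i']; first by rewrite coef0 normr0.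
  rewrite coefZ normrM [leRHS]PoszM ler_pM//; rewrite ger0_norm// lez_nat; lia.
apply: le_trans (ler_normD _ _) _; apply: le_trans (lerD (ler_normB _ _) h4) _.
apply: le_trans (lerD (lerD (ler_normD _ _) h3) (lexx _)) _.
apply: le_trans (lerD (lerD (lerD hD hS) (lexx _)) (lexx _)) _.
rewrite -!PoszD lez_nat -!mulnDl leq_mul2r; apply/orP; right; lia.
Qed.

(** Each step costs a factor linear in n + T. The resulting power is of factorial growth, and the
    denominator gained from the vanishing at 0 has to beat it. *)
Lemma dsteps_bound P n H T : (forall i, size (P i) <= n)%N -> supported P ->
  coef_bound H P ->
  [/\ forall i, (size (dsteps P T i) <= n + T)%N, supported (dsteps P T) &
  coef_bound (H * (n + 2 * T + (N * k + N * k.+1 + (4 * N + 4))) ^ T)%N (dsteps P T)].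
Proof.
move=> Pn P0 PH.
have main t : (t <= T)%N -> [/\ forall i, (size (dsteps P t i) <= n + t)%N, supported (dsteps P t) &
  coef_bound (H * (n + 2 * T + (N * k + N * k.+1 + (4 * N + 4))) ^ t)%N (dsteps P t)].
  elim: t => [|t IH] tT.
    by split => //= [i|]; rewrite ?addn0// expn0 muln1.
  have [h1 h2 h3] := IH (ltnW tT).
  split => /=.
  - by move=> i; rewrite addnS; exact: dstep_size.
  - exact: dstep_supported.
  - move=> i l; have h := dstep_coef t h1 h2 h3 i l. apply: (le_trans h).
    rewrite lez_nat expnS mulnCA leq_mul2l leq_mul2r; apply/orP; right; apply/orP; right; lia.
by have := main T (leqnn T).
Qed.

End derived_forms.

(** * Non-vanishing of the forms and comparison of sizes *)

Section zeros_are_transcendental.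
Context {R : realType}.
Implicit Types (k n N : nat) (z : R).

Lemma poly_unbounded_roots (p : {poly R}) :
  (forall X : R, exists2 z, X < z & root p z) -> p = 0.
Proof.
have [n] := ubnP (size p); elim: n p => // n IH p pn hp.
apply/eqP/negPn/negP => p0.
have [z _ rz] := hp 0; have /factor_theorem[q pE] := rz.
have q0 : q != 0 by apply: contra_neq p0 => q0; rewrite pE q0 mul0r.
have /eqP := q0; apply; apply: IH.
  by move: pn; rewrite pE size_mul ?polyXsubC_eq0// size_XsubC addn2 ltnS.
move=> X; have [y] := hp (Num.max X z); rewrite gt_max => /andP[Xy zy].
rewrite pE rootM => /orP[ry|]; first by exists y.
by rewrite root_XsubC gt_eqF.
Qed.

(** If the form vanished identically, dividing it by J^i for the least i with Q_i <> 0 would give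
    Q_i K^(N - i) = 0 at the zeros of J, by continuity since these are simple. As K does not vanish
    there, Q_i would have arbitrarily large roots. *)
Lemma jz_form_neq0 k N (Q : nat -> {poly R}) :
  (forall X : R, exists2 z, X < z & jz k z = 0) ->
  (forall z : R, 0 < z -> jz k z = 0 -> jz k.+1 z != 0) ->
  (exists2 i, (i <= N)%N & Q i != 0) ->
  exists z : R, \sum_(i < N.+1) (Q i).[z] * (jz k z ^+ i * jz k.+1 z ^+ (N - i)) != 0.
Proof.
move=> zeros sep [i0 i0N Qi0]; apply: contrapT => hF.
have {}hF z : \sum_(i < N.+1) (Q i).[z] * (jz k z ^+ i * jz k.+1 z ^+ (N - i)) = 0.
  by apply/eqP/negPn/negP => h; apply: hF; exists z.
suff : Q i0 = 0 by apply/eqP.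
have [n] := ubnP i0; elim: n i0 i0N {Qi0} => // n IH i iN ni.
have Q0 j : (j < i)%N -> Q j = 0.
  by move=> ji; apply: IH; [rewrite (leq_trans (ltnW ji))|rewrite (leq_trans ji)].
apply: poly_unbounded_roots => X.
have [z] := zeros (Num.max X 0); rewrite gt_max => /andP[Xz z0] Jz.
exists z => //.
pose g y := \sum_(j < N.+1 - i) (Q (j + i)%N).[y] * (jz k y ^+ j * jz k.+1 y ^+ (N - (j + i))).
have gE y : jz k y ^+ i * g y = 0.
  have := hF y; rewrite -(big_mkord xpredT (fun i => (Q i).[y] * (jz k y ^+ i * jz k.+1 y ^+ (N - i)))).
  rewrite (@big_cat_nat _ _ _ i)//=; last exact: leqW.
  rewrite big_nat_cond big1 ?add0r; last first.
    by move=> j /andP[/andP[_ ji] _]; rewrite Q0// horner0 mul0r.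
  rewrite -{1}[i]add0n big_addn big_mkord => <-.
  by rewrite /g mulr_sumr; apply: eq_bigr => j _; rewrite exprD; ring.
have gz : g z = (Q i).[z] * jz k.+1 z ^+ (N - i).
  rewrite /g subSn// big_ord_recl big1 ?addr0; last first.
    by move=> j _; rewrite Jz exprS !mul0r mulr0.
  by rewrite expr0 mul1r.
have gc : {for z, continuous g}.
  apply: (@is_derive_continuous _ _ _ _ (dsum (n := (N.+1 - i)%N)
    (F := fun j y => (Q (j + i)%N).[y] * (jz k y ^+ j * jz k.+1 y ^+ (N - (j + i))))
    (dF := fun j => (Q (j + i)%N)^`().[z] * (jz k z ^+ j * jz k.+1 z ^+ (N - (j + i))) +
      (Q (j + i)%N).[z] * (j%:R * jz k z ^+ j.-1 * djz k z * jz k.+1 z ^+ (N - (j + i)) +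
        jz k z ^+ j * ((N - (j + i))%:R * jz k.+1 z ^+ (N - (j + i)).-1 * djz k.+1 z))) _)).
  move=> j _; apply: dmul; last by apply: dmul; apply: dpow; exact: is_derive_djz.
have dJ : djz k z != 0.
  apply/eqP => dJ; have := djzE k z; rewrite dJ mulr0 Jz mulr0 sub0r => /esym/eqP.
  by rewrite oppr_eq0 2!mulf_eq0 pnatr_eq0/= (gt_eqF z0) (negbTE (sep _ z0 Jz)).
have [d d0 hd] := isolated_zero (is_derive_djz k z) dJ Jz.
have gz0 : g z = 0.
  apply/eqP/negPn/negP => gzN0.
  have [|d' d'0 hd'] := continuous_epsilon gc (e := `|g z|); first by rewrite normr_gt0.
  pose h := Num.min d d' / 2.
  have m0 : 0 < Num.min d d' by rewrite lt_min d0.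
  have h0 : 0 < h by rewrite divr_gt0.
  have hm : h < Num.min d d' by rewrite /h ltr_pdivrMr// ltr_pMr// ltr1n.
  have [hd1 hd2] : h < d /\ h < d' by apply/andP; rewrite -lt_min.
  have e : z + h - z = h by rewrite addrC addKr.
  have Jy : jz k (z + h) != 0.
    by apply: hd; rewrite ?e ?gtr0_norm// -subr_eq0 e gt_eqF.
  have gy : g (z + h) = 0.
    by have /eqP := gE (z + h); rewrite mulf_eq0 expf_eq0 (negbTE Jy) andbF => /eqP.
  by have := hd' (z + h); rewrite e gtr0_norm// gy sub0r normrN ltxx => /(_ hd2).
move: gz0; rewrite gz => /eqP; rewrite mulf_eq0 expf_eq0 (negbTE (sep _ z0 Jz)) andbF orbF.
by rewrite rootE.
Qed.

Lemma fact_le_expn m n : (m <= n)%N -> (m`! <= n ^ m)%N.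
Proof.
elim: m => [|m IH] mn; first by rewrite expn0.
by rewrite factS expnS leq_mul// IH// ltnW.
Qed.

Lemma fact_expn_le m T : (m`! * m ^ T <= (m + T)`!)%N.
Proof.
elim: T => [|T IH]; first by rewrite expn0 muln1 addn0.
by rewrite addnS factS expnS mulnCA; apply: leq_mul => //; rewrite ltnW// ltnS leq_addr.
Qed.

Lemma fact_sub_le m T : (T <= m)%N -> (m`! <= (m - T)`! * m ^ T)%N.
Proof.
elim: T => [|T IH] Tm; first by rewrite subn0 expn0 muln1.
apply: leq_trans (IH (ltnW Tm)) _.
by rewrite -(subnSK Tm) factS expnS -mulnA [X in (_ <= X)%N]mulnCA leq_mul2r subnSK// leq_subr orbT.
Qed.

Lemma expn_fact_expR m : m%:R ^+ m <= expR 1 ^+ m * m`!%:R :> R.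
Proof.
rewrite -expRM_natl mulr1 -ler_pdivrMr ?ltr0n ?fact_gt0//.
apply: le_trans (sum_exp_coeff_le m.+1 (ler0n _ m)).
by rewrite big_nat_recr//= lerDr sumr_ge0// => i _; rewrite divr_ge0 ?exprn_ge0.
Qed.

(** The two bounds on m give 2 (n + T) (e + 1) <= m, so squaring the last hypothesis yields m^(2 m)
    <= A^(2 m) m^m. *)
Lemma exponent_comparison (m n T e : nat) (A : R) : (0 < m)%N -> 1 <= A ->
  (4 * e.+1 * n <= m)%N -> (4 * e.+1 * T <= m)%N ->
  m%:R ^+ m <= A ^+ m * m%:R ^+ ((n + T) * e.+1) -> m%:R <= A ^+ 2.
Proof.
move=> m0 A1 nm Tm h.
have m1 : 1 <= m%:R :> R by rewrite ler1n.
have A0 : 0 <= A by rewrite (le_trans _ A1).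
have h2 : m%:R ^+ m * m%:R ^+ m <= (A ^+ m * A ^+ m) * m%:R ^+ m :> R.
  apply: le_trans (ler_pM _ _ h h) _; rewrite ?exprn_ge0// mulrACA ler_wpM2l ?mulr_ge0 ?exprn_ge0//.
  by rewrite -exprD ler_weXn2l//; lia.
have := h2; rewrite ler_pM2r ?exprn_gt0 ?ltr0n// -exprMn -expr2 ler_pXn2r ?nnegrE ?exprn_ge0//.
Qed.

End zeros_are_transcendental.

Section transcendence.
Context {R : realType}.

Lemma jz_form_derivative N k (P : nat -> {poly int}) (a : nat -> int) (B c w : R) :
  0 <= c -> ebnd B c (fun m => (a m)%:~R) -> supported N P ->
  (forall z, jz_form N k P z = w * egf (fun m => (a m)%:~R) z) ->
  forall t z, jz_form N k (dsteps N k P t) z =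
    w * (z ^+ t * egfn (fun m => (a m)%:~R) t z).
Proof.
move=> c0 aB P0 P_a; elim=> [|t IH] z.
  rewrite /= P_a expr0 mul1r /egfn; congr (_ * egf _ z).
  by apply/funext => m; rewrite addn0.
have Pt0 : supported N (dsteps N k P t).
  by elim: (t) => //= t' h; exact: dstep_supported.
have [D dD DE] := dstep_form k t z Pt0.
rewrite [dsteps _ _ _ _]/(dstep N k t (dsteps N k P t)) -DE IH.
have h : is_derive z 1 (jz_form N k (dsteps N k P t))
  (w * (t%:R * z ^+ t.-1 * 1 * egfn (fun m => (a m)%:~R) t z
     + z ^+ t * egfn (fun m => (a m)%:~R) t.+1 z)).
  have -> : jz_form N k (dsteps N k P t) = fun z => w * (z ^+ t * egfn (fun m => (a m)%:~R) t z).
    by apply/funext => y; exact: IH.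
  apply: dscale; apply: dmul; first by apply: dpow; exact: did.
  rewrite (_ : egfn _ t.+1 z = egf (fun m => (a (m.+1 + t)%N)%:~R) z); last first.
    by congr (egf _ z); apply/funext => m; rewrite addSnnS.
  exact: (is_derive_egf z c0 (ebnd_shiftn t aB)).
rewrite (is_derive_unique dD h); case: t {IH Pt0 dD DE h} => [|t].
  by rewrite expr1 expr0; ring.
by rewrite /= !exprS; ring.
Qed.

Lemma power_bookkeeping (K0 Kx m x b c cx e1 ec C : R) (n T e m' : nat) :
  K0 * (Kx * (m ^+ n * (x ^+ m' * (b ^+ m' * c ^+ m' *
    (cx ^+ m' * (m ^+ T * e1 ^+ m' / m ^+ m') * ec))))) * C ^+ m' *
    (b ^+ m' * m ^+ (n + T)) ^+ e =
  K0 * Kx * ec * (x * b * c * cx * e1 * C * b ^+ e) ^+ m' *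
    m ^+ ((n + T) * e.+1) / m ^+ m'.
Proof.
rewrite mulnS [m ^+ (_ + _ * _)]exprD [m ^+ (n + T) in RHS]exprD [(_ * e)%N]mulnC.
rewrite !exprMn -!exprM [(m' * e)%N]mulnC [((n + T) * e)%N]mulnC.
move: (m ^+ n) (m ^+ T) (m ^+ (e * (n + T))) (m ^+ m') (b ^+ (e * m')) => u v u' v' w.
move: (x ^+ m') (b ^+ m') (c ^+ m') (cx ^+ m') (e1 ^+ m') (C ^+ m') => y1 y2 y3 y4 y5 y6.
ring.
Qed.

(** Let m' be the order of the auxiliary function at 0 and T its order at xi. The derivative of
    order T at xi is an integer polynomial p at xi, times a power of J_{k+1}. Up to factors c^m',
    |p(xi)| is at most m'^(n + T) / m'^m', and by Liouville at least the power -e of the height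
    m'^(n + T). Hence m'^m' <= A^m' m'^((n + T) (e + 1)), which is impossible for large m' because n
    and T are small compared with m'. *)
Lemma jz_zero_transcendental k (xi : R) (p0 : {poly int}) :
  (forall X : R, exists2 z, X < z & jz k z = 0) ->
  (forall z : R, 0 < z -> jz k z = 0 -> jz k.+1 z != 0) ->
  0 < xi -> jz k xi = 0 -> p0 != 0 -> ~~ root (map_poly intr p0) xi.
Proof.
move=> zeros sep xi0 Jxi p0N0; apply/negP => rp0.
have [K0 [C [e [K00 C1 liou]]]] := liouville p0N0 rp0.
(* D n <= m' and D T <= m' will make (n + T) (e + 1) at most m' / 2. N is such that N.+1 n = 2 M
   with M = D n, twice as many unknowns as equations. *)
pose D := (4 * e.+1)%N; pose N := (2 * D).-1.
have N1 : N.+1 = (2 * D)%N by rewrite /N prednK// /D; lia.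
pose c := (4 * N + 4)%N; pose cR : R := c%:R.
have c0 : 0 <= cR by rewrite ler0n.
have c1 : 1 <= cR by rewrite ler1n /c addn4.
pose ec := expR (cR * xi).
pose E := cR * xi * ec.
have ec1 : 0 < ec by exact: expR_gt0.
have E0 : 0 < E by rewrite !mulr_gt0// (lt_le_trans ltr01).
pose Kx := `|jz k.+1 xi|.
have Kx0 : 0 < Kx by rewrite normr_gt0; exact: sep.
pose x1 : R := Num.max 1 xi.
have x11 : 1 <= x1 by rewrite le_max lexx.
have xix1 : xi <= x1 by rewrite le_max lexx orbT.
pose e1 : R := expR 1.
have e11 : 1 <= e1 by rewrite /e1 -expR0 ler_expR.
pose w := (N * k + N * k.+1 + (4 * N + 4))%N.
pose b32 : R := 32 * cR.
have b321 : 1 <= b32 by rewrite /b32; lra.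
pose Cst : R := Num.max 1 (K0 * (Kx ^+ N)^-1 * ec).
have Cst1 : 1 <= Cst by rewrite le_max lexx.
pose A : R := Cst * (x1 * b32 * cR * (cR * x1) * e1 * C ^+ 2 * b32 ^+ e).
have A1 : 1 <= A.
  have mul1 (u v : R) : 1 <= u -> 1 <= v -> 1 <= u * v.
    by move=> h1 h2; rewrite -[leLHS]mulr1 ler_pM.
  have h1 : 1 <= C ^+ 2 by rewrite exprn_ege1.
  have h2 : 1 <= b32 ^+ e by rewrite exprn_ege1.
  exact: (mul1 _ _ Cst1 (mul1 _ _ (mul1 _ _ (mul1 _ _ (mul1 _ _ (mul1 _ _ (mul1 _ _ x11 b321) c1) (mul1 _ _ c1 x11)) e11) h1) h2)).
(* The three terms serve to bound T by m' / D, to contradict m' <= A^2 at the end, and to absorb [w]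
   into n. *)
pose bnd : R := (b32 * cR) ^+ D * E + A ^+ 2 + w%:R.
pose n' := Num.bound bnd; pose n := n'.+1.
have t1 : 0 <= (b32 * cR) ^+ D * E.
  apply: mulr_ge0; last exact: ltW.
  by apply: exprn_ge0; apply: mulr_ge0 => //; exact: le_trans ler01 b321.
have t2 : 0 <= A ^+ 2 by rewrite exprn_ge0// (le_trans _ A1).
have t3 : 0 <= w%:R :> R by rewrite ler0n.
have nbnd : bnd < n%:R.
  have : 0 <= bnd by rewrite /bnd !addr_ge0.
  by move=> /archi_boundP h; apply: (lt_le_trans h); rewrite ler_nat leqnSn.
have n_E : (b32 * cR) ^+ D * E < n%:R by apply: le_lt_trans nbnd; rewrite /bnd -addrA lerDl addr_ge0.
have n_A : A ^+ 2 < n%:R by apply: le_lt_trans nbnd; rewrite /bnd addrAC lerDr addr_ge0.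
have n_w : (w <= n)%N by rewrite -(ler_nat R) ltW//; apply: le_lt_trans nbnd; rewrite /bnd lerDr addr_ge0.
pose M := (D * n)%N.
have D0 : (0 < D)%N by rewrite /D.
have M0 : (0 < M)%N by rewrite muln_gt0 D0.
have U2M : (N.+1 * n = 2 * M)%N by rewrite N1 /M mulnA.
have [||q [a [[i0 [l0 ql0]] qb a0 ab aE]]] := @auxiliary_function R k N n M => //.
  by rewrite U2M.
rewrite U2M -/c in qb ab.
pose Qb := (4 * M * c ^ M)%N.
have Qb_E : (2 * (2 * M) * c ^ M = Qb)%N by rewrite /Qb mulnA.
rewrite Qb_E in qb ab.
pose B := (2 * M * Qb)%N.
have aB : ebnd B%:R cR (fun m => (a m)%:~R : R) by exact: ebnd_int.
(* Otherwise the form would vanish identically, against [jz_form_neq0]. *)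
have [m0 am0] : exists m, a m != 0.
  apply: contrapT => h; have ha m : a m = 0.
    by apply/eqP/negPn/negP => hm; apply: h; exists m.
  pose Q i : {poly R} := \poly_(l < n) ((q (inord i) (inord l))%:~R / l`!%:R).
  have [|z] := jz_form_neq0 (N := N) (Q := Q) zeros sep.
    exists i0; first by rewrite -ltnS.
    apply/eqP => /polyP/(_ l0); rewrite coef_poly ltn_ord coef0 !inord_val => /eqP.
    by rewrite mulf_eq0 intr_eq0 (negbTE ql0) invr_eq0 (negbTE (fact_neq0 _)).
  have := aE z; rewrite (@egf_finite _ _ 0) ?big_geq//; last by move=> m _; rewrite ha.
  move=> h0 /eqP; apply; rewrite [RHS]h0; apply: eq_bigr => i _; congr (_ * _).
  rewrite /Q horner_poly; apply: eq_bigr => l _; rewrite !inord_val.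
  by rewrite [RHS]mulrA mulrAC.
have exa : exists m, a m != 0 by exists m0.
case: (ex_minnP exa) => m' am' m'min {m0 am0 exa}.
have aM m : (m < m')%N -> a m = 0.
  by move=> mm'; apply/eqP/negPn/negP => /m'min; rewrite leqNgt mm'.
have aMR j : (j < m')%N -> (a j)%:~R = 0 :> R by move=> /aM ->.
have Mm' : (M <= m')%N by rewrite leqNgt; apply/negP => /a0 /eqP; exact/negP.
have nm' : (n <= m')%N by rewrite (leq_trans _ Mm')// /M leq_pmull.
have m'0 : (0 < m')%N by rewrite (leq_trans _ nm').
pose m : R := m'%:R.
have m_gt0 : 0 < m by rewrite ltr0n.
have m_ge1 : 1 <= m by rewrite ler1n.
have cM : (c ^ M <= c ^ m')%N by rewrite leq_exp2l// /c addn4.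
have M2 : (M < 2 ^ m')%N by rewrite (leq_trans (ltn_expl M (isT : 1 < 2)%N))// leq_exp2l.
have pow_le (u : nat) : (0 < u)%N -> (u <= u ^ m')%N.
  by move=> u0; rewrite -{1}[u]expn1 leq_pexp2l.
have Qb_le : (Qb <= (8 * c) ^ m')%N.
  rewrite /Qb (_ : 8 * c = 4 * 2 * c)%N// !expnMn leq_mul// leq_mul ?pow_le// ltnW//.
have B_le : (B <= (32 * c) ^ m')%N.
  rewrite /B (_ : 32 * c = 2 * 2 * (8 * c))%N; last by rewrite mulnA.
  by rewrite [X in (_ <= X)%N]expnMn leq_mul// expnMn leq_mul ?pow_le// ltnW.
have B_leR : B%:R <= b32 ^+ m' :> R.
  by rewrite /b32 /cR -natrM -natrX ler_nat.
(* The coefficient [a m'] is a non-zero integer, so [vanishing_bound] limits the order of vanishing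
   at xi. *)
have vanish T : (forall t, (t < T)%N -> egfn (fun m => (a m)%:~R) t xi = 0 :> R) -> (D * T <= m')%N.
  move=> hT; rewrite leqNgt; apply/negP => m'T.
  have := vanishing_bound c0 xi0 (ebndj0 aB) hT aMR.
  rewrite -/ec -/E add0n => hb.
  have h1 : (m'`!%:R)^-1 <= b32 ^+ m' * E ^+ T * cR ^+ m' / (m' + T)`!%:R :> R.
    apply: le_trans (le_trans hb _).
      rewrite ler_peMl ?invr_ge0// -intr_norm ler1z -gtz0_ge1 normr_gt0//.
    by rewrite ler_wpM2r ?invr_ge0// ler_wpM2r ?exprn_ge0// ler_wpM2r ?exprn_ge0// ltW.
  have h2 : m ^+ T <= (b32 * cR) ^+ m' * E ^+ T.
    have h3 : (m' + T)`!%:R <= m'`!%:R * ((b32 * cR) ^+ m' * E ^+ T) :> R.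
      move: h1; rewrite ler_pdivlMr ?ltr0n ?fact_gt0// mulrC ler_pdivrMr ?ltr0n ?fact_gt0//.
      by move=> h; apply: (le_trans h); rewrite le_eqVlt; apply/orP; left; apply/eqP; rewrite [(b32 * cR) ^+ m']exprMn; ring.
    have h4 : m'`!%:R * m ^+ T <= (m' + T)`!%:R :> R.
      by rewrite /m -natrX -natrM ler_nat fact_expn_le.
    by rewrite -(ler_pM2l (_ : 0 < m'`!%:R)) ?ltr0n ?fact_gt0//; exact: le_trans h4 h3.
  have bc1 : 1 <= b32 * cR by rewrite -[leLHS]mulr1 ler_pM.
  have h5 : m ^+ T <= ((b32 * cR) ^+ D * E) ^+ T.
    apply: (le_trans h2); rewrite [leRHS]exprMn -exprM ler_wpM2r ?exprn_ge0 ?(ltW E0)//.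
    by rewrite ler_weXn2l// ltnW.
  have T0 : (0 < T)%N by case: (T) m'T; rewrite ?muln0.
  move: h5; rewrite ler_pXn2r ?nnegrE ?(ltW m_gt0)// => h5.
  have := lt_le_trans n_E (_ : n%:R <= m); rewrite ler_nat => /(_ nm').
  by rewrite ltNge h5.
have exT : exists T, egfn (fun m => (a m)%:~R) T xi != 0 :> R.
  apply: contrapT => h; have /vanish : forall t, (t < m'.+1)%N -> egfn (fun m => (a m)%:~R) t xi = 0 :> R.
    by move=> t _; apply/eqP/negPn/negP => ht; apply: h; exists t.
  by rewrite leqNgt leq_pmull.
case: (ex_minnP exT) => T gT Tmin {exT}.
have DT : (D * T <= m')%N.
  by apply: vanish => t tT; apply/eqP/negPn/negP => /Tmin; rewrite leqNgt tT.
have Tm' : (T <= m')%N by rewrite (leq_trans _ DT)// leq_pmull.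
(* The factor n'! clears the denominators l! of the basis z^l / l!, as l < n = n'.+1. *)
pose P i : {poly int} := if (i <= N)%N then
   \poly_(l < n) (q (inord i) (inord l) * (n'`! %/ l`!)%N%:Z) else 0.
have Pn i : (size (P i) <= n)%N by rewrite /P; case: ifP; rewrite ?size_poly ?size_poly0.
have P0 : supported N P by move=> i; rewrite /P ltnNge => /negbTE ->.
have PH : coef_bound (Qb * n'`!)%N P.
  move=> i l; rewrite /P; case: ifP => _; last by rewrite coef0 normr0.
  rewrite coef_poly; case: ifP => _; last by rewrite normr0.
  by rewrite normrM PoszM ler_pM// ger0_norm// lez_nat leq_div.
have P_a z : jz_form N k P z = n'`!%:R * egf (fun m => (a m)%:~R) z :> R.
  rewrite aE mulr_sumr /jz_form; apply: eq_bigr => i _; rewrite [RHS]mulrA; congr (_ * _).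
  rewrite /P -ltnS ltn_ord (@horner_coef_wide _ n); last first.
    by rewrite (leq_trans (size_poly _ _))// size_poly.
  rewrite mulr_sumr; apply: eq_bigr => l _; rewrite coef_map coef_poly ltn_ord !inord_val /= intrM.
  have ln : (l <= n')%N by rewrite -ltnS.
  have := @fact_neq0 R l; have : (n'`! %/ l`! * l`!)%N = n'`! by rewrite divnK// -(bin_fact ln) mulnCA dvdn_mulr.
  move=> /(congr1 (fun x : nat => x%:R : R)); rewrite natrM => <- h.
  by rewrite -pmulrn; field.
have form := jz_form_derivative c0 aB P0 P_a T xi.
have [szP suP coP] := dsteps_bound k T Pn P0 PH.
pose p := dsteps N k P T 0%N.
have pE : (map_poly intr p).[xi] * jz k.+1 xi ^+ N =
    n'`!%:R * (xi ^+ T * egfn (fun m => (a m)%:~R) T xi).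
  rewrite -form /jz_form big_ord_recl big1 ?addr0.
    by rewrite expr0 mul1r subn0.
  by move=> i _; rewrite Jxi exprS !mul0r mulr0.
have pxi0 : (map_poly intr p).[xi] != 0.
  apply/eqP => h; move/esym/eqP: pE; rewrite h mul0r !mulf_eq0 (negbTE gT) expf_eq0 (gt_eqF xi0).
  by rewrite andbF (negbTE (fact_neq0 _)).
pose H := (Qb * n'`! * (n + 2 * T + w) ^ T)%N.
have pH l : `|p`_l|%:~R <= H%:R :> R.
  by rewrite -[H%:R]/(H%:Z%:~R) ler_int; exact: coP.
have := liou p (n + T)%N H%:R (szP 0%N) pH pxi0.
set X := `|_|; move=> final.
have n'_le : n'`!%:R <= m ^+ n :> R.
  rewrite /m -natrX ler_nat (leq_trans (fact_le_expn (leqnn n')))//.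
  apply: (@leq_trans (m' ^ n')); last by rewrite leq_pexp2l.
  by case: (posnP n') => [->//|n'0]; rewrite leq_exp2r// ltnW.
have XE : X = (Kx ^+ N)^-1 * (n'`!%:R * (xi ^+ T * `|egfn (fun m => (a m)%:~R) T xi|)).
  have := congr1 Num.norm pE; rewrite !normrM !normrX normr_nat (gtr0_norm xi0) -/X -/Kx => <-.
  by rewrite mulrC mulfK// expf_neq0 ?gt_eqF.
have b2 : xi ^+ T <= x1 ^+ m'.
  apply: (@le_trans _ _ (x1 ^+ T)); last by rewrite ler_weXn2l.
  by rewrite lerXn2r ?nnegrE ?(ltW xi0)// (le_trans ler01).
have b4 : cR ^+ T <= cR ^+ m' by rewrite ler_weXn2l.
have cx1 : 1 <= cR * x1 by rewrite -[leLHS]mulr1 ler_pM.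
have b5 : (cR * xi) ^+ (m' - T) <= (cR * x1) ^+ m'.
  apply: (@le_trans _ _ ((cR * x1) ^+ (m' - T))); last by rewrite ler_weXn2l// leq_subr.
  by rewrite lerXn2r ?nnegrE ?ler_wpM2l// mulr_ge0// ?(ltW xi0)// (le_trans ler01).
(* From m'^m' <= exp(1)^m' m'! and m'! <= (m' - T)! m'^T. *)
have b6 : ((m' - T)`!%:R)^-1 <= m ^+ T * e1 ^+ m' / m ^+ m' :> R.
  rewrite -[leLHS]mul1r ler_pdivrMr ?ltr0n ?fact_gt0// mulrAC ler_pdivlMr ?exprn_gt0// mul1r.
  apply: (le_trans (expn_fact_expR m')); rewrite -mulrA mulrCA ler_wpM2l ?exprn_ge0 ?(le_trans _ e11)//.
  by rewrite mulrC /m -natrX -natrM ler_nat fact_sub_le.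
have b7 : C ^+ (n + T) <= (C ^+ 2) ^+ m'.
  by rewrite -exprM ler_weXn2l// mul2n -addnn leq_add.
have gT_le : `|egfn (fun m => (a m)%:~R) T xi| <=
    b32 ^+ m' * cR ^+ m' * ((cR * x1) ^+ m' * (m ^+ T * e1 ^+ m' / m ^+ m') * ec).
  have aBT := ebnd_shiftn T aB.
  have aTR j : (j < m' - T)%N -> (a (j + T)%N)%:~R = 0 :> R.
    by rewrite ltn_subRL addnC => /aM ->.
  have := egf_tail xi c0 aBT aTR.
  rewrite (gtr0_norm xi0) -/ec => h; apply: (le_trans h).
  have f0 : 0 <= (cR * xi) ^+ (m' - T) by rewrite exprn_ge0// mulr_ge0// (ltW xi0).
  apply: ler_pM => //.
  - by rewrite mulr_ge0// exprn_ge0.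
  - by rewrite !mulr_ge0// ?invr_ge0// (ltW ec1).
  - by rewrite ler_pM// exprn_ge0.
  - by rewrite ler_wpM2r ?(ltW ec1)// ler_pM// invr_ge0.
have b8 : H%:R <= b32 ^+ m' * m ^+ (n + T) :> R.
  have HE : H%:R = Qb%:R * n'`!%:R * (n + 2 * T + w)%:R ^+ T :> R.
    by rewrite -natrX -natrM -natrM.
  rewrite HE exprD.
  have h1 : (n + 2 * T + w)%:R ^+ T <= 4 ^+ m' * m ^+ T :> R.
    apply: (@le_trans _ _ ((4 * m) ^+ T)).
      rewrite lerXn2r ?nnegrE ?ler0n ?mulr_ge0 ?(ltW m_gt0)// /m -natrM ler_nat.
      by have := n_w; have := nm'; have := Tm'; clear; lia.
    rewrite [leLHS]exprMn; apply: ler_wpM2r; first by rewrite exprn_ge0// ltW.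
    by apply: ler_weXn2l => //; rewrite ler1n.
  have h2 : Qb%:R <= (8 * cR) ^+ m' :> R by rewrite /cR -natrM -natrX ler_nat.
  have -> : b32 ^+ m' * (m ^+ n * m ^+ T) = (8 * cR) ^+ m' * m ^+ n * (4 ^+ m' * m ^+ T).
    rewrite /b32 (_ : 32 * cR = 8 * cR * 4); last by ring.
    by rewrite [(8 * cR * 4) ^+ m']exprMn mulrACA [4 ^+ m' * _]mulrC !mulrA.
  by apply: ler_pM => //; apply: ler_pM.
have m0' : 0 <= m by exact: ltW.
have X_le : X <= (Kx ^+ N)^-1 * (m ^+ n * (x1 ^+ m' *
   (b32 ^+ m' * cR ^+ m' * ((cR * x1) ^+ m' * (m ^+ T * e1 ^+ m' / m ^+ m') * ec)))).
  rewrite XE ler_wpM2l ?invr_ge0 ?exprn_ge0 ?(ltW Kx0)// ler_pM// ?mulr_ge0 ?exprn_ge0 ?(ltW xi0)//.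
  by rewrite ler_pM// exprn_ge0// ltW.
have X0 : 0 <= X by exact: normr_ge0.
have C0' : 0 <= C by rewrite (le_trans _ C1).
have final2 : 1 <= K0 * ((Kx ^+ N)^-1 * (m ^+ n * (x1 ^+ m' *
   (b32 ^+ m' * cR ^+ m' * ((cR * x1) ^+ m' * (m ^+ T * e1 ^+ m' / m ^+ m') * ec)))))
   * (C ^+ 2) ^+ m' * (b32 ^+ m' * m ^+ (n + T)) ^+ e.
  have KX0 : 0 <= K0 * X by apply: mulr_ge0 => //; exact: ltW.
  have CnT0 : 0 <= C ^+ (n + T) by exact: exprn_ge0.
  have H0 : 0 <= H%:R :> R by rewrite ler0n.
  apply: (le_trans final); apply: ler_pM.
  - exact: mulr_ge0.
  - exact: exprn_ge0.
  - by apply: ler_pM => //; apply: ler_wpM2l => //; exact: ltW.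
  - by rewrite lerXn2r// nnegrE; apply: le_trans b8.
have final3 : m ^+ m' <= A ^+ m' * m ^+ ((n + T) * e.+1).
  have : m ^+ m' <= (K0 * (Kx ^+ N)^-1 * ec) * ((x1 * b32 * cR * (cR * x1) * e1 * C ^+ 2 * b32 ^+ e) ^+ m')
       * m ^+ ((n + T) * e.+1).
    rewrite -[leLHS]mul1r -ler_pdivlMr ?exprn_gt0//; apply: (le_trans final2).
    rewrite le_eqVlt; apply/orP; left; apply/eqP.
    exact: power_bookkeeping.
  move=> h; apply: (le_trans h); rewrite ler_wpM2r ?exprn_ge0// /A [leRHS]exprMn.
  rewrite ler_wpM2r//.
    by rewrite exprn_ge0// !mulr_ge0// ?exprn_ge0// (le_trans _ x11, le_trans _ b321, le_trans _ e11).
  apply: (@le_trans _ _ Cst); first by rewrite le_max lexx orbT.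
  by rewrite -{1}[Cst]expr1 ler_weXn2l.
have nD : (4 * e.+1 * n <= m')%N by exact: Mm'.
have := exponent_comparison m'0 A1 nD DT final3.
by apply/negP; rewrite -ltNge (lt_le_trans n_A)// ler_nat.
Qed.

End transcendence.

(** * Location of the zeros of Bessel functions *)

Section mean_value.
Context {R : realType}.
Implicit Types (f df : R -> R) (a b x : R).

Lemma mvt f df a b : a < b ->
  (forall x, a <= x <= b -> is_derive x 1 f (df x)) ->
  exists2 c, a < c < b & f b - f a = df c * (b - a).
Proof.
move=> ab fd.
have [||c cab E] := @MVT R f df a b ab.
- by move=> x; rewrite in_itv/= => /andP[ax xb]; apply: fd; rewrite !ltW.
- apply: continuous_in_subspaceT => x; rewrite inE/= in_itv/= => xab.
  exact: is_derive_continuous (fd _ xab).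
- by exists c => //; move: cab; rewrite in_itv.
Qed.

Lemma derive_ge0_le f df a b : a <= b ->
  (forall x, a <= x <= b -> is_derive x 1 f (df x)) ->
  (forall x, a < x < b -> 0 <= df x) -> f a <= f b.
Proof.
rewrite le_eqVlt => /predU1P[-> //|ab] fd df0.
have [c cab E] := mvt ab fd.
by rewrite -subr_ge0 E mulr_ge0 ?df0// subr_ge0 ltW.
Qed.

Lemma derive_le0_ge f df a b : a <= b ->
  (forall x, a <= x <= b -> is_derive x 1 f (df x)) ->
  (forall x, a < x < b -> df x <= 0) -> f b <= f a.
Proof.
move=> ab fd df0; rewrite -lerN2.
apply: (@derive_ge0_le (fun x => - f x) (fun x => - df x)) => // x xab.
  exact/dopp/fd.
by rewrite oppr_ge0 df0.
Qed.

Lemma derive_eq0_eq f a b : a <= b ->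
  (forall x, a <= x <= b -> is_derive x 1 f 0) -> f a = f b.
Proof.
move=> ab fd; apply/eqP; rewrite eq_le.
by rewrite (derive_ge0_le ab fd)//= (derive_le0_ge ab fd).
Qed.

Lemma ivt_root f a b : a <= b -> (forall x, a <= x <= b -> {for x, continuous f}) ->
  f a * f b <= 0 -> exists2 c, a <= c <= b & f c = 0.
Proof.
move=> ab fc fab.
have [||c cab fc0] := @IVT R f a b 0 ab.
- apply: continuous_in_subspaceT => x; rewrite inE/= in_itv/= => xab; exact: fc.
- rewrite ge_min le_max; move: fab.
  have [fa|fa] := leP (f a) 0; have [fb|fb] := leP (f b) 0 => //= h.
  + by apply/orP; move: fa; rewrite le_eqVlt => /predU1P[->|fa]; [left|right; rewrite -(nmulr_rle0 _ fa) ]; rewrite ?lexx//.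
  + by rewrite (ltW fb) orbT.
  + by rewrite (ltW fa).
  + by have := mulr_gt0 fa fb; rewrite ltNge h.
- by exists c => //; move: cab; rewrite in_itv.
Qed.

Lemma no_root_sign f a b : (forall x, a < x < b -> {for x, continuous f}) ->
  (forall x, a < x < b -> f x != 0) ->
  forall x y, a < x < b -> a < y < b -> 0 < f x -> 0 < f y.
Proof.
move=> fc f0 x y xab yab fx; rewrite ltNge; apply/negP => fy.
wlog xy : x y f fc f0 xab yab fx fy / x <= y => [H|].
  have [xy|yx] := leP x y; first exact: (H x y f).
  have fyN : f y < 0 by rewrite lt_neqAle fy f0.
  apply: (H y x (fun z => - f z)); rewrite ?oppr_gt0 ?oppr_le0 ?(ltW fx) ?(ltW yx)//.
  - by move=> z zab; apply: continuousN; exact: fc.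
  - by move=> z zab; rewrite oppr_eq0 f0.
have [||c /andP[xc cy]] := @ivt_root f x y xy.
- move=> z /andP[xz zy]; apply: fc; move: xab yab => /andP[ax _] /andP[_ yb].
  by rewrite (lt_le_trans ax)// (le_lt_trans zy).
- by rewrite pmulr_rle0.
- apply/eqP; apply: f0; move: xab yab => /andP[ax _] /andP[_ yb].
  by rewrite (lt_le_trans ax)// (le_lt_trans cy).
Qed.

Lemma next_root f a c : a < c -> f c = 0 -> (forall x, a < x -> {for x, continuous f}) ->
  (exists2 d, 0 < d & forall x, a < x < a + d -> f x != 0) ->
  exists b, [/\ a < b, b <= c, f b = 0 & forall x, a < x < b -> f x != 0].
Proof.
move=> ac fc fcont [d d0 hd].
pose Z := [set y | a < y /\ f y = 0].
have lbZ : has_lbound Z by exists a => y [/ltW].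
have hZ : has_inf Z by split => //; exists c.
pose b := inf Z.
have db : a + d <= b.
  apply: lb_le_inf; first by exists c.
  move=> y [ay fy]; rewrite leNgt; apply/negP => yd.
  by have := hd y; rewrite ay yd fy eqxx => /(_ isT).
have ab : a < b by rewrite (lt_le_trans _ db)// ltrDl.
exists b; split => //; first by apply: ge_inf.
  apply/eqP/negPn/negP => fb0.
  have [|e e0 he] := continuous_epsilon (fcont _ ab) (e := `|f b|).
    by rewrite normr_gt0.
  have [y [ay fy] yb] := inf_adherent e0 hZ.
  have b_y : b <= y by apply: ge_inf.
  have := he y; rewrite fy sub0r normrN ltxx => /(_ _)/negP; apply => //.
  by rewrite ger0_norm ?subr_ge0// ltrBlDr addrC.
move=> x /andP[ax xb]; apply/eqP => fx.
by have := ge_inf lbZ (conj ax fx); rewrite leNgt xb.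
Qed.

End mean_value.

(** * Sturm comparison and enumeration of the zeros *)

Section bessel_zeros.
Context {R : realType}.
Implicit Types (k n : nat) (x z a b w : R).

Lemma bh0 k : bh k (0 : R) = (k`!%:R)^-1.
Proof.
apply: lim_near_cst => //; exists 1%N => // -[//|n] _.
rewrite /pseries/series/= big_nat_recl// big1 ?addr0; last first.
  by move=> i _; rewrite expr0n/= mulr0.
by rewrite /bh_coeff fact0 !expr0 divr1 mulr1 mul1r add0n.
Qed.

(** The constant term 1 / n! dominates the rest of the series, which is at most exp|t| / (n +
    1)!. *)
Lemma bh_large_neq0 n t : expR `|t| < n.+1%:R -> bh n t != 0 :> R.
Proof.
move=> tn; pose e : R^nat := fun m => (m == 0%N)%:R / n`!%:R.
pose r : R^nat := fun m => if m is 0%N then 0 else bh_coeff n m.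
have eB : ebnd (n`!%:R)^-1 1 e.
  move=> m; rewrite expr1n mulr1 /e normrM normfV !normr_nat ler_piMl//.
  by case: (m == 0%N).
have rB : ebnd (n.+1`!%:R)^-1 1 r.
  case=> [|m]; first by rewrite normr0 expr0 mulr1.
  rewrite expr1n mulr1 /r /bh_coeff normrM normrX normrN1 expr1n mul1r normfV normr_nat.
  rewrite lef_pV2 ?posrE ?ltr0n ?fact_gt0// ler_nat addSn.
  by rewrite addnC -addSn (leq_trans _ (fact_mul_le n.+1 m))// leq_pmulr// fact_gt0.
have E : bh n t = (n`!%:R)^-1 + egf r t.
  rewrite -[(n`!%:R)^-1](_ : egf e t = _); last first.
    rewrite (@egf_finite _ _ 1); first by rewrite big_nat1 /e fact0 expr0 divr1 mulr1 mul1r.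
    by case=> // m _; rewrite /e mul0r.
  rewrite -(egfD _ ler01 ler01 eB rB); congr (egf _ t); apply/funext => -[|m].
    by rewrite /e /r /bh_coeff expr0 add0n addr0.
  by rewrite /e /r mul0r add0r.
have h := normr_egf_le t ler01 rB; rewrite mul1r in h.
rewrite E; apply/eqP => /eqP; rewrite addr_eq0 => /eqP E0.
have : (n`!%:R)^-1 <= (n.+1`!%:R)^-1 * expR `|t| :> R.
  by apply: le_trans h; rewrite -[egf r t]opprK -E0 normrN ger0_norm// invr_ge0.
rewrite mulrC ler_pdivlMr ?ltr0n ?fact_gt0// mulrC factS natrM mulfK ?fact_neq0//.
by rewrite leNgt tn.
Qed.

(** By the recurrence, a common zero of two consecutive orders is a zero of all higher orders, which
    [bh_large_neq0] excludes for large orders. *)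
Lemma jz_no_common_root k z : 0 < z -> jz k z = 0 -> jz k.+1 z != 0.
Proof.
move=> z0 J0; apply/eqP => K0.
have all n : jz (n + k) z = 0 /\ jz (n + k).+1 z = 0.
  elim: n => [//|n [h1 h2]]; split; first by rewrite addSn.
  apply: (mulfI (lt0r_neq0 z0)); rewrite mulr0 addSn jz_rec h1 h2; ring.
pose n := Num.bound (expR `|z ^+ 2|).
have [/eqP] := all n; rewrite mulf_eq0 expf_eq0 (gt_eqF z0) andbF/= => h _.
have := @bh_large_neq0 (n + k) (z ^+ 2); rewrite h => /(_ _)/negP; apply => //.
apply: lt_le_trans (archi_boundP _) _; first exact: expR_ge0.
by rewrite ler_nat leqW// leq_addr.
Qed.

(** This is J_k(x), see [besselJE]. *)
Definition bj k x : R := jz k (x / 2).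

(* The Euler derivative [x J_k'(x)], meaningful at 0 as well. *)
Definition ebj k x : R := k%:R * bj k x - x * bj k.+1 x.

Lemma is_derive_bj k x : x != 0 -> is_derive x 1 (bj k) (ebj k x / x).
Proof.
move=> x0; have x20 : x / 2 != 0 by rewrite mulf_neq0 ?invr_eq0.
have h : is_derive x 1 (bj k) _ := dcomp (g := fun y => y / 2) (is_derive_jz k x20)
   (dmul (did x) (dcst 2^-1 x)).
apply: (is_derive_eq h); rewrite /ebj /bj.
by field.
Qed.

(** Bessel's equation in Euler form, (x d/dx)^2 J_k = (k^2 - x^2) J_k. *)
Lemma is_derive_ebj k x : x != 0 ->
  is_derive x 1 (ebj k) ((k%:R ^+ 2 - x ^+ 2) / x * bj k x).
Proof.
move=> x0.
have h : is_derive x 1 (ebj k) _ := dsub (dscale k%:R (is_derive_bj k x0))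
  (dmul (did x) (is_derive_bj k.+1 x0)).
apply: (is_derive_eq h); rewrite /ebj.
have := jz_rec k (x / 2); rewrite -/(bj k.+2 x) -/(bj k.+1 x) -/(bj k x) => E.
have -> : x * bj k.+2 x = 2 * (k.+1%:R * bj k.+1 x - x / 2 * bj k x) by rewrite -E; field.
by rewrite -!natr1; field.
Qed.

Lemma continuous_bj k x : 0 < x -> {for x, continuous (bj k)}.
Proof. by move=> x0; exact: is_derive_continuous (is_derive_bj k (lt0r_neq0 x0)). Qed.

Lemma bj_simple_root k x : 0 < x -> bj k x = 0 -> ebj k x != 0.
Proof.
move=> x0 J0; rewrite /ebj J0 mulr0 sub0r oppr_eq0; apply: mulf_neq0; first exact: lt0r_neq0.
by apply: jz_no_common_root J0; rewrite divr_gt0.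
Qed.

Lemma bj_gt0_near0 k : exists2 d, 0 < d & forall x, 0 < x < d -> 0 < bj k x.
Proof.
have c : 0 < (k`!%:R)^-1 :> R by rewrite invr_gt0 ltr0n fact_gt0.
have [d d0 hd] := continuous_epsilon (is_derive_continuous (is_derive_bh k (0 : R))) c.
exists (Num.min 1 d); first by rewrite lt_min ltr01.
move=> x /andP[x0]; rewrite lt_min => /andP[x1 xd].
rewrite /bj /jz mulr_gt0// ?exprn_gt0 ?divr_gt0//.
have := hd ((x / 2) ^+ 2); rewrite subr0 bh0 ger0_norm; last by rewrite exprn_ge0// divr_ge0// ltW.
have : (x / 2) ^+ 2 < d by nra.
move=> h /(_ h); rewrite ltr_norml ltrBrDl subrr => /andP[+ _]; by [].
Qed.

(* Sturm comparison with [sin (w ln x)], which solves the Euler equation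
   [x (x y')' + w^2 y = 0]; no change of unknown to remove the first order term
   is then needed. *)
Definition wsturm k w a x : R :=
  ebj k x * sin (w * (ln x - ln a)) - w * bj k x * cos (w * (ln x - ln a)).

Lemma is_derive_wsturm k w a x : 0 < x ->
  is_derive x 1 (wsturm k w a)
    ((w ^+ 2 + k%:R ^+ 2 - x ^+ 2) / x * bj k x * sin (w * (ln x - ln a))).
Proof.
move=> x0; have xN0 := lt0r_neq0 x0.
have dphi : is_derive x 1 (fun y => w * (ln y - ln a)) _ :=
  dscale w (dsub (is_derive1_ln x0) (dcst (ln a) x)).
have h : is_derive x 1 (wsturm k w a) _ :=
  dsub (dmul (is_derive_ebj k xN0) (dcomp (f := sin) (g := fun y => w * (ln y - ln a)) (is_derive_sin _) dphi))
    (dmul (dscale w (is_derive_bj k xN0)) (dcomp (f := cos) (g := fun y => w * (ln y - ln a)) (is_derive_cos _) dphi)).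
apply: (is_derive_eq h).
by set s := sin _; set c := cos _; field.
Qed.

(** The window is one half-period of sin (w ln (x / a)). If J_k > 0 on it, [wsturm] is nonincreasing
    there because x^2 >= k^2 + w^2, yet it goes from - w J_k(a) <= 0 to w J_k(b) > 0. The sign [s]
    in [key] covers the case J_k < 0. *)
Lemma bj_root_window k a w : 0 < a -> 0 < w -> k%:R ^+ 2 + w ^+ 2 <= a ^+ 2 ->
  exists2 x, a < x <= a * expR (pi / w) & bj k x = 0.
Proof.
move=> a0 w0 kwa; set b := a * expR (pi / w).
have b0 : 0 < b by rewrite mulr_gt0 ?expR_gt0.
have wpi : 0 < pi / w :> R by rewrite divr_gt0// pi_gt0.
have ab : a < b by rewrite /b ltr_pMr// expR_gt1.
have lnb : ln b = ln a + pi / w by rewrite lnM ?posrE ?expR_gt0// expRK.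
apply: contrapT => nroot.
have J0 x : a < x <= b -> bj k x != 0.
  by move=> xab; apply/eqP => Jx; apply: nroot; exists x.
have key (s : R) : (s == 1) || (s == -1) -> (forall x, a < x <= b -> 0 < s * bj k x) -> False.
  move=> s1 Jpos.
  have Jc : {for a, continuous (fun x => s * bj k x)}.
    by apply: is_derive_continuous (dscale s (is_derive_bj k (lt0r_neq0 a0))).
  have Ja : 0 <= s * bj k a.
    rewrite leNgt; apply/negP => Ja.
    have [d d0 hd] := continuous_epsilon Jc (e := - (s * bj k a)) ltac:(by rewrite oppr_gt0).
    pose h := Num.min d (b - a) / 2.
    have m0 : 0 < Num.min d (b - a) by rewrite lt_min d0 subr_gt0.
    have h0 : 0 < h by rewrite divr_gt0.
    have : h < Num.min d (b - a) by rewrite /h ltr_pdivrMr// ltr_pMr// ltr1n.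
    rewrite lt_min => /andP[hd1 hba].
    have := hd (a + h); rewrite [a + h - a]addrAC subrr add0r gtr0_norm// => /(_ hd1).
    have := Jpos (a + h); rewrite ltrDl h0 -lerBrDl (ltW hba) => /(_ isT) p.
    by rewrite ltr_norml => /andP[_]; rewrite ltrBlDr addNr; apply/negP; rewrite -leNgt ltW.
  have : s * wsturm k w a b <= s * wsturm k w a a.
    apply: (@derive_le0_ge _ (fun x => s * wsturm k w a x)
      (fun x => s * ((w ^+ 2 + k%:R ^+ 2 - x ^+ 2) / x * bj k x * sin (w * (ln x - ln a)))) a b (ltW ab)).
      by move=> x /andP[ax _]; apply: dscale; apply: is_derive_wsturm; exact: lt_le_trans ax.
    move=> x /andP[ax xb]; have x0 := lt_trans a0 ax.
    have sx : 0 < sin (w * (ln x - ln a)).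
      apply: sin_gt0_pi; rewrite mulr_gt0 ?subr_gt0 ?ltr_ln ?posrE//=.
      have : ln x < ln b by rewrite ltr_ln ?posrE.
      by rewrite lnb -ltrBlDl ltr_pdivlMr// mulrC.
    rewrite (_ : s * _ = (w ^+ 2 + k%:R ^+ 2 - x ^+ 2) * (x^-1 * (s * bj k x) * sin (w * (ln x - ln a)))); last by ring.
    apply: mulr_le0_ge0.
      by rewrite subr_le0 addrC (le_trans kwa)// ler_sqr ?nnegrE ltW.
    apply: mulr_ge0; last exact: ltW.
    apply: mulr_ge0; first by rewrite invr_ge0 ltW.
    by apply/ltW/Jpos; rewrite ax ltW.
  rewrite /wsturm subrr mulr0 sin0 cos0 lnb [ln a + _]addrC addrK [w * _]mulrC divfK ?lt0r_neq0//.
  rewrite sinpi cospi.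
  have Jb := Jpos b; rewrite ab lexx in Jb; have {}Jb := Jb isT.
  by nra.
have sgn x y : a < x <= b -> a < y <= b -> 0 < bj k x -> 0 < bj k y.
  move=> xab yab; rewrite !ltNge => Jx; apply/negP => Jy.
  have {}Jx : 0 < bj k x by rewrite ltNge.
  have posz z : a < z -> 0 < z by exact: lt_trans.
  have [xy|yx] := leP x y.
    have [||c /andP[xc cy] Jc] := @ivt_root _ (bj k) x y xy.
    + move=> z /andP[xz _]; apply: continuous_bj; move: xab => /andP[ax _].
      by rewrite (lt_le_trans _ xz)// posz.
    + by rewrite pmulr_rle0.
    + have := J0 c; rewrite Jc eqxx => /(_ _)/negP; apply => //.
      by move: xab yab => /andP[ax _] /andP[_ yb]; rewrite (lt_le_trans ax)// (le_trans cy).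
  have [||c /andP[xc cy] Jc] := @ivt_root _ (bj k) y x (ltW yx).
  + move=> z /andP[xz _]; apply: continuous_bj; move: yab => /andP[ay _].
    by rewrite (lt_le_trans _ xz)// posz.
  + by rewrite pmulr_lle0.
  + have := J0 c; rewrite Jc eqxx => /(_ _)/negP; apply => //.
    by move: xab yab => /andP[_ xb] /andP[ay _]; rewrite (lt_le_trans ay)// (le_trans cy).
have bb : a < b <= b by rewrite ab lexx.
have [Jb|Jb|/eqP] := ltgtP (bj k b) 0; last by rewrite (negbTE (J0 _ bb)).
- apply: (key (-1)); rewrite ?eqxx ?orbT// => x xab; rewrite mulN1r oppr_gt0.
  rewrite lt_neqAle J0//= leNgt; apply/negP => Jx.
  by have := sgn _ _ xab bb Jx; rewrite ltNge (ltW Jb).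
- by apply: (key 1); rewrite ?eqxx// => x xab; rewrite mul1r (sgn _ _ bb xab).
Qed.

Lemma bj_unbounded_roots k X : exists2 x, X < x & bj k x = 0.
Proof.
pose a := Num.max X (k%:R + 1).
have a1 : k%:R + 1 <= a by rewrite le_max lexx orbT.
have k0 : 0 <= k%:R :> R by [].
have [||x /andP[ax _] Jx] := @bj_root_window k a 1 _ ltr01.
- by lra.
- by nra.
- by exists x => //; rewrite (le_lt_trans _ ax)// le_max lexx.
Qed.

(** Up to k, the right-hand side of Bessel's equation has the sign of J_k. Before a first zero b <=
    k the Euler derivative [ebj] would be nondecreasing, hence nonnegative since its lower limit at
    the origin is not negative; then J_k would be nondecreasing, and J_k(b) > 0. *)
Lemma bj_no_small_root k x : 0 < x <= k%:R -> bj k x != 0.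
Proof.
move=> /andP[x0 xk]; apply/eqP => Jx.
have k0 : (0 < k)%N by rewrite -(ltr0n R) (lt_le_trans x0).
have [d d0 hd] := bj_gt0_near0 k.
have [b [b0 bx Jb before]] : exists b, [/\ 0 < b, b <= x, bj k b = 0 &
    forall y, 0 < y < b -> bj k y != 0].
  apply: next_root => //; first exact: continuous_bj.
  by exists d => // y; rewrite add0r => /hd /lt0r_neq0.
have db : d <= b.
  by rewrite leNgt; apply/negP => bd; have := hd b; rewrite b0 bd Jb ltxx => /(_ isT).
have pos y : 0 < y < b -> 0 < bj k y.
  move=> yb; apply: (@no_root_sign _ (bj k) 0 b _ before (d / 2) y) => //.
  - by move=> z /andP[z0 _]; exact: continuous_bj.
  - by rewrite divr_gt0//= (lt_le_trans _ db)// ltr_pdivrMr// ltr_pMr// ltr1n.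
  - by apply: hd; rewrite divr_gt0//= ltr_pdivrMr// ltr_pMr// ltr1n.
have ebj0 y : 0 < y < b -> 0 <= ebj k y.
  move=> /andP[y0 yb]; rewrite leNgt; apply/negP => ey.
  (* So close to 0 that x' J_{k+1}(x') <= x' exp(y) < - [ebj k y]. *)
  pose x' := Num.min y (- ebj k y / expR y) / 2.
  have m0 : 0 < Num.min y (- ebj k y / expR y).
    by rewrite lt_min y0 divr_gt0 ?oppr_gt0 ?expR_gt0.
  have x'0 : 0 < x' by rewrite divr_gt0.
  have : x' < Num.min y (- ebj k y / expR y) by rewrite /x' ltr_pdivrMr// ltr_pMr// ltr1n.
  rewrite lt_min => /andP[x'y]; rewrite ltr_pdivlMr ?expR_gt0// => x'e.
  have e1 : ebj k x' <= ebj k y.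
    apply: (@derive_ge0_le _ _ (fun t => (k%:R ^+ 2 - t ^+ 2) / t * bj k t)); first exact: ltW.
      by move=> t /andP[xt _]; apply/is_derive_ebj/lt0r_neq0; exact: lt_le_trans xt.
    move=> t /andP[xt ty]; have t0 := lt_trans x'0 xt.
    apply: mulr_ge0; last by rewrite ltW// pos// t0 (lt_trans ty).
    apply: mulr_ge0; last by rewrite invr_ge0 ltW.
    rewrite subr_ge0 ler_sqr ?nnegrE ?(ltW t0)//.
    by rewrite (le_trans (ltW (lt_trans ty yb)))// (le_trans bx).
  have jb : `|bj k.+1 x'| <= expR y.
    rewrite /bj jz_egf.
    have eB : ebnd 1 2 (fun m => (jz_coeff k.+1 m)%:~R : R).
      move=> m; rewrite mul1r -intr_norm -natrX.
      by rewrite -[_%:R]/((2 ^ m)%N%:Z%:~R) ler_int; exact: jz_coeff_le.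
    apply: le_trans (normr_egf_le (x' / 2) (ler0n R 2) eB) _.
    have hx : `|x' / 2| = x' / 2 by rewrite gtr0_norm// divr_gt0.
    by rewrite mul1r ler_expR hx; lra.
  have jp : 0 <= bj k x' by rewrite ltW// pos// x'0 (lt_trans x'y).
  have : x' * bj k.+1 x' <= x' * expR y.
    by rewrite ler_pM2l//; exact: le_trans (ler_norm _) jb.
  have : 0 <= k%:R * bj k x' by rewrite mulr_ge0.
  by move: e1 x'e; rewrite /ebj; lra.
have d2b : d / 2 < b by rewrite (lt_le_trans _ db)// ltr_pdivrMr// ltr_pMr// ltr1n.
have d20 : 0 < d / 2 by rewrite divr_gt0.
have : bj k (d / 2) <= bj k b.
  apply: (@derive_ge0_le _ _ (fun t => ebj k t / t)); first exact: ltW.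
    by move=> t /andP[dt _]; apply/is_derive_bj/lt0r_neq0; exact: lt_le_trans dt.
  move=> t /andP[dt tb]; rewrite divr_ge0 ?ebj0 ?tb ?(lt_trans _ dt)//.
  by rewrite ltW// (lt_trans _ dt).
by rewrite Jb leNgt pos// d20.
Qed.

Lemma bj_next_root k a : 0 <= a ->
  exists b, [/\ a < b, bj k b = 0 & forall x, a < x < b -> bj k x != 0].
Proof.
move=> a0; have [c ac Jc] := bj_unbounded_roots k a.
have [||b [ab _ Jb hb]] := @next_root _ (bj k) a c ac Jc; last by exists b.
- by move=> x ax; apply: continuous_bj; exact: le_lt_trans ax.
- move: a0; rewrite le_eqVlt => /predU1P[<-|a0].
    have [d d0 hd] := bj_gt0_near0 k; exists d => // x.
    by rewrite add0r => /hd /lt0r_neq0.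
  have [Ja|Ja] := eqVneq (bj k a) 0.
    have [|d d0 hd] := isolated_zero (is_derive_bj k (lt0r_neq0 a0)) _ Ja.
      by rewrite mulf_neq0 ?bj_simple_root// invr_eq0 lt0r_neq0.
    exists d => // x /andP[ax xd]; apply: hd; first by rewrite gt_eqF.
    by rewrite gtr0_norm ?subr_gt0// ltrBlDl.
  have [|d d0 hd] := continuous_epsilon (continuous_bj (k := k) a0) (e := `|bj k a|).
    by rewrite normr_gt0.
  exists d => // x /andP[ax xd]; apply/eqP => Jx.
  have := hd x; rewrite gtr0_norm ?subr_gt0// ltrBlDl => /(_ xd).
  by rewrite Jx sub0r normrN ltxx.
Qed.

Definition next_bj_root k a := xget 0 [set b |
  [/\ a < b, bj k b = 0 & forall x, a < x < b -> bj k x != 0]].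

Lemma next_bj_rootP k a : 0 <= a -> [/\ a < next_bj_root k a,
  bj k (next_bj_root k a) = 0 & forall x, a < x < next_bj_root k a -> bj k x != 0].
Proof. by move=> a0; apply: (xgetPex 0 (bj_next_root k a0)). Qed.

(* The positive zeros of [J_k], numbered from 0. *)
Fixpoint bjz k n : R := next_bj_root k (if n is n'.+1 then bjz k n' else 0).

Lemma bjz_gt0 k n : 0 < bjz k n.
Proof.
elim: n => [|n IH] /=; first by have [] := next_bj_rootP k (lexx 0).
by have [h _ _] := next_bj_rootP k (ltW IH); exact: lt_trans h.
Qed.

Lemma bjz_lt k n : bjz k n < bjz k n.+1.
Proof. by have [] := next_bj_rootP k (ltW (bjz_gt0 k n)). Qed.

Lemma bjz_root k n : bj k (bjz k n) = 0.
Proof.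
case: n => [|n]; first by have [] := next_bj_rootP k (lexx 0).
by have [] := next_bj_rootP k (ltW (bjz_gt0 k n)).
Qed.

Lemma bjz_consecutive k n x : bjz k n < x < bjz k n.+1 -> bj k x != 0.
Proof. by have [_ _] := next_bj_rootP k (ltW (bjz_gt0 k n)); apply. Qed.

Lemma bjz_first k x : 0 < x < bjz k 0 -> bj k x != 0.
Proof. by have [_ _] := next_bj_rootP k (lexx 0); apply. Qed.

Lemma bjz_le k : {homo bjz k : m n / (m <= n)%N >-> m <= n}.
Proof. by apply: homo_leq => //; [exact: le_trans|move=> n; exact/ltW/bjz_lt]. Qed.

Lemma bjz_mono k : {mono bjz k : m n / (m <= n)%N >-> m <= n}.
Proof.
move=> m n; apply/idP/idP; last exact: bjz_le.
apply: contraTT; rewrite -ltnNge -ltNge => nm.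
exact: lt_le_trans (bjz_lt k n) (bjz_le k nm).
Qed.

Lemma bjz_gt_order k n : k%:R < bjz k n.
Proof.
rewrite ltNge; apply/negP => h.
by have := @bj_no_small_root k (bjz k n); rewrite bjz_gt0 h bjz_root eqxx => /(_ isT).
Qed.

Lemma bjz_next_le k n x : bjz k n < x -> bj k x = 0 -> bjz k n.+1 <= x.
Proof.
by move=> nx Jx; rewrite leNgt; apply/negP => h; have := @bjz_consecutive k n x;
  rewrite nx h Jx eqxx => /(_ isT).
Qed.

Lemma bjz0_le k x : 0 < x -> bj k x = 0 -> bjz k 0 <= x.
Proof.
by move=> x0 Jx; rewrite leNgt; apply/negP => h; have := @bjz_first k x;
  rewrite x0 h Jx eqxx => /(_ isT).
Qed.

(* [b (b - a) >= pi a] for consecutive roots [a < b], by comparison with frequency [w = b]. *)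
Lemma bjz_gap_ge k n : pi * bjz k n <= bjz k n.+1 * (bjz k n.+1 - bjz k n).
Proof.
set a := bjz k n; set b := bjz k n.+1.
have a0 : 0 < a := bjz_gt0 k n; have b0 : 0 < b := bjz_gt0 k n.+1.
have ab : a < b := bjz_lt k n.
(* ln (b / a) <= b / a - 1 turns the half-period estimate into the gap estimate. *)
suff h : pi <= b * (ln b - ln a).
  have : ln b - ln a <= b / a - 1.
    have := @le_ln1Dx R (b / a - 1); rewrite addrCA subrr addr0 ln_div ?posrE//; apply.
    by rewrite ltrBrDl subrr divr_gt0.
  move=> h2; have := le_trans h (ler_wpM2l (ltW b0) h2).
  by rewrite -(ler_pM2r a0) => h3; apply: (le_trans h3); rewrite -mulrA mulrBl divfK ?mul1r// gt_eqF.
rewrite leNgt; apply/negP => h.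
have mid : a < (a + b) / 2 < b by rewrite midf_lt//=; have := midf_lt ab => -[].
have key (s : R) : (s == 1) || (s == -1) -> (forall x, a < x < b -> 0 < s * bj k x) -> False.
  move=> s1 Jpos.
  have s0 : s != 0 by case/orP : s1 => /eqP ->; rewrite ?oppr_eq0 oner_eq0.
  have ph x : a < x <= b -> 0 < sin (b * (ln x - ln a)).
    move=> /andP[ax xb]; have x0 := lt_trans a0 ax.
    apply: sin_gt0_pi; rewrite mulr_gt0 ?subr_gt0 ?ltr_ln ?posrE//=.
    by apply: le_lt_trans h; rewrite ler_pM2l// lerB// ler_ln ?posrE.
  have W : s * wsturm k b a a <= s * wsturm k b a b.
    apply: (@derive_ge0_le _ (fun x => s * wsturm k b a x)
      (fun x => s * ((b ^+ 2 + k%:R ^+ 2 - x ^+ 2) / x * bj k x * sin (b * (ln x - ln a)))) a b (ltW ab)).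
      by move=> x /andP[ax _]; apply: dscale; apply: is_derive_wsturm; exact: lt_le_trans ax.
    move=> x /andP[ax xb]; have x0 := lt_trans a0 ax.
    rewrite (_ : s * _ = (b ^+ 2 + k%:R ^+ 2 - x ^+ 2) * (x^-1 * (s * bj k x) * sin (b * (ln x - ln a)))); last by ring.
    apply: mulr_ge0; first by rewrite subr_ge0; nra.
    apply: mulr_ge0; last by rewrite ltW// ph// ax ltW.
    by apply: mulr_ge0; [rewrite invr_ge0 ltW|apply/ltW/Jpos; rewrite ax].
  move: W; rewrite /wsturm subrr mulr0 sin0 /a /b !bjz_root -/a -/b !mulr0 !mul0r !subr0 mulr0.
  (* J_k vanishes at both ends, so [wsturm] is 0 at a. At b it has the sign of [s * ebj k b], which
     is negative since [s * bj k] is positive just before its zero b. *)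
  rewrite leNgt => /negP; apply; rewrite mulrA nmulr_rlt0; first by apply: ph; rewrite ab lexx.
  have dJ := dscale s (is_derive_bj k (lt0r_neq0 b0)).
  have e0 := bj_simple_root b0 (bjz_root k n.+1).
  rewrite lt_neqAle mulf_neq0//= leNgt; apply/negP => sepos.
  have D0 : 0 < s * (ebj k b / b) by rewrite mulrA divr_gt0.
  have [d d0 hd] := is_derive_epsilon dJ D0.
  pose t := Num.min d (b - a) / 2.
  have m0 : 0 < Num.min d (b - a) by rewrite lt_min d0 subr_gt0.
  have t0 : 0 < t by rewrite divr_gt0.
  have : t < Num.min d (b - a) by rewrite /t ltr_pdivrMr// ltr_pMr// ltr1n.
  rewrite lt_min => /andP[td tba].
  have := hd (- t); rewrite oppr_eq0 gt_eqF// normrN gtr0_norm// => /(_ isT td).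
  rewrite /b bjz_root -/b mulr0 subr0 ltr_norml => /andP[+ _].
  rewrite ltrBrDr addNr invrN mulrN oppr_gt0 pmulr_llt0 ?invr_gt0// => hneg.
  have := Jpos (b - t); rewrite ltrBrDl -ltrBrDr tba gtrBl t0 => /(_ isT).
  by rewrite ltNge ltW.
have sgn x y : a < x < b -> a < y < b -> 0 < bj k x -> 0 < bj k y.
  apply: no_root_sign => z.
    by move=> /andP[az _]; apply: continuous_bj; exact: lt_trans az.
  exact: bjz_consecutive.
have [Jm|Jm|Jm] := ltgtP (bj k ((a + b) / 2)) 0.
- apply: (key (-1)); rewrite ?eqxx ?orbT// => x xab; rewrite mulN1r oppr_gt0.
  rewrite lt_neqAle (bjz_consecutive xab)/= leNgt; apply/negP => Jx.
  by have := sgn _ _ xab mid Jx; rewrite ltNge (ltW Jm).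
- by apply: (key 1); rewrite ?eqxx// => x xab; rewrite mul1r (sgn _ _ mid xab).
- by have := bjz_consecutive mid; rewrite Jm eqxx.
Qed.

(* The window of frequency [w = a - k] above a root [a]. *)
Lemma bjz_gap_le k n :
  (bjz k n.+1 - bjz k n) * (bjz k n - k%:R) <= pi * bjz k n.+1.
Proof.
set a := bjz k n; set b := bjz k n.+1.
have a0 : 0 < a := bjz_gt0 k n; have b0 : 0 < b := bjz_gt0 k n.+1.
have ab : a < b := bjz_lt k n.
have ka : 0 < a - k%:R by rewrite subr_gt0 bjz_gt_order.
have k0 : 0 <= k%:R :> R by [].
have [|x /andP[ax xb] Jx] := @bj_root_window k a (a - k%:R) a0 ka; first by nra.
have bE : b <= a * expR (pi / (a - k%:R)) by rewrite (le_trans (bjz_next_le ax Jx)).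
have h : 1 - pi / (a - k%:R) <= a / b.
  have := expR_ge1Dx (- (pi / (a - k%:R))) => h; apply: (le_trans h).
  by rewrite expRN ler_pdivlMr// mulrC ler_pdivrMr ?expR_gt0.
have : (1 - pi / (a - k%:R)) * (b * (a - k%:R)) <= a / b * (b * (a - k%:R)).
  by rewrite ler_wpM2r// mulr_ge0// ltW.
have -> : (1 - pi / (a - k%:R)) * (b * (a - k%:R)) = b * (a - k%:R) - pi * b.
  by field; rewrite gt_eqF.
have -> : a / b * (b * (a - k%:R)) = a * (a - k%:R) by field; rewrite gt_eqF.
by lra.
Qed.

(** A fixed frequency w remains usable for zeros close to k, where the frequency a - k degenerates.
    The window then starts at k + w, and (k + w)^2 >= k^2 + w^2. *)
Lemma bjz_next_window k n w : 0 < w ->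
  bjz k n.+1 <= Num.max (bjz k n) (k%:R + w) * expR (pi / w).
Proof.
move=> w0; set a := Num.max _ _.
have k0 : 0 <= k%:R :> R by [].
have aw : k%:R + w <= a by rewrite le_max lexx orbT.
have [||x /andP[ax xb] Jx] := @bj_root_window k a w _ w0; [by lra|by nra|].
apply: le_trans xb; apply: bjz_next_le => //; apply: le_lt_trans ax.
by rewrite le_max lexx.
Qed.

Lemma bjz0_window k w : 0 < w -> bjz k 0 <= (k%:R + w) * expR (pi / w).
Proof.
move=> w0; have k0 : 0 <= k%:R :> R by [].
have [||x /andP[ax xb] Jx] := @bj_root_window k (k%:R + w) w _ w0; [by lra|by nra|].
by apply: le_trans xb; apply: bjz0_le => //; apply: lt_trans ax; lra.
Qed.

End bessel_zeros.

(** * Bourget's hypothesis *)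

Section bourget.
Context {R : realType}.
Implicit Types (k m n : nat) (x z : R).

Lemma jz_unbounded_roots k (X : R) : exists2 z, X < z & jz k z = 0.
Proof.
have [x Xx Jx] := bj_unbounded_roots k (2 * X); exists (x / 2) => //.
by rewrite ltr_pdivlMr// mulrC.
Qed.

(* Lommel polynomials: [z ^ (m - 1) J_(k + m) = A_m J_(k + 1) - B_m J_k]. *)
Fixpoint lommel k m : {poly int} * {poly int} :=
  if m is m'.+1 then
    ((lommel k m').2, (k + m'.+1)%:Z *: (lommel k m').2 - 'X^2 * (lommel k m').1)
  else (0, 1).

(** The value at 0 is the product of k + 1, ..., k + m. *)
Lemma lommel_neq0 k m : (lommel k m).2 != 0.
Proof.
suff : (lommel k m).2.[0] != 0 by apply: contra_neq => ->; rewrite horner0.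
elim: m => [|m IH] /=; first by rewrite hornerC oner_eq0.
rewrite hornerD hornerZ hornerN hornerM hornerXn expr0n/= mul0r subr0.
by rewrite mulf_neq0//; rewrite addnS.
Qed.

Lemma lommel_root k m z : jz k z = 0 ->
  z ^+ m * jz (k + m) z = (map_poly intr (lommel k m).1).[z] * z * jz k.+1 z /\
  z ^+ m * jz (k + m.+1) z = (map_poly intr (lommel k m).2).[z] * jz k.+1 z.
Proof.
move=> J0; elim: m => [|m [IH1 IH2]] /=.
  by rewrite !expr0 addn0 addn1 J0 map_poly0 rmorph1 horner0 hornerC; split; ring.
split; first by rewrite exprS -mulrA IH2; ring.
have E := jz_rec (k + m) z; rewrite !addnS in IH2 *.
have -> : z ^+ m.+1 * jz (k + m).+2 z = z ^+ m * (z * jz (k + m).+2 z) by rewrite exprS; ring.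
rewrite E mulrBr mulrCA IH2 [z ^+ m * (z * _)]mulrCA IH1.
rewrite rmorphB/= map_polyZ/= rmorphM/= map_polyXn hornerD hornerN hornerZ hornerM hornerXn.
by rewrite -pmulrn; ring.
Qed.

Theorem bourget k l x : (k < l)%N -> 0 < x -> bj k x = 0 -> bj l x != 0.
Proof.
move=> kl x0 Jk; apply/eqP => Jl.
pose m := (l - k.+1)%N.
have lE : l = (k + m.+1)%N by rewrite addnS -addSn subnKC.
have z0 : 0 < x / 2 by rewrite divr_gt0.
have [_ h] := lommel_root m Jk.
have sep (y : R) : 0 < y -> jz k y = 0 -> jz k.+1 y != 0 by exact: jz_no_common_root.
have := jz_zero_transcendental (jz_unbounded_roots k) sep z0 Jk (lommel_neq0 k m).
rewrite rootE => /negP; apply.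
have Kn : jz k.+1 (x / 2) != 0 by exact: sep.
move/esym/eqP: h; rewrite -lE -/(bj l x) Jl mulr0 mulf_eq0 (negbTE Kn) orbF.
by [].
Qed.

Lemma bj_order_inj k l x : 0 < x -> bj k x = 0 -> bj l x = 0 -> k = l.
Proof.
move=> x0 Jk Jl; have [kl|lk|//] := ltngtP k l.
  by have := bourget kl x0 Jk; rewrite Jl eqxx.
by have := bourget lk x0 Jl; rewrite Jk eqxx.
Qed.

End bourget.

(** * Sums over the zeros and the normalized length *)

Section zero_asymptotics.
Context {R : realType}.
Implicit Types (k n s : nat) (x d e : R).

(** If all zeros were at most X, the gaps would be at least pi j_{k,1} / X. *)
Lemma bjz_cofinal k (X : R) : exists n, X < bjz k n.
Proof.
apply: contrapT => h; have {}h n : bjz k n <= X by rewrite leNgt; apply/negP => hn; apply: h; exists n.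
have X0 : 0 < X by apply: lt_le_trans (h 0%N); exact: bjz_gt0.
pose c := pi * bjz k 0 / X : R.
have c0 : 0 < c by rewrite divr_gt0// mulr_gt0 ?pi_gt0 ?bjz_gt0.
have grow n : n%:R * c <= bjz k n.
  elim: n => [|n IH]; first by rewrite mul0r ltW// bjz_gt0.
  rewrite -natr1 mulrDl mul1r; apply: le_trans (lerD IH (_ : c <= bjz k n.+1 - bjz k n)) _; last by rewrite addrC subrK.
  rewrite ler_pdivrMr//; apply: le_trans (le_trans _ (bjz_gap_ge k n)) _.
    by rewrite ler_pM2l ?pi_gt0// bjz_le.
  by rewrite mulrC ler_wpM2l ?subr_ge0 ?(ltW (bjz_lt k n)).
have := archi_boundP (ltW (divr_gt0 X0 c0)); rewrite ltr_pdivrMr// => h2.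
by have := lt_le_trans h2 (le_trans (grow _) (h _)); rewrite ltxx.
Qed.

Lemma bj_root_bjz k x : 0 < x -> bj k x = 0 -> exists n, x = bjz k n.
Proof.
move=> x0 Jx; case: (ex_minnP (bjz_cofinal k x)) => -[|n] xn nmin.
  by have := bjz0_le x0 Jx; rewrite leNgt xn.
exists n; apply/eqP; rewrite eq_le; apply/andP; split.
  by rewrite leNgt; apply/negP => nx; have := bjz_next_le nx Jx; rewrite leNgt xn.
by rewrite leNgt; apply/negP => /nmin; rewrite ltnn.
Qed.

Lemma bjz_is_bessel_zero k n : is_bessel_zero k n.+1 (bjz k n : R).
Proof.
split; [exact: bjz_gt0|by rewrite besselJE; exact: bjz_root|].
rewrite (_ : [set y | _] = bjz k @` `I_n.+1).
  by apply: inj_card_eq => i j _ _ ij; apply/eqP; rewrite eqn_leq -!(@bjz_mono R k) ij lexx.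
apply/seteqP; split => y /=.
  rewrite besselJE => -[/andP[y0 yn] Jy]; have [i yi] := bj_root_bjz y0 Jy.
  by exists i; rewrite ?yi// ltnS -(@bjz_mono R k) -yi.
move=> [i]; rewrite ltnS => ni <-.
by rewrite bjz_gt0 bjz_le// besselJE -/(bj k _) bjz_root.
Qed.

Lemma bessel_zero_bjz k n : bessel_zero k n.+1 = bjz k n :> R.
Proof.
apply: xget_unique; first exact: bjz_is_bessel_zero.
move=> y [y0]; rewrite besselJE => Jy yn; have [m ym] := bj_root_bjz y0 Jy.
have [_ _] := bjz_is_bessel_zero k m; rewrite -ym => hm.
have : (`I_n.+1 #= `I_m.+1)%card by apply: card_eq_trans hm; rewrite card_eq_sym.
by move=> /card_eq_II [->].
Qed.

(* Length of [s] circles and [2 k] radii divided by [mu = bjz k s]. *)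
Definition disc_ratio k s : R :=
  (2 * pi * \sum_(i < s) bjz k i + 2 * k%:R * bjz k s) / bjz k s ^+ 2.

(** For the frequency pi / ln (1 + d) the window ratio is 1 + d, whatever k. The additive constant
    accounts for windows that start at k plus the frequency rather than at a zero. *)
Lemma bjz_gap_small d : 0 < d -> exists2 w : R, 0 < w &
  (forall k, bjz k 0 - k%:R <= d * bjz k 0 + w) /\
  (forall k n, bjz k n.+1 - bjz k n <= d * bjz k n.+1 + w).
Proof.
move=> d0; pose w := pi / ln (1 + d).
have ld0 : 0 < ln (1 + d) by rewrite ln_gt0// ltrDl.
have w0 : 0 < w by rewrite divr_gt0// pi_gt0.
have F : expR (pi / w) = 1 + d.
  rewrite /w invf_div mulrC divfK ?gt_eqF ?pi_gt0// lnK// posrE.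
  by rewrite addr_gt0.
exists (w * (1 + d)); first by rewrite mulr_gt0// addr_gt0.
split=> [k|k n].
  have := bjz0_window k w0; rewrite F => h1.
  by have := @bjz_gt_order R k 0; nra.
have := bjz_next_window k n w0; rewrite F => h1.
have h2 : Num.max (bjz k n) (k%:R + w) <= bjz k n + w.
  by rewrite ge_max lerDl (ltW w0) lerD2r ltW// bjz_gt_order.
have h3 := le_trans h1 (ler_wpM2r (ltW (addr_gt0 ltr01 d0)) h2).
by have := @bjz_lt R k n; nra.
Qed.

Lemma sum_gap k s : \sum_(i < s) (bjz k i.+1 - bjz k i) = bjz k s - bjz k 0 :> R.
Proof.
rewrite -(big_mkord xpredT (fun i => bjz k i.+1 - bjz k i)).
by rewrite telescope_sumr.
Qed.

Lemma disc_ratio_le2 k s : disc_ratio k s <= 2.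
Proof.
have b0 : 0 < bjz k s :> R := bjz_gt0 k s.
rewrite /disc_ratio ler_pdivrMr ?exprn_gt0//.
have h : pi * \sum_(i < s) bjz k i <= bjz k s * (bjz k s - bjz k 0) :> R.
  rewrite -(sum_gap k s) !mulr_sumr; apply: ler_sum => i _.
  apply: (le_trans (bjz_gap_ge k i)); rewrite ler_wpM2r//.
    by rewrite subr_ge0 ltW// bjz_lt.
  by rewrite bjz_le.
have := @bjz_gt_order R k 0; rewrite -(ler_pM2l b0) in h.
by nra.
Qed.

Lemma sum_bjzS k s : \sum_(i < s) bjz k i.+1 = \sum_(i < s) bjz k i + bjz k s - bjz k 0 :> R.
Proof.
have := sum_gap k s; rewrite sumrB => h.
by rewrite -addrA -h addrC subrK.
Qed.

(** A squared gap is twice the error in replacing j_i (j_{i+1} - j_i) by half the increment of j^2.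
    The total is o(mu^2), because each gap is o(mu) and the gaps add up to less than mu. *)
Lemma sum_sqr_gap_le k s d w : 0 <= d -> 0 <= w ->
  (forall n, bjz k n.+1 - bjz k n <= d * bjz k n.+1 + w) ->
  \sum_(i < s) (bjz k i.+1 - bjz k i) ^+ 2 <= (d * bjz k s + w) * bjz k s.
Proof.
move=> d0 w0 hd; apply: (@le_trans _ _ ((d * bjz k s + w) * (bjz k s - bjz k 0))).
  rewrite -(sum_gap k s) mulr_sumr; apply: ler_sum => i _.
  rewrite expr2 ler_wpM2r ?subr_ge0 ?(ltW (bjz_lt k i))//.
  by apply: (le_trans (hd i)); rewrite lerD2r ler_wpM2l// bjz_le.
rewrite ler_wpM2l ?addr_ge0 ?mulr_ge0 ?(ltW (bjz_gt0 k s))//.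
by rewrite gerBl ltW// bjz_gt0.
Qed.

Lemma disc_ratio_ge e : 0 < e -> exists L : R, forall k s, L <= bjz k s -> 1 - e <= disc_ratio k s.
Proof.
(* With b = [bjz k s], the errors in 2 pi times the sum of the zeros are [(bjz k 0 - k%:R) ^+ 2] <=
   4 d b^2, the squared gaps <= 2 d b^2, and 2 pi b <= e b^2 / 3; as 12 d <= e, they stay below e
   b^2. *)
move=> e0; pose d := Num.min 1 (e / 12).
have d0 : 0 < d by rewrite lt_min ltr01 divr_gt0.
have [w w0 [h0 hg]] := bjz_gap_small d0.
exists (Num.max (w / d) (6 * pi / e)) => k s; rewrite ge_max => /andP[].
set b := bjz k s; have b0 : 0 < b := bjz_gt0 k s.
rewrite ler_pdivrMr// => wb; rewrite ler_pdivrMr// => pb.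
rewrite /disc_ratio -/b ler_pdivlMr ?exprn_gt0//.
have kb : k%:R < b := bjz_gt_order k s.
have k0 : 0 <= k%:R :> R by [].
have h1 : \sum_(i < s) (bjz k i.+1 - bjz k i) * (bjz k i - k%:R) <= pi * \sum_(i < s) bjz k i.+1 :> R.
  by rewrite mulr_sumr; apply: ler_sum => i _; exact: bjz_gap_le.
have h2 : 2 * \sum_(i < s) (bjz k i.+1 - bjz k i) * (bjz k i - k%:R) =
    (b - k%:R) ^+ 2 - (bjz k 0 - k%:R) ^+ 2 - \sum_(i < s) (bjz k i.+1 - bjz k i) ^+ 2 :> R.
  have -> : (b - k%:R) ^+ 2 - (bjz k 0 - k%:R) ^+ 2 =
     \sum_(i < s) ((bjz k i.+1 - k%:R) ^+ 2 - (bjz k i - k%:R) ^+ 2).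
    rewrite -(big_mkord xpredT (fun i => (bjz k i.+1 - k%:R) ^+ 2 - (bjz k i - k%:R) ^+ 2)).
    by rewrite (telescope_sumr (fun i => (bjz k i - k%:R) ^+ 2)).
  by rewrite -sumrB mulr_sumr; apply: eq_bigr => i _; ring.
have h3 := sum_sqr_gap_le s (ltW d0) (ltW w0) (hg k).
have h4 : 0 <= (bjz k 0 - k%:R : R) <= 2 * d * b.
  apply/andP; split; first by rewrite subr_ge0 ltW// bjz_gt_order.
  apply: (le_trans (h0 k)).
  have : d * bjz k 0 <= d * b by rewrite ler_pM2l// bjz_le.
  by lra.
have h5 : (bjz k 0 - k%:R : R) ^+ 2 <= 4 * d * b ^+ 2.
  have d1 : d <= 1 by rewrite ge_min lexx.
  move: h4 => /andP[p0 p1].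
  apply: (@le_trans _ _ ((2 * d * b) ^+ 2)); first by rewrite ler_sqr ?nnegrE// (le_trans p0).
  rewrite (_ : (2 * d * b) ^+ 2 = 4 * d * b ^+ 2 * d); last by ring.
  by rewrite ler_piMr// !mulr_ge0 ?exprn_ge0// ltW.
have h6 : 12 * d <= e by rewrite mulrC -ler_pdivlMr// ge_min lexx orbT.
rewrite sum_bjzS -/b in h1.
have b00 := @bjz_gt0 R k 0 : 0 < bjz k 0 :> R.
have p0 : 0 < pi :> R := pi_gt0 R.
have hb2 : 0 < b ^+ 2 by rewrite exprn_gt0.
have p1 : 0 <= pi * bjz k 0 :> R by rewrite mulr_ge0// ltW.
have p2 : 6 * (pi * b) <= e * b ^+ 2 by rewrite mulrA expr2 mulrA ler_pM2r// [e * b]mulrC.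
have p3 : 12 * d * b ^+ 2 <= e * b ^+ 2 by rewrite ler_pM2r.
have p6 : 0 <= e * b ^+ 2 by rewrite mulr_ge0// ltW.
have p4 : w * b <= d * b ^+ 2 by rewrite expr2 mulrA ler_pM2r// mulrC.
have p5 : k%:R ^+ 2 >= 0 :> R by rewrite exprn_ge0.
move: h1 h2 h3 h5.
set S := \sum_(i < s) bjz k i; set S1 := \sum_(i < s) _ * _; set S2 := \sum_(i < s) _ ^+ 2.
move=> h1 h2 h3 h5.
have h3' : S2 <= d * b ^+ 2 + w * b by apply: (le_trans h3); rewrite mulrDl expr2 mulrA.
have E : (b - k%:R) ^+ 2 = b ^+ 2 - 2 * k%:R * b + k%:R ^+ 2 by ring.
rewrite E in h2.
have h1' : S1 <= pi * S + pi * b - pi * bjz k 0 by rewrite -mulrDr -mulrBr.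
rewrite -mulrA mulrBl mul1r.
rewrite -[4 * d * _]mulrA in h5; rewrite -[12 * d * _]mulrA in p3.
move: ((bjz k 0 - k%:R) ^+ 2) h2 h5 => q h2 h5.
move: (pi * S) (pi * b) (pi * bjz k 0) (e * b ^+ 2) (d * b ^+ 2) (w * b) h5 p6 p1 p2 p3 p4 h1' h3' => u1 u2 u3 u4 u5 u6 h5 p6 p1 p2 p3 p4 h1' h3'.
lra.
Qed.

(** The factor j_{i+1} of [bjz_gap_ge] is kept instead of being bounded by mu; the sum of j_{i+1}
    (j_{i+1} - j_i) is about mu^2 / 2, which yields 1 in place of 2. *)
Lemma disc_ratio0_le e : 0 < e -> exists L : R, forall s, L <= bjz 0 s -> disc_ratio 0 s <= 1 + e.
Proof.
move=> e0; pose d := e / 2; have d0 : 0 < d by rewrite divr_gt0.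
have [w w0 [_ hg]] := bjz_gap_small d0.
exists (w / d) => s; set b := bjz 0 s; have b0 : 0 < b := bjz_gt0 0 s.
rewrite ler_pdivrMr// => wb.
rewrite /disc_ratio -/b ler_pdivrMr ?exprn_gt0// mulr0 mul0r addr0.
have h1 : pi * \sum_(i < s) bjz 0 i <= \sum_(i < s) bjz 0 i.+1 * (bjz 0 i.+1 - bjz 0 i) :> R.
  by rewrite mulr_sumr; apply: ler_sum => i _; exact: bjz_gap_ge.
have h2 : 2 * \sum_(i < s) bjz 0 i.+1 * (bjz 0 i.+1 - bjz 0 i) =
    b ^+ 2 - bjz 0 0 ^+ 2 + \sum_(i < s) (bjz 0 i.+1 - bjz 0 i) ^+ 2 :> R.
  have -> : b ^+ 2 - bjz 0 0 ^+ 2 = \sum_(i < s) (bjz 0 i.+1 ^+ 2 - bjz 0 i ^+ 2).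
    rewrite -(big_mkord xpredT (fun i => bjz 0 i.+1 ^+ 2 - bjz 0 i ^+ 2)).
    by rewrite (telescope_sumr (fun i => bjz 0 i ^+ 2)).
  by rewrite -big_split mulr_sumr; apply: eq_bigr => i _ /=; ring.
have h3 := sum_sqr_gap_le s (ltW d0) (ltW w0) (hg 0%N); rewrite -/b in h3.
have p4 : w * b <= d * b ^+ 2 by rewrite expr2 mulrA ler_pM2r// mulrC.
have p5 : bjz 0 0 ^+ 2 >= 0 :> R by rewrite exprn_ge0// ltW// bjz_gt0.
have h3' : \sum_(i < s) (bjz 0 i.+1 - bjz 0 i) ^+ 2 <= 2 * (d * b ^+ 2).
  by apply: (le_trans h3); rewrite mulrDl; move: p4; rewrite expr2 mulrA; lra.
have de : 2 * (d * b ^+ 2) = e * b ^+ 2 by rewrite /d; field.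
by rewrite de in h3'; rewrite -mulrA mulrDl mul1r; lra.
Qed.

Lemma disc_ratio_first e : 0 < e -> exists K, forall k, (K <= k)%N -> 2 - e <= disc_ratio k 0.
Proof.
move=> e0; pose d := e / 4; have d0 : 0 < d by rewrite divr_gt0.
have [w w0 [h0 _]] := bjz_gap_small d0.
exists (Num.bound (w / d)) => k Kk.
have kd : w / d < k%:R.
  by apply: lt_le_trans (archi_boundP (ltW (divr_gt0 w0 d0))) _; rewrite ler_nat.
rewrite /disc_ratio big_ord0 mulr0 add0r; set b := bjz k 0.
have b0 : 0 < b := bjz_gt0 k 0; have kb : k%:R < b := bjz_gt_order k 0.
rewrite ler_pdivlMr ?exprn_gt0// expr2 mulrA ler_pM2r//.
have := h0 k; rewrite -/b => hb.
move: kd; rewrite ltr_pdivrMr// => kd.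
have : d * b = e * b / 4 by rewrite /d; field.
have : d * k%:R <= d * b by rewrite ler_pM2l// ltW.
by lra.
Qed.

End zero_asymptotics.

(** * Hausdorff measure of circles and radii *)

Section hausdorff_bounds.
Context {R : realType}.
Implicit Types (p q : R * R) (A B : set (R * R)) (d : R).

Lemma enorm_ge0 p : 0 <= enorm p.
Proof. exact: sqrtr_ge0. Qed.

Lemma enorm_sqr p : enorm p ^+ 2 = p.1 ^+ 2 + p.2 ^+ 2.
Proof. by rewrite sqr_sqrtr// addr_ge0// sqr_ge0. Qed.

Lemma ediam_ge0 A : (0 <= ediam A)%E.
Proof. by rewrite /ediam le_max lexx. Qed.

Lemma ediam_le A (c : R) : 0 <= c ->
  (forall p q, A p -> A q -> enorm (p - q) <= c) -> (ediam A <= c%:E)%E.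
Proof.
move=> c0 h; rewrite /ediam ge_max lee_fin c0/=.
by apply: ge_ereal_sup => _ [[p q] [/= Ap Aq] <-]; rewrite lee_fin h.
Qed.

Lemma le_ediam A p q : A p -> A q -> ((enorm (p - q))%:E <= ediam A)%E.
Proof.
move=> Ap Aq; rewrite /ediam le_max; apply/orP; right.
by apply: ereal_sup_ubound; exists (p, q).
Qed.

Lemma sum_single_le (T : finType) (f : T -> R) (c : R) : 0 <= c ->
  (forall u, f u <= c) -> (forall u v, f u != 0 -> f v != 0 -> u = v) ->
  \sum_u f u <= c.
Proof.
move=> c0 fc funi; have [[u fu]|h] := pselect (exists u, f u != 0).
  rewrite (bigD1 u)//= big1 ?addr0// => v vu.
  by apply/eqP; apply: contraNT vu => fv; apply/eqP; exact: funi.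
rewrite big1// => u _; apply/eqP/negPn/negP => fu; apply: h.
by exists u.
Qed.

(* A set of diameter at most [d] meets only one piece, in a parameter set whose
   length times the weight is at most the diameter; the intervals spanned by these
   parameter sets cover [a u, b u]. *)
Lemma hausdorff1_pre_ge (T : finType) (a b w : T -> R) (P : T -> R -> R * R) d A :
  (forall u, a u <= b u) -> (forall u, 0 <= w u) ->
  (forall u x, a u <= x <= b u -> A (P u x)) ->
  (forall u v x y, a u <= x <= b u -> a v <= y <= b v ->
     enorm (P u x - P v y) <= d -> u = v /\ w u * `|x - y| <= enorm (P u x - P v y)) ->
  ((\sum_u w u * (b u - a u))%:E <= hausdorff1_pre d A)%E.
Proof.
move=> ab w0 PA sep; apply: le_ereal_inf_tmp => _ [F [Fd AF] <-].
pose D n := fine (ediam (F n)).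
have FE n : ediam (F n) = (D n)%:E.
  rewrite /D fineK// fin_numE; have := ediam_ge0 (F n); have := Fd n.
  by case: (ediam (F n)).
have D0 n : 0 <= D n by rewrite -lee_fin -FE ediam_ge0.
have Dd n : D n <= d by rewrite -lee_fin -FE.
have FD n p q : F n p -> F n q -> enorm (p - q) <= D n.
  by move=> Fp Fq; rewrite -lee_fin -FE le_ediam.
pose G u n := [set x | a u <= x <= b u /\ F n (P u x)].
(* [G u n] need not be measurable, so the interval that it spans is measured; the case distinction
   keeps the empty set apart, where sup and inf are default values. *)
pose len u n : R := if pselect (G u n !=set0) then sup (G u n) - inf (G u n) else 0.
pose J u n : set R := if pselect (G u n !=set0) then `[inf (G u n), sup (G u n)]%classic else set0.
have Gub u n : has_ubound (G u n) by exists (b u) => x [/andP[]].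
have Glb u n : has_lbound (G u n) by exists (a u) => x [/andP[]].
have GJ u n : G u n `<=` J u n.
  move=> x Gx; rewrite /J; case: pselect => [?|]; last by case; exists x.
  by rewrite /= in_itv/= ge_inf ?ub_le_sup.
have len0 u n : 0 <= len u n.
  rewrite /len; case: pselect => // -[x Gx]; rewrite subr_ge0.
  by apply: (@le_trans _ _ x); [exact: ge_inf|exact: ub_le_sup].
have lenJ u n : lebesgue_measure (J u n) = (len u n)%:E.
  rewrite /J; have := len0 u n; rewrite /len; case: pselect => [?|?] h; last by rewrite measure0.
  rewrite lebesgue_measure_itv/= lte_fin; case: ltP => // h2.
  by congr (_%:E); apply/eqP; rewrite eq_sym eq_le h subr_le0 h2.
have mJ u n : measurable (J u n).
  by rewrite /J; case: pselect => ?; [exact: measurable_itv|exact: measurable0].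
have lenD u n : w u * len u n <= D n.
  rewrite /len; case: pselect => [[x0 Gx0]|?]; last by rewrite mulr0.
  have := w0 u; rewrite le_eqVlt => /predU1P[<-|wu0]; first by rewrite mul0r.
  rewrite mulrC -ler_pdivlMr// lerBlDr; apply: ge_sup; first by exists x0.
  move=> x Gx; rewrite -lerBlDl; apply: lb_le_inf; first by exists x0.
  move=> y Gy; rewrite lerBlDl -lerBlDr ler_pdivlMr// mulrC.
  have hFD := FD _ _ _ Gx.2 Gy.2.
  have [_ h] := sep u u x y Gx.1 Gy.1 (le_trans hFD (Dd n)).
  by apply: le_trans (le_trans h hFD); rewrite (ler_wpM2l (ltW wu0))// ler_norm.
have lenS n : \sum_u w u * len u n <= D n.
  apply: sum_single_le => // u v; rewrite /len.
  case: pselect => [[x Gx] _|?]; last by rewrite mulr0 eqxx.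
  case: pselect => [[y Gy] _|?]; last by rewrite mulr0 eqxx.
  by have [] := sep u v x y Gx.1 Gy.1 (le_trans (FD _ _ _ Gx.2 Gy.2) (Dd n)).
have cov u : ((w u * (b u - a u))%:E <= \sum_(0 <= n <oo) (w u * len u n)%:E)%E.
  under eq_eseriesr do rewrite EFinM.
  rewrite nneseriesZl; last by move=> *; rewrite lee_fin.
  rewrite EFinM lee_wpmul2l ?lee_fin//.
  have : (lebesgue_measure `[a u, b u]%classic <= \sum_(0 <= n <oo) lebesgue_measure (J u n))%E.
    apply: measure_sigma_subadditive; [exact: mJ| |]; first exact: measurable_itv.
    move=> x /=; rewrite in_itv/= => xab.
    by have [n _ Fn] := AF _ (PA u x xab); exists n => //; apply: GJ.
  under eq_eseriesr do rewrite lenJ.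
  apply: le_trans; rewrite lebesgue_measure_itv/= lte_fin; case: ltP => // ba.
  by rewrite lee_fin subr_le0.
rewrite -sumEFin.
apply: le_trans (lee_sum _ (fun u _ => cov u)) _.
rewrite -nneseries_sum; last by move=> *; rewrite lee_fin mulr_ge0.
apply: lee_nneseries => n _; first by move=> _; rewrite sume_ge0// => u _; rewrite lee_fin mulr_ge0.
by rewrite sumEFin FE lee_fin.
Qed.

(** Finite covers are easily joined and suffice for upper bounds; [finite_cover_pre] pads them with
    empty sets, whose [ediam] is 0. *)
Definition finite_cover d A (c : R) := exists s : seq (set (R * R)),
  [/\ forall B, B \in s -> (ediam B <= d%:E)%E,
      forall p, A p -> exists2 B, B \in s & B p &
      (\sum_(B <- s) ediam B <= c%:E)%E].

Lemma finite_cover_pre d A c : 0 <= d -> finite_cover d A c -> (hausdorff1_pre d A <= c%:E)%E.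
Proof.
move=> d0 [s [sd As sc]]; apply: le_trans sc.
have ed0 : ediam (set0 : set (R * R)) = 0%E.
  by apply/eqP; rewrite eq_le ediam_ge0 andbT; apply: ediam_le.
apply: ereal_inf_lbound; exists (fun n => nth set0 s n); first split.
- move=> n; have [ns|sn] := ltnP n (size s); first by apply: sd; rewrite mem_nth.
  by rewrite nth_default// ed0 lee_fin.
- move=> p /As [B Bs Bp]; exists (index B s) => //=.
  by rewrite nth_index.
- rewrite (nneseries_split 0 (size s)); last by move=> n _; exact: ediam_ge0.
  rewrite [X in (_ + X)%E]eseries0 ?adde0.
    by rewrite (big_nth set0) add0n.
  by move=> n; rewrite add0n => sn _; rewrite nth_default.
Qed.

Lemma finite_coverS d A B c : A `<=` B -> finite_cover d B c -> finite_cover d A c.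
Proof. by move=> AB [s [h1 h2 h3]]; exists s; split => // p /AB /h2. Qed.

Lemma finite_coverU d A B a b :
  finite_cover d A a -> finite_cover d B b -> finite_cover d (A `|` B) (a + b).
Proof.
move=> [s [h1 h2 h3]] [t [k1 k2 k3]]; exists (s ++ t); split.
- by move=> C; rewrite mem_cat => /orP[/h1|/k1].
- move=> p [/h2|/k2] [C Cs Cp]; exists C => //; rewrite mem_cat Cs ?orbT//.
- by rewrite big_cat/= EFinD leeD.
Qed.

Lemma finite_cover_bigcup d (A : nat -> set (R * R)) (c : nat -> R) n :
  (forall i, (i < n)%N -> finite_cover d (A i) (c i)) ->
  finite_cover d [set p | exists2 i, (i < n)%N & A i p] (\sum_(i < n) c i).
Proof.
elim: n => [|n IH] h.
  exists [::]; split => //; last by rewrite big_nil big_ord0.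
  by move=> p [].
rewrite big_ord_recr/=; apply: finite_coverS (finite_coverU (IH _) (h n _)) => //.
  move=> p [i]; rewrite ltnS leq_eqVlt => /predU1P[->|hi] Ap; first by right.
  by left; exists i.
by move=> i hi; apply: h; rewrite ltnS ltnW.
Qed.

Lemma finite_cover_curve d (P : R -> R * R) (w l : R) : 0 < d -> 0 <= w -> 0 < l ->
  (forall x y, enorm (P x - P y) <= w * `|x - y|) ->
  finite_cover d (P @` `[0, l]%classic) (w * l).
Proof.
move=> d0 w0 l0 lip.
pose N := (Num.trunc (w * l / d)).+1.
have N0 : (0 < N%:R :> R) by rewrite ltr0n.
have hN : w * (l / N%:R) <= d.
  rewrite mulrA ler_pdivrMr// [d * _]mulrC -ler_pdivrMr// ltW//.
  exact: truncnS_gt.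
have lN0 : 0 < l / N%:R by rewrite divr_gt0.
pose B i := P @` `[i%:R * (l / N%:R), i.+1%:R * (l / N%:R)]%classic.
have BD i : (ediam (B i) <= (w * (l / N%:R))%:E)%E.
  apply: ediam_le; first by rewrite mulr_ge0// ltW.
  move=> _ _ [x /= xi <-] [y /= yi <-]; apply: le_trans (lip _ _) _.
  rewrite ler_wpM2l//; move: xi yi; rewrite !in_itv/= -natr1 mulrDl mul1r.
  set c := _ * _; set e := l / _.
  by move=> /andP[? ?] /andP[? ?]; rewrite ler_norml; apply/andP; split; lra.
have inB i : (i < N)%N -> B i \in [seq B i | i <- iota 0 N].
  by move=> iN; apply/mapP; exists i; rewrite ?mem_iota.
exists [seq B i | i <- iota 0 N]; split.
- by move=> C /mapP[i _ ->]; apply: le_trans (BD i) _; rewrite lee_fin.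
- move=> _ [x /= + <-]; rewrite in_itv/= => /andP[x0 xl].
  pose q := x / (l / N%:R).
  have q0 : 0 <= q by rewrite divr_ge0// ltW.
  have [xeq|xlt] := eqVneq x l.
    exists (B N.-1); first exact: inB.
    exists x => //=; rewrite in_itv/= xeq; apply/andP; split.
      rewrite mulrCA -[leRHS]mulr1 ler_wpM2l//; first exact: ltW.
      by rewrite ler_pdivrMr// mul1r ler_nat.
    by rewrite mulrCA divff ?mulr1// gt_eqF.
  have xl' : x < l by rewrite lt_neqAle xlt.
  exists (B (Num.trunc q)).
    apply: inB; rewrite -(ltr_nat R).
    have := q0; rewrite -truncn_le => hq; apply: le_lt_trans hq _.
    rewrite /q invf_div mulrCA -[ltRHS]mulr1 ltr_pM2l// ltr_pdivrMr// mul1r.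
    exact: xl'.
  exists x => //=; rewrite in_itv/= -ler_pdivlMr// truncn_le q0/=.
  by rewrite -ler_pdivrMr// ltW//; exact: truncnS_gt.
- rewrite big_map.
  apply: (@le_trans _ _ (\sum_(i <- iota 0 N) (w * (l / N%:R))%:E)%E).
    by apply: lee_sum => i _.
  rewrite sumEFin lee_fin big_const_seq count_predT size_iota iter_addr addr0.
  by rewrite -[leLHS]mulr_natr -mulrA divfK ?lexx// gt_eqF.
Qed.

End hausdorff_bounds.

(** * Distances in polar coordinates *)

Section circles_rays.
Context {R : realType}.

Definition pt (r t : R) : R * R := (r * cos t, r * sin t).

Lemma abs_sin_le (y : R) : `|sin y| <= `|y|.
Proof.
have h (x : R) : 0 < x -> `|sin x| <= x.
  move=> x0; have [c _] := @mvt R sin cos 0 x x0 (fun z _ => is_derive_sin z).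
  rewrite sin0 !subr0 => ->; rewrite normrM (gtr0_norm x0) ler_piMl ?(ltW x0)//.
  by rewrite ler_norml cos_geN1 cos_le1.
have [y0|y0|->] := ltgtP y 0; last by rewrite sin0 normr0.
  by rewrite -normrN -sinN -(normrN y) (gtr0_norm (x := - y)) ?oppr_gt0// h ?oppr_gt0.
by rewrite (gtr0_norm y0) h.
Qed.

Lemma cos_half (x : R) : 1 - cos x = 2 * sin (x / 2) ^+ 2.
Proof.
have -> : cos x = cos (x / 2 + x / 2) by congr cos; lra.
rewrite cosD -!expr2 cos2sin2; lra.
Qed.

(** Law of cosines, in a form that separates the radial from the angular part. *)
Lemma enorm_ptB r t r' t' :
  enorm (pt r t - pt r' t') ^+ 2 = (r - r') ^+ 2 + 2 * r * r' * (1 - cos (t - t')).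
Proof.
rewrite enorm_sqr /pt/= cosB.
have := sin2cos2 t; have := sin2cos2 t'.
move: (cos t) (sin t) (cos t') (sin t') => a b c d e f.
have -> : (r * a - r' * c) ^+ 2 + (r * b - r' * d) ^+ 2 =
  r ^+ 2 * (a ^+ 2 + b ^+ 2) + r' ^+ 2 * (c ^+ 2 + d ^+ 2) - 2 * r * r' * (a * c + b * d) by ring.
by rewrite e f; ring.
Qed.

Lemma pt_arc_le r t t' : 0 <= r -> enorm (pt r t - pt r t') <= r * `|t - t'|.
Proof.
move=> r0; rewrite -(ler_pXn2r (n := 2)) ?nnegrE ?enorm_ge0 ?mulr_ge0//.
rewrite enorm_ptB subrr expr0n/= add0r cos_half.
have := abs_sin_le ((t - t') / 2); rewrite normrM [`|2^-1|]gtr0_norm ?invr_gt0// => h.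
have h2 : `|sin ((t - t') / 2)| ^+ 2 <= (`|t - t'| / 2) ^+ 2 by rewrite lerXn2r ?nnegrE.
rewrite real_normK ?num_real// in h2.
rewrite exprMn; have r2 : 0 <= r ^+ 2 by apply: sqr_ge0.
have := ler_wpM2l r2 h2; move: (sin _ ^+ 2) => S; rewrite !expr2; nra.
Qed.

Lemma pt_ray_dist x y t : enorm (pt x t - pt y t) = `|x - y|.
Proof.
apply/eqP; rewrite -(eqrXn2 (n := 2)) ?enorm_ge0//.
by rewrite enorm_ptB subrr cos0 subrr mulr0 addr0 real_normK// num_real.
Qed.

Lemma enorm_pt x t : 0 <= x -> enorm (pt x t) = x.
Proof.
move=> x0; apply/eqP; rewrite -(eqrXn2 (n := 2)) ?enorm_ge0//.
by rewrite enorm_sqr /pt/= !exprMn -mulrDr cos2Dsin2 mulr1.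
Qed.

Lemma enorm_ptB_ge r t r' t' : 0 <= r -> 0 <= r' -> `|r - r'| <= enorm (pt r t - pt r' t').
Proof.
move=> r0 r'0; rewrite -(ler_pXn2r (n := 2)) ?nnegrE ?enorm_ge0//.
rewrite enorm_ptB real_normK ?num_real// lerDl.
by rewrite mulr_ge0 ?mulr_ge0// subr_ge0 cos_le1.
Qed.

Lemma cos_le_away (c x : R) : 0 <= c -> c <= `|x| -> `|x| <= 2 * pi - c -> cos x <= cos c.
Proof.
move=> c0; have -> : cos x = cos `|x|.
  by rewrite cos_norm.
move: `|x| => {}x cx xc.
have p0 := pi_gt0 R.
have cosle a b : 0 <= a -> a <= b -> b <= pi -> cos b <= cos a.
  move=> a0 ab bp; rewrite leNgt; apply/negP.
  rewrite ltr_cos ?in_itv/= ?a0 ?(le_trans ab)// ?(le_trans a0)//.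
  by rewrite ltNge ab.
have [xp|xp] := leP x pi; first exact: cosle.
have -> : cos x = cos (2 * pi - x).
  by have := cosD2pi (- x); rewrite cosN => <-; congr cos; lra.
by apply: cosle; lra.
Qed.

Lemma polar_exists (al : R) p : exists2 t, al <= t < al + 2 * pi & p = pt (enorm p) t.
Proof.
have p0 := pi_gt0 R.
have shift (t : R) (n : nat) : cos (t + n%:R * (2 * pi)) = cos t /\ sin (t + n%:R * (2 * pi)) = sin t.
  elim: n => [|n [IH1 IH2]]; first by rewrite mul0r addr0.
  have -> : t + n.+1%:R * (2 * pi) = t + n%:R * (2 * pi) + pi + pi.
    by rewrite -natr1; ring.
  by rewrite !cosDpi !sinDpi !opprK.
have shiftz (t : R) (z : int) : pt (enorm p) (t + z%:~R * (2 * pi)) = pt (enorm p) t.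
  case: (intP z) => [|n|n]; first by rewrite mulr0z mul0r addr0.
    by rewrite /pt; have [-> ->] := shift t n.+1.
  have := shift (t - n.+1%:R * (2 * pi)) n.+1; rewrite subrK => -[e1 e2].
  by rewrite /pt rmorphN/= mulNr -e1 -e2.
have [t pt0] : exists t, p = pt (enorm p) t.
  have [e0|en0] := eqVneq (enorm p) 0.
    exists 0; rewrite e0 /pt !mul0r; have := enorm_sqr p; rewrite e0 expr0n/=.
    move/eqP; rewrite eq_sym paddr_eq0 ?sqr_ge0// !sqrf_eq0 => /andP[/eqP + /eqP].
    by case: p {e0 shiftz} => /= a b -> ->.
  have ep : 0 < enorm p by rewrite lt_neqAle eq_sym en0 enorm_ge0.
  have e2 := enorm_sqr p.
  pose a := p.1 / enorm p; pose b := p.2 / enorm p.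
  have ab : a ^+ 2 + b ^+ 2 = 1.
    by rewrite /a /b !expr_div_n -mulrDl -e2 divff// expf_neq0.
  have a1 : -1 <= a <= 1.
    rewrite -ler_norml -(ler_pXn2r (n := 2)) ?nnegrE// expr1n real_normK ?num_real//.
    by rewrite -ab lerDl sqr_ge0.
  have ca : cos (acos a) = a by apply: acosK; rewrite in_itv.
  have sa : sin (acos a) ^+ 2 = b ^+ 2 by rewrite sin2cos2 ca -ab; lra.
  have pE (t : R) : cos t = a -> sin t = b -> p = pt (enorm p) t.
    move=> h1 h2; rewrite /pt h1 h2 /a /b !mulrA ![enorm p * _]mulrC !mulfK//.
    by case: (p).
  move/eqP: sa; rewrite eqf_sqr => /orP[] /eqP sa; first by exists (acos a); apply: pE.
  by exists (- acos a); apply: pE; rewrite ?cosN// sinN sa opprK.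
pose z := Num.floor ((t - al) / (2 * pi)).
have tp : 0 < 2 * pi :> R by lra.
have h1 : z%:~R * (2 * pi) <= t - al.
  by rewrite -ler_pdivlMr// floor_le.
have h2 : t - al < (z%:~R + 1) * (2 * pi).
  by rewrite -ltr_pdivrMr// -[1]/(1%:~R) -rmorphD/= floorD1_gt.
exists (t + (- z)%:~R * (2 * pi)); last by rewrite shiftz.
by rewrite rmorphN/=; apply/andP; split; lra.
Qed.
End circles_rays.

(** * Length of a union of circles and radii *)

Section circles_rays_measure.
Context {R : realType}.

Lemma finite_pos_lower_bound n (g : nat -> R) : (forall i, (i < n)%N -> 0 < g i) ->
  exists2 t, 0 < t & forall i, (i < n)%N -> t <= g i.
Proof.
elim: n => [|n IH] h; first by exists 1.
have [|t t0 ht] := IH; first by move=> i hi; apply: h; rewrite ltnS ltnW.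
exists (Num.min t (g n)); first by rewrite lt_min t0 h.
move=> i; rewrite ltnS leq_eqVlt => /predU1P[->|hi]; first by rewrite ge_min lexx orbT.
by rewrite ge_min ht.
Qed.

Lemma sin_ge_near0 (e : R) : 0 < e ->
  exists2 t, 0 < t & forall y, 0 <= y <= t -> (1 - e) * y <= sin y.
Proof.
move=> e0; have [t [t0 ht]] := continuous_epsilon (@continuous_cos R 0) e0.
exists (t / 2); first by rewrite divr_gt0.
move=> y /andP[]; rewrite le_eqVlt => /predU1P[<- _|y0 yt]; first by rewrite mulr0 sin0.
have [c /andP[c0 cy]] := @mvt R sin cos 0 y y0 (fun z _ => is_derive_sin z).
rewrite sin0 !subr0 => ->; rewrite ler_wpM2r ?(ltW y0)//.
have := ht c; rewrite cos0 subr0 (gtr0_norm c0) => h.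
have : `|cos c - 1| < e by apply: h; lra.
by rewrite ltr_norml => /andP[]; lra.
Qed.

(** The chord is 2 rho sin (|t - t'| / 2). Being shorter than the chord of angle tau, it spans an
    angle less than tau, where the sine is nearly linear. *)
Lemma arc_dist (rho tau e d t t' : R) : 0 <= rho -> 0 < tau -> e <= 1 ->
  (forall y, 0 <= y <= tau -> (1 - e) * y <= sin y) ->
  `|t - t'| <= 2 * pi - tau -> d ^+ 2 < 2 * rho ^+ 2 * (1 - cos tau) ->
  enorm (pt rho t - pt rho t') <= d ->
  `|t - t'| < tau /\ rho * (1 - e) * `|t - t'| <= enorm (pt rho t - pt rho t').
Proof.
move=> rho0 tau0 e1 hs htt hd hD.
have dE : enorm (pt rho t - pt rho t') ^+ 2 = 2 * rho ^+ 2 * (1 - cos (t - t')).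
  by rewrite enorm_ptB subrr expr0n/= add0r expr2 !mulrA.
have r2 : 0 <= rho ^+ 2 by apply: sqr_ge0.
have lt : `|t - t'| < tau.
  rewrite ltNge; apply/negP => h.
  have hc := cos_le_away (ltW tau0) h htt.
  have : enorm (pt rho t - pt rho t') ^+ 2 <= d ^+ 2.
    by rewrite lerXn2r ?nnegrE ?enorm_ge0// (le_trans _ hD) ?enorm_ge0.
  rewrite dE => h2; have : 2 * rho ^+ 2 * (1 - cos tau) <= 2 * rho ^+ 2 * (1 - cos (t - t')).
    by rewrite ler_wpM2l ?mulr_ge0//; lra.
  lra.
split => //.
rewrite -(ler_pXn2r (n := 2)) ?nnegrE ?enorm_ge0//; last first.
  by rewrite mulr_ge0// mulr_ge0// subr_ge0.
rewrite dE -[cos _]cos_norm cos_half.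
have := hs (`|t - t'| / 2); move: (`|t - t'|) (normr_ge0 (t - t')) lt => y y0 lt h.
have {}h : (1 - e) * (y / 2) <= sin (y / 2) by apply: h; apply/andP; split; lra.
have h0 : 0 <= (1 - e) * (y / 2) by rewrite mulr_ge0 ?divr_ge0// subr_ge0.
have h2 : ((1 - e) * (y / 2)) ^+ 2 <= sin (y / 2) ^+ 2.
  by rewrite lerXn2r ?nnegrE// (le_trans h0 h).
have -> : (rho * (1 - e) * y) ^+ 2 = 4 * (rho ^+ 2 * ((1 - e) * (y / 2)) ^+ 2) by field.
have := ler_wpM2l r2 h2; move: (rho ^+ 2) (sin _ ^+ 2) (((1 - e) * _) ^+ 2) => A B C; lra.
Qed.

(** The circles have radii [r 1], ..., [r s], completed by the values 0 and 1; the radii of the disc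
    are m consecutive ones among M equally spaced directions. M may exceed m: with m = 0 each circle
    still has to be cut into at least one arc. *)
Variables (s m M : nat) (r : nat -> R) (al h : R) (N : set (R * R)).
Hypotheses (r0 : r 0%N = 0) (rS : forall i, (i <= s)%N -> r i < r i.+1) (r1 : r s.+1 = 1).
Hypotheses (M0 : (0 < M)%N) (mM : (m <= M)%N) (hM : M%:R * h = 2 * pi).
Hypothesis NE : forall p, N p <-> (exists2 i, (i < s)%N & enorm p = r i.+1) \/
  (exists j x, [/\ (j < m)%N, 0 <= x < 1 & p = pt x (al + j%:R * h)]).

Let radii_le i j : (i <= j)%N -> (j <= s.+1)%N -> r i <= r j.
Proof.
move=> ij; rewrite -(subnKC ij); elim: (j - i)%N => [|k IH] hk; first by rewrite addn0.
rewrite addnS in hk *; apply: le_trans (IH (ltnW hk)) (ltW (rS _)).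
by rewrite -ltnS.
Qed.

Let radii_ge0 i : (i <= s.+1)%N -> 0 <= r i.
Proof. by move=> hi; rewrite -r0 radii_le. Qed.

Let h_gt0 : 0 < h.
Proof.
have : 0 < M%:R * h by rewrite hM mulr_gt0 ?pi_gt0.
by rewrite pmulr_rgt0// ltr0n.
Qed.

Let step_away (j j' : nat) : (j < M)%N -> (j' < M)%N -> (j < j')%N ->
  h <= (j'%:R - j%:R) * h <= 2 * pi - h.
Proof.
move=> jM j'M jj'; rewrite -hM -[X in M%:R * h - X]mul1r -mulrBl.
have f1 : (j%:R + 1 <= j'%:R :> R) by rewrite natr1 ler_nat.
have f2 : (j'%:R + 1 <= M%:R :> R) by rewrite natr1 ler_nat.
have f3 : (0 <= j%:R :> R) by rewrite ler0n.
apply/andP; split; last by apply: ler_wpM2r; [exact: ltW|lra].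
by rewrite -{1}[h]mul1r; apply: ler_wpM2r; [exact: ltW|lra].
Qed.

Let total : R := 2 * pi * (\sum_(i < s) r i.+1) + m%:R.

Lemma circles_rays_upper : (hausdorff1 N <= total%:E)%E.
Proof.
apply: ge_ereal_sup => _ [d /= d0 <-].
apply: finite_cover_pre; first exact: ltW.
have p0 := pi_gt0 R.
have c1 : finite_cover d [set p | exists2 i, (i < s)%N & enorm p = r i.+1]
    (\sum_(i < s) r i.+1 * (2 * pi)).
  apply: finite_coverS (finite_cover_bigcup (A := fun i => (pt (r i.+1)) @` `[0, 2 * pi]%classic)
    (c := fun i => r i.+1 * (2 * pi)) _).
    move=> p [i hi e]; exists i => //; have [t] := polar_exists 0 p.
    rewrite add0r e => /andP[t0 t1] pE; exists t => //=.
    by rewrite in_itv/= t0 ltW.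
  move=> i hi; apply: finite_cover_curve => //; [exact: radii_ge0 (leqW hi)|lra|].
  by move=> x y; apply: pt_arc_le; exact: radii_ge0 (leqW hi).
have c2 : finite_cover d [set p | exists j x, [/\ (j < m)%N, 0 <= x < 1 & p = pt x (al + j%:R * h)]]
    (\sum_(j < m) 1 * 1).
  apply: finite_coverS (finite_cover_bigcup
    (A := fun j => (fun x => pt x (al + j%:R * h)) @` `[0, 1]%classic) (c := fun=> 1 * 1) _).
    move=> p [j [x [jm /andP[x0 x1] ->]]]; exists j => //; exists x => //=.
    by rewrite in_itv/= x0 ltW.
  move=> j hj; apply: finite_cover_curve => // x y.
  by rewrite pt_ray_dist mul1r.
have -> : total = \sum_(i < s) r i.+1 * (2 * pi) + \sum_(j < m) 1 * 1.
  by rewrite /total -mulr_suml mulrC mulr1 sumr_const card_ord.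
by apply: finite_coverS (finite_coverU c1 c2) => p /NE.
Qed.

(* Cut out the neighbourhoods of width [tau] of the crossings; the remaining arcs
   and segments are at positive mutual distance. *)
Lemma circles_rays_lower_eps (e : R) : 0 < e < 1 ->
  ((total - e * (2 * pi * (\sum_(i < s) r i.+1) + 2 * M%:R * (\sum_(i < s) r i.+1)
      + 2 * m%:R * s.+1%:R))%:E <= hausdorff1 N)%E.
Proof.
move=> /andP[e0 e1].
have [t1 t10 ht1] := sin_ge_near0 e0.
have [|t2 t20 ht2] := @finite_pos_lower_bound s.+1 (fun i => r i.+1 - r i).
  by move=> i; rewrite ltnS => hi; rewrite subr_gt0 rS.
(* Half of the smallest radial gap and half of the angular step keep the trimmed pieces nonempty;
   [t1] serves the sine estimate, and tau <= e bounds the total loss. *)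
pose tau := Num.min (Num.min t1 (t2 / 2)) (Num.min (h / 2) (Num.min e 1)).
have h20 : 0 < h / 2 by rewrite divr_gt0.
have t220 : 0 < t2 / 2 by rewrite divr_gt0.
have tau0 : 0 < tau by rewrite !lt_min t10 e0 h20 t220 ltr01.
have tau1 : tau <= t1 by rewrite !ge_min lexx.
have tau2 : 2 * tau <= t2.
  by rewrite mulrC -ler_pdivlMr// !ge_min lexx !orbT.
have tau3 : 2 * tau <= h.
  by rewrite mulrC -ler_pdivlMr// !ge_min lexx !orbT.
have taue : tau <= e by rewrite !ge_min lexx !orbT.
have tau5 : tau <= 1 by rewrite !ge_min lexx !orbT.
clearbody tau.
have gap i : (i <= s)%N -> 2 * tau <= r i.+1 - r i.
  by move=> hi; apply: le_trans tau2 (ht2 i _).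
have hsin y : 0 <= y <= tau -> (1 - e) * y <= sin y.
  by move=> /andP[y0 y1]; apply: ht1; rewrite y0 (le_trans y1).
have pi2 := pi_ge2 R.
pose kap := 1 - cos tau.
have kap0 : 0 < kap.
  rewrite /kap subr_gt0 -cos0 ltr_cos//; rewrite in_itv/= ?lexx/=; lra.
have kap2 : kap <= 2 by have := cos_geN1 tau; rewrite /kap; lra.
(* Less than tau, and less than the chord of angle tau at any distance rho >= tau from the origin,
   whose square is 2 rho^2 kap. *)
pose d := tau * kap / 3.
have d0 : 0 < d by rewrite !divr_gt0// mulr_gt0.
have dtau : d < tau.
  by rewrite /d -mulrA gtr_pMr// ltr_pdivrMr//; lra.
have d2 rho : tau <= rho -> d ^+ 2 < 2 * rho ^+ 2 * (1 - cos tau).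
  move=> hr; rewrite -/kap.
  have h1 : tau ^+ 2 <= rho ^+ 2 by rewrite lerXn2r ?nnegrE ?(ltW tau0)// (le_trans (ltW tau0)).
  have h2 : 0 < tau ^+ 2 * kap by rewrite mulr_gt0 ?exprn_gt0.
  have h3 : tau ^+ 2 * kap <= rho ^+ 2 * kap by rewrite ler_wpM2r// ltW.
  have h4 : tau ^+ 2 * kap * kap <= tau ^+ 2 * kap * 2 by rewrite ler_wpM2l// ltW.
  have -> : d ^+ 2 = tau ^+ 2 * kap * kap / 9 by rewrite /d; field.
  lra.
(* The pieces are arc j of circle i and segment i of radius j. *)
pose T : finType := ('I_s * 'I_M + 'I_m * 'I_s.+1)%type.
pose a (u : T) : R := match u with inl (i, j) => al + j%:R * h + tau | inr (j, i) => r i + tau end.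
pose b (u : T) : R := match u with
  inl (i, j) => al + j.+1%:R * h - tau | inr (j, i) => r i.+1 - tau end.
pose w (u : T) : R := match u with inl (i, j) => r i.+1 * (1 - e) | inr _ => 1 end.
pose P (u : T) (x : R) := match u with
  inl (i, j) => pt (r i.+1) x | inr (j, i) => pt x (al + j%:R * h) end.
have rge (i : 'I_s) : tau <= r i.+1.
  have hi : (i <= s)%N by rewrite ltnW.
  have := gap i hi; have := radii_ge0 (leqW hi); lra.
have rge0 (i : 'I_s) : 0 <= r i.+1 by apply: le_trans (ltW tau0) (rge i).
have rayx (i : 'I_s.+1) (x : R) : r i + tau <= x <= r i.+1 - tau -> tau <= x < 1.
  move=> /andP[h1 h2]; have hi : (i <= s)%N by rewrite -ltnS.
  have := radii_ge0 (leqW hi); have := @radii_le i.+1 s.+1 hi (leqnn _); rewrite r1.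
  by move=> h3 h4; apply/andP; split; lra.
have radial (i : nat) (i' : 'I_s.+1) x : (i <= s.+1)%N -> r i' + tau <= x <= r i'.+1 - tau -> tau <= `|r i - x|.
  move=> hi /andP[h1 h2]; rewrite ler_normr; have [ii|ii] := leqP i i'.
    by have := radii_le ii (leqW (ltn_ord i')); lra.
  by have := radii_le ii hi; lra.
have hlow : ((\sum_u w u * (b u - a u))%:E <= hausdorff1_pre d N)%E.
  apply: (@hausdorff1_pre_ge R T a b w P).
  - move=> [[i j]|[j i]] /=; last by have := gap i (ltn_ord i); lra.
    by rewrite -natr1 mulrDl mul1r; lra.
  - by move=> [[i j]|[j i]] //=; rewrite mulr_ge0// subr_ge0 ltW.
  - move=> [[i j]|[j i]] x /= hx; apply/NE.
      by left; exists i => //; apply: enorm_pt.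
    right; exists j, x; split => //; have /andP[h1 ->] := rayx _ _ hx.
    by rewrite (le_trans (ltW tau0)).
  - have big X (p : R * R) : tau <= X -> X <= enorm p -> enorm p <= d -> False by lra.
    move=> [[i j]|[j i]] [[i' j']|[j' i']] x y /= hx hy hD.
    + have ii' : i = i' :> nat.
        have hd := le_trans (enorm_ptB_ge x y (rge0 i) (rge0 i')) hD.
        case: (ltngtP i i') => // ii; exfalso.
          have g := gap _ (ltn_ord i); have g2 := gap _ (ltnW (ltn_ord i')).
          have := @radii_le i.+1 i' ii (leqW (ltnW (ltn_ord i'))).
          by move: hd; rewrite ler_norml => /andP[]; lra.
        have g := gap _ (ltn_ord i); have g2 := gap _ (ltnW (ltn_ord i)).
        have := @radii_le i'.+1 i ii (leqW (ltnW (ltn_ord i))).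
        by move: hd; rewrite ler_norml => /andP[]; lra.
      move/val_inj: ii' => ii'; subst i'.
      move: hx hy; rewrite -!natr1 !mulrDl !mul1r => /andP[x1 x2] /andP[y1 y2].
      have lastM (l : 'I_M) : l%:R * h <= 2 * pi - h.
        rewrite -hM -{3}[h]mul1r -mulrBl ler_wpM2r ?(ltW h_gt0)//.
        by rewrite lerBrDr natr1 ler_nat.
      have firstM (l : 'I_M) : 0 <= l%:R * h by rewrite mulr_ge0 ?(ltW h_gt0).
      have xy : `|x - y| <= 2 * pi - tau.
        by rewrite ler_norml; have := lastM j; have := lastM j'; have := firstM j;
           have := firstM j'; move=> *; apply/andP; split; lra.
      have [lt res] := arc_dist (rge0 i) tau0 (ltW e1) hsin xy (d2 _ (rge i)) hD.
      split => //; suff -> : j = j' by [].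
      apply: val_inj => /=; case: (ltngtP j j') => // jj; exfalso.
        have /andP[+ _] := step_away (ltn_ord j) (ltn_ord j') jj.
        by rewrite mulrBl => ?; move: lt; rewrite ltr_norml => /andP[]; lra.
      have /andP[+ _] := step_away (ltn_ord j') (ltn_ord j) jj.
      by rewrite mulrBl => ?; move: lt; rewrite ltr_norml => /andP[]; lra.
    + exfalso; have /andP[y1 _] := rayx _ _ hy.
      have h1 := radial i.+1 i' y (leqW (ltn_ord i)) hy.
      exact: (big _ _ h1 (enorm_ptB_ge x (al + j'%:R * h) (rge0 i) (le_trans (ltW tau0) y1)) hD).
    + exfalso; have /andP[x1 _] := rayx _ _ hx.
      have h1 := radial i'.+1 i x (leqW (ltn_ord i')) hx; rewrite distrC in h1.
      exact: (big _ _ h1 (enorm_ptB_ge (al + j%:R * h) y (le_trans (ltW tau0) x1) (rge0 i')) hD).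
    + have /andP[x1 _] := rayx _ _ hx; have /andP[y1 _] := rayx _ _ hy.
      have x0 := le_trans (ltW tau0) x1; have y0 := le_trans (ltW tau0) y1.
      have jj' : j = j'.
        apply: val_inj => /=; case: (eqVneq (j : nat) j') => // jj; exfalso.
        have hc : cos (al + j%:R * h - (al + j'%:R * h)) <= cos tau.
          have -> : al + j%:R * h - (al + j'%:R * h) = (j%:R - j'%:R) * h by ring.
          suff /andP[h1 h2] : h <= `|(j%:R - j'%:R) * h| <= 2 * pi - h.
            by apply: cos_le_away; lra.
          have jM := leq_trans (ltn_ord j) mM; have jM' := leq_trans (ltn_ord j') mM.
          move: jj; rewrite neq_ltn => /orP[] jj.
            by rewrite -normrN -mulNr opprB gtr0_norm ?step_away// mulr_gt0// subr_gt0 ltr_nat.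
          by rewrite gtr0_norm ?step_away// mulr_gt0// subr_gt0 ltr_nat.
        have : enorm (pt x (al + j%:R * h) - pt y (al + j'%:R * h)) ^+ 2 <= d ^+ 2.
          by rewrite lerXn2r ?nnegrE ?enorm_ge0// ltW.
        rewrite enorm_ptB => hle.
        have xy : tau ^+ 2 <= x * y by rewrite expr2 ler_pM// ltW.
        have := d2 tau (lexx _).
        have : 2 * tau ^+ 2 * (1 - cos tau) <=
          2 * x * y * (1 - cos (al + j%:R * h - (al + j'%:R * h))).
          move: hc; move: (cos (al + _ - _)) => C hc.
          have hk : kap <= 1 - C by rewrite /kap lerD2l lerN2.
          have := ler_pM (sqr_ge0 tau) (ltW kap0) xy hk.
          by rewrite -/kap -[2 * x * y]mulrA -!(mulrA 2) ler_pM2l.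
        have := sqr_ge0 (x - y); lra.
      subst j'; rewrite pt_ray_dist mul1r; split => //.
      congr (inr (_, _)); apply: val_inj => /=; rewrite pt_ray_dist in hD.
      case: (ltngtP i i') => // ii; exfalso.
        have := radii_le ii (leqW (ltn_ord i')); move: hx hy hD.
        by rewrite ler_norml => /andP[? ?] /andP[? ?] /andP[]; lra.
      have := radii_le ii (leqW (ltn_ord i)); move: hx hy hD.
      by rewrite ler_norml => /andP[? ?] /andP[? ?] /andP[]; lra.
apply: le_trans (le_trans hlow _); last by apply: ereal_sup_ubound; exists d.
have -> : \sum_u w u * (b u - a u) =
    \sum_(i < s) \sum_(j < M) r i.+1 * (1 - e) *
    (al + j.+1%:R * h - tau - (al + j%:R * h + tau)) +
    \sum_(j < m) \sum_(i < s.+1) 1 * (r i.+1 - tau - (r i + tau)).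
  by rewrite big_sumType !pair_bigA; congr (_ + _); apply: eq_bigr => -[].
rewrite lee_fin.
have -> : \sum_(i < s) \sum_(j < M) r i.+1 * (1 - e) *
    (al + j.+1%:R * h - tau - (al + j%:R * h + tau)) =
    (1 - e) * (2 * pi - 2 * tau * M%:R) * \sum_(i < s) r i.+1.
  rewrite mulr_sumr; apply: eq_bigr => i _.
  under eq_bigr => j _.
    have -> : al + j.+1%:R * h - tau - (al + j%:R * h + tau) = h - 2 * tau by rewrite -natr1; ring.
    over.
  by rewrite sumr_const card_ord -[LHS]mulr_natr -hM; ring.
have -> : \sum_(j < m) \sum_(i < s.+1) 1 * (r i.+1 - tau - (r i + tau)) =
    m%:R * (1 - 2 * tau * s.+1%:R).
  rewrite sumr_const card_ord -[LHS]mulr_natr mulrC; congr (_ * _).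
  under eq_bigr => i _.
    have -> : 1 * (r i.+1 - tau - (r i + tau)) = (r i.+1 - r i) - 2 * tau by ring.
    over.
  rewrite big_split/= sumr_const card_ord -(big_mkord xpredT (fun i => r i.+1 - r i)).
  by rewrite telescope_sumr// r1 r0 -[X in _ + X]mulr_natr; ring.
set S := \sum_(i < s) _.
have S0 : 0 <= S by apply: sumr_ge0.
have M0' : 0 <= M%:R :> R by [].
have m0' : 0 <= m%:R * s.+1%:R :> R by rewrite mulr_ge0.
have hA : tau * (m%:R * s.+1%:R) <= e * (m%:R * s.+1%:R) by rewrite ler_wpM2r.
have hB : (1 - e) * tau * (M%:R * S) <= e * (M%:R * S).
  rewrite ler_wpM2r// ?mulr_ge0//; have := mulr_gt0 e0 tau0; rewrite mulrBl mul1r; lra.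
rewrite /total -/S; nra.
Qed.

Lemma hausdorff1_circles_rays : hausdorff1 N = total%:E.
Proof.
apply/eqP; rewrite eq_le circles_rays_upper/=.
set K := 2 * pi * (\sum_(i < s) r i.+1) + 2 * M%:R * (\sum_(i < s) r i.+1) + 2 * m%:R * s.+1%:R.
have S0 : 0 <= \sum_(i < s) r i.+1.
  by apply: sumr_ge0 => i _; apply: radii_ge0; rewrite ltnS ltnW.
have K0 : 0 <= K by rewrite /K !addr_ge0// ?mulr_ge0// pi_ge0.
have low := circles_rays_lower_eps; rewrite -/K in low.
have := circles_rays_upper.
case: (hausdorff1 N) low => [x||] low //.
  move=> _; rewrite lee_fin leNgt; apply/negP => xt.
  pose e := Num.min (1 / 2) ((total - x) / (K + 1) / 2).
  have tx : 0 < total - x by rewrite subr_gt0.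
  have K1 : 0 < K + 1 by lra.
  have e0 : 0 < e by rewrite lt_min !divr_gt0.
  have e1 : e < 1 by rewrite gt_min; apply/orP; left; lra.
  have := low e; rewrite e0 e1 lee_fin => /(_ isT).
  have : e * K <= (total - x) / 2.
    apply: (@le_trans _ _ (e * (K + 1))); first by rewrite ler_wpM2l ?(ltW e0)//; lra.
    rewrite -ler_pdivlMr//; apply: (@le_trans _ _ ((total - x) / (K + 1) / 2)).
      by rewrite /e ge_min lexx orbT.
    by rewrite mulrAC.
  lra.
have h12 : 0 < (1 / 2 : R) < 1 by apply/andP; split; lra.
by have := low _ h12.
Qed.
End circles_rays_measure.

(** * Classification of the eigenfunctions *)

Section circle_integral.
Context {R : realType}.
Implicit Types f g e : R -> R.

(* The integral over [0, 2pi] of a function, as the increment of an antiderivative. *)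
Definition is_circle_int f (z : R) := exists2 F : R -> R,
  (forall x, 0 <= x <= 2 * pi -> is_derive x 1 F (f x)) & z = F (2 * pi) - F 0.

Definition circle_int f : R := xget 0 (is_circle_int f).

Lemma is_circle_int_unique f a b : is_circle_int f a -> is_circle_int f b -> a = b.
Proof.
move=> [F hF ->] [G hG ->].
have h (x : R) : 0 <= x <= 2 * pi -> is_derive x 1 (fun x => F x - G x) 0.
  by move=> hx; rewrite -(subrr (f x)); apply: dsub; [exact: hF|exact: hG].
have := @derive_eq0_eq R (fun x => F x - G x) 0 (2 * pi) _ h.
by rewrite mulr_ge0 ?pi_ge0// => /(_ isT); lra.
Qed.

Lemma circle_intE f z : is_circle_int f z -> circle_int f = z.
Proof.
by move=> h; exact: is_circle_int_unique (xgetI 0 h) h.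
Qed.

Lemma continuous_primitive f : continuous f ->
  exists F : R -> R, forall x : R, 0 <= x -> is_derive x 1 F (f x).
Proof.
(* The lower end -1 makes the primitive differentiable at 0 from both sides. *)
move=> cf; exists (fun y => (\int[lebesgue_measure]_(t in `[-1, y]) f t)%R).
move=> x x0.
have x1 : -1 < x by lra.
have xu : x < x + 1 by rewrite ltrDl.
have int1 : lebesgue_measure.-integrable `[-1, x + 1] (EFin \o f).
  apply: continuous_compact_integrable; first exact: segment_compact.
  by apply: continuous_subspaceT => y; exact: cf.
have [h1 h2] := continuous_FTC1_closed xu int1 x1 (cf x).
by split; [exact: h1|rewrite -h2 derive1E].
Qed.

Lemma circle_intP f : continuous f -> is_circle_int f (circle_int f).
Proof.
move=> /continuous_primitive[F hF].
have h : is_circle_int f (F (2 * pi) - F 0) by exists F => // x /andP[x0 _]; exact: hF.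
by rewrite (circle_intE h).
Qed.

Lemma circle_intD f g : continuous f -> continuous g ->
  circle_int (fun x => f x + g x) = circle_int f + circle_int g.
Proof.
move=> /circle_intP[F hF ->] /circle_intP[G hG ->].
apply: circle_intE; exists (fun x => F x + G x); last by ring.
by move=> x hx; apply: dadd; [exact: hF|exact: hG].
Qed.

Lemma circle_intZ k f : continuous f -> circle_int (fun x => k * f x) = k * circle_int f.
Proof.
move=> /circle_intP[F hF ->].
apply: circle_intE; exists (fun x => k * F x); last by ring.
by move=> x hx; apply: dscale; exact: hF.
Qed.

Lemma circle_intB f g : continuous f -> continuous g ->
  circle_int (fun x => f x - g x) = circle_int f - circle_int g.
Proof.
move=> /circle_intP[F hF ->] /circle_intP[G hG ->].
apply: circle_intE; exists (fun x => F x - G x); last by ring.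
by move=> x hx; apply: dsub; [exact: hF|exact: hG].
Qed.

Lemma eq_circle_int f g : f =1 g -> circle_int f = circle_int g.
Proof. by move=> /funext ->. Qed.

Lemma circle_int_le f (B : R) : continuous f -> (forall x, 0 <= x <= 2 * pi -> f x <= B) ->
  circle_int f <= 2 * pi * B.
Proof.
move=> /circle_intP[F hF ->] hB; have p0 := pi_gt0 R.
have [|c /andP[c0 c1] ->] := @mvt R F f 0 (2 * pi) _ hF; first lra.
by rewrite subr0 mulrC ler_wpM2l ?hB ?(ltW c0) ?(ltW c1)//; lra.
Qed.

Lemma circle_int_abs f (B : R) : continuous f -> (forall x, 0 <= x <= 2 * pi -> `|f x| <= B) ->
  `|circle_int f| <= 2 * pi * B.
Proof.
move=> cf hB; rewrite ler_norml; apply/andP; split; last first.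
  by apply: circle_int_le => // x /hB; rewrite ler_norml => /andP[].
have := @circle_int_le (fun x => -1 * f x) B; rewrite circle_intZ// => h.
suff : -1 * circle_int f <= 2 * pi * B by lra.
apply: h; first by move=> x; apply: cvgM; [exact: cvg_cst|exact: cf].
by move=> x /hB; rewrite ler_norml => /andP[]; lra.
Qed.

(** As e'' = - k^2 e, the integrand is g'' e - g e'', the derivative of g' e - g e'. *)
Lemma circle_int_parts (g dg ddg e de : R -> R) (k : R) :
  (forall x : R, is_derive x 1 g (dg x)) -> (forall x : R, is_derive x 1 dg (ddg x)) ->
  g 0 = g (2 * pi) -> dg 0 = dg (2 * pi) ->
  (forall x : R, is_derive x 1 e (de x)) -> (forall x : R, is_derive x 1 de (- k ^+ 2 * e x)) ->
  e 0 = e (2 * pi) -> de 0 = de (2 * pi) ->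
  is_circle_int (fun x => ddg x * e x + k ^+ 2 * (g x * e x)) 0.
Proof.
move=> hg hdg g0 dg0 he hde e0 de0.
exists (fun x => dg x * e x - g x * de x); last by rewrite g0 dg0 e0 de0 subrr.
move=> x _; apply: is_derive_eq (dsub (dmul (hdg x) (he x)) (dmul (hg x) (hde x))) _.
by rewrite mulrA; ring.
Qed.

Lemma derive_under_circle_int (F : R -> R -> R) (G : R -> R) (r : R) :
  (\forall x \near r, continuous (F x)) -> continuous G ->
  (forall e : R, 0 < e -> exists2 d, 0 < d & forall x t, `|x - r| < d -> 0 <= t <= 2 * pi ->
     `|F x t - F r t - (x - r) * G t| <= e * `|x - r|) ->
  is_derive r 1 (fun x => circle_int (F x)) (circle_int G).
Proof.
move=> cF cG hF.
have cFr : continuous (F r) by exact: nbhs_singleton cF.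
have p0 := pi_gt0 R.
suff h : h^-1 *: (circle_int (F (h *: (1:R) + r)) - circle_int (F r)) @[h --> 0^'] --> circle_int G.
  by apply: DeriveDef; [apply/cvg_ex; exists (circle_int G)|apply: cvg_lim].
apply/(@cvgrPdist_le _ R^o) => e e0.
have e'0 : 0 < e / (2 * pi) by rewrite divr_gt0// mulr_gt0.
have [d d0 hd] := hF _ e'0.
have [d' /= d'0 cF'] := (@nbhs_ballP _ _ _ _).1 cF.
near=> h.
have h0 : h != 0 by near: h; exact: nbhs_dnbhs_neq.
have hsmall : `|h| < d.
  by near: h; apply: dnbhs0_lt.
have hsmall' : `|h| < d' by near: h; apply: dnbhs0_lt.
have ch : continuous (F (h + r)).
  by apply: cF'; rewrite -ball_normE/= opprD addrCA subrr addr0 normrN.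
rewrite /= /GRing.scale/= mulr1.
have -> : circle_int G - h^-1 * (circle_int (F (h + r)) - circle_int (F r)) =
  h^-1 * (h * circle_int G - (circle_int (F (h + r)) - circle_int (F r))).
  by rewrite [RHS]mulrBr mulKf.
have cGh : continuous (fun t => h * G t).
  by move=> x; apply: cvgM; [exact: cvg_cst|exact: cG].
have cB : continuous (fun t => F (h + r) t - F r t).
  by move=> x; apply: cvgB; [exact: ch|exact: cFr].
rewrite -circle_intZ// -circle_intB// -circle_intB//.
rewrite normrM normfV mulrC ler_pdivrMr ?normr_gt0//.
have -> : e * `|h| = 2 * pi * (e / (2 * pi) * `|h|) by rewrite mulrA [2 * pi * _]mulrC divfK// gt_eqF// mulr_gt0.
apply: circle_int_abs.
  by move=> x; apply: cvgB; [exact: cGh|exact: cB].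
move=> t ht; rewrite distrC; have := hd (h + r) t; rewrite addrK.
by apply.
Unshelve. all: by end_near.
Qed.

End circle_integral.

(** * Functions of two variables with continuous gradient *)

Section plane_calculus.
Context {R : realType}.
Implicit Types (f fx fy g gx gy u : R * R -> R) (p : R * R).

Lemma is_derive_dir_x f p d :
  is_derive p dir_x f d <-> is_derive p.1 1 (fun x => f (x, p.2)) d.
Proof.
have E : (fun h => h^-1 *: (f (h *: dir_x + p) - f p)) =
    (fun h : R => h^-1 *: (f (h *: (1 : R) + p.1, p.2) - f (p.1, p.2))).
  apply/funext => h; congr (_ *: (f _ - f _)); last by case: (p).
  by case: (p) => a b; rewrite /GRing.scale/= /dir_x; congr pair; rewrite /= /GRing.scale/= mulr0 add0r.
by split=> -[h1 h2]; split; move: h1 h2; rewrite /derivable /derive E.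
Qed.

Lemma is_derive_dir_y f p d :
  is_derive p dir_y f d <-> is_derive p.2 1 (fun y => f (p.1, y)) d.
Proof.
have E : (fun h => h^-1 *: (f (h *: dir_y + p) - f p)) =
    (fun h : R => h^-1 *: (f (p.1, h *: (1 : R) + p.2) - f (p.1, p.2))).
  apply/funext => h; congr (_ *: (f _ - f _)); last by case: (p).
  by case: (p) => a b; rewrite /GRing.scale/= /dir_y; congr pair; rewrite /= /GRing.scale/= mulr0 add0r.
by split=> -[h1 h2]; split; move: h1 h2; rewrite /derivable /derive E.
Qed.

Definition has_grad f fx fy := forall p, unit_disc p ->
  [/\ is_derive p dir_x f (fx p), is_derive p dir_y f (fy p),
      {for p, continuous fx} & {for p, continuous fy}].

Lemma continuous2_epsilon f p : {for p, continuous f} -> forall e, 0 < e ->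
  exists2 d, 0 < d & forall x y, `|x - p.1| < d -> `|y - p.2| < d -> `|f (x, y) - f p| < e.
Proof.
move=> fp e e0; move: fp => /(@cvgrPdist_lt _ R^o) /(_ e e0) /nbhs_ballP[d /= d0 hd].
exists d => // x y hx hy; rewrite distrC; apply: (hd (x, y)).
by split; rewrite -ball_normE/= distrC.
Qed.

Lemma epsilon_continuous2 f p : (forall e, 0 < e ->
  exists2 d, 0 < d & forall x y, `|x - p.1| < d -> `|y - p.2| < d -> `|f (x, y) - f p| < e) ->
  {for p, continuous f}.
Proof.
move=> h; apply/(@cvgrPdist_lt _ R^o) => e e0; have [d d0 hd] := h e e0.
suff : nbhs p [set q | `|f p - f q| < e] by [].
apply/(@nbhs_ballP R (R * R)%type); exists d => // -[x y] [/=]; rewrite -!ball_normE/= => hx hy.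
by rewrite distrC; apply: hd; rewrite distrC.
Qed.

Lemma unit_disc_box p : unit_disc p ->
  exists2 d, 0 < d & forall x y, `|x - p.1| < d -> `|y - p.2| < d -> unit_disc (x, y).
Proof.
rewrite /unit_disc /= => hp.
pose d := Num.min 1 ((1 - (p.1 ^+ 2 + p.2 ^+ 2)) / (4 * (1 + `|p.1| + `|p.2|))).
have K0 : 0 < 4 * (1 + `|p.1| + `|p.2|).
  by rewrite mulr_gt0// -addrA ltr_pwDl// addr_ge0.
have d0 : 0 < d by rewrite lt_min ltr01/= divr_gt0// subr_gt0.
have d1 : d <= 1 by rewrite ge_min lexx.
have d2 : d * (4 * (1 + `|p.1| + `|p.2|)) <= 1 - (p.1 ^+ 2 + p.2 ^+ 2).
  by rewrite -ler_pdivlMr// ge_min lexx orbT.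
exists d => // x y hx hy.
have sq (a b : R) : `|b - a| < d -> b ^+ 2 <= a ^+ 2 + d * (2 * `|a| + 1).
  move=> h; have -> : b ^+ 2 = a ^+ 2 + ((b - a) * (2 * a) + (b - a) * (b - a)) by ring.
  rewrite lerD2l [d * _]mulrDr mulr1 lerD//.
    apply: le_trans (ler_norm _) _; rewrite normrM ler_pM// ?(ltW h)//.
    by rewrite normrM gtr0_norm.
  apply: le_trans (ler_norm _) _; rewrite normrM -[leRHS]mulr1 ler_pM// ?(ltW h)// ltW//.
  by rewrite (lt_le_trans h).
have := sq _ _ hx; have := sq _ _ hy.
have a1 := normr_ge0 p.1; have a2 := normr_ge0 p.2.
have := mulr_ge0 (ltW d0) a1; have := mulr_ge0 (ltW d0) a2.
rewrite /=; lra.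
Qed.

Lemma mvt_increment (g dg : R -> R) (a b c e : R) :
  (forall z, `|z - a| <= `|b - a| -> is_derive z 1 g (dg z)) ->
  (forall z, `|z - a| <= `|b - a| -> `|dg z - c| < e) ->
  `|g b - g a - c * (b - a)| <= e * `|b - a|.
Proof.
move=> gd hc; have [ab|ba|->] := ltgtP a b; last by rewrite !subrr mulr0 subrr normr0 mulr0.
  have [|z /andP[z1 z2] ->] := @mvt R g dg a b ab.
    move=> z /andP[z1 z2]; apply: gd.
    by rewrite !ger0_norm ?subr_ge0//; [rewrite lerD2r|exact: ltW].
  rewrite -mulrBl normrM ler_wpM2r// ltW// hc//.
  by rewrite !ger0_norm ?subr_ge0//; [rewrite lerD2r|..]; exact: ltW.
have [|z /andP[z1 z2] hz] := @mvt R g dg b a ba.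
  move=> z /andP[z1 z2]; apply: gd.
  by rewrite !ler0_norm ?subr_le0//; [rewrite lerN2 lerD2r|exact: ltW].
have -> : g b - g a - c * (b - a) = (dg z - c) * (b - a).
  by rewrite mulrBl; congr (_ - _); rewrite -[LHS]opprB hz; ring.
rewrite normrM ler_wpM2r// ltW// hc//.
by rewrite !ler0_norm ?subr_le0//; [rewrite lerN2 lerD2r|..]; exact: ltW.
Qed.

(** Mean value theorem along a horizontal and a vertical segment, both in a box contained in the
    disc. *)
Lemma grad_increment f fx fy p : has_grad f fx fy -> unit_disc p -> forall e, 0 < e ->
  exists2 d, 0 < d & forall x y, `|x - p.1| < d -> `|y - p.2| < d ->
    `|f (x, y) - f p - (fx p * (x - p.1) + fy p * (y - p.2))| <= e * (`|x - p.1| + `|y - p.2|).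
Proof.
move=> hf dp e e0; have [d1 d10 h1] := unit_disc_box dp.
have [_ _ cx cy] := hf p dp.
have [d2 d20 h2] := continuous2_epsilon cx e0.
have [d3 d30 h3] := continuous2_epsilon cy e0.
pose d := Num.min d1 (Num.min d2 d3).
exists d => [|x y]; first by rewrite !lt_min d10 d20 d30.
rewrite !lt_min => /and3P[x1 x2 x3] /and3P[y1 y2 y3].
have p0 : `|p.1 - p.1| = 0 by rewrite subrr normr0.
have q0 : `|p.2 - p.2| = 0 by rewrite subrr normr0.
have A : `|f (x, y) - f (x, p.2) - fy p * (y - p.2)| <= e * `|y - p.2|.
  apply: (@mvt_increment (fun z => f (x, z)) (fun z => fy (x, z))) => z hz.
    apply/(is_derive_dir_y f (x, z)).
    by have [] := hf (x, z) (h1 _ _ x1 (le_lt_trans hz y1)).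
  by apply: h3 => //; exact: le_lt_trans hz y3.
have B : `|f (x, p.2) - f (p.1, p.2) - fx p * (x - p.1)| <= e * `|x - p.1|.
  apply: (@mvt_increment (fun z => f (z, p.2)) (fun z => fx (z, p.2))) => z hz.
    apply/(is_derive_dir_x f (z, p.2)).
    have dz : unit_disc (z, p.2) by apply: h1; rewrite ?q0// (le_lt_trans hz x1).
    by have [] := hf (z, p.2) dz.
  by apply: h2; rewrite ?q0// (le_lt_trans hz x2).
rewrite -surjective_pairing in B.
have -> : f (x, y) - f p - (fx p * (x - p.1) + fy p * (y - p.2)) =
  (f (x, y) - f (x, p.2) - fy p * (y - p.2)) + (f (x, p.2) - f p - fx p * (x - p.1)) by ring.
by apply: le_trans (ler_normD _ _) _; rewrite [leRHS]mulrDr [leRHS]addrC lerD.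
Qed.

Lemma grad_continuous f fx fy p : has_grad f fx fy -> unit_disc p -> {for p, continuous f}.
Proof.
move=> hf dp; apply: epsilon_continuous2 => e e0.
have [d d0 hd] := grad_increment hf dp ltr01.
pose K := 2 + `|fx p| + `|fy p|.
have K0 : 0 < K by rewrite /K -addrA ltr_pwDl// addr_ge0.
pose d' := Num.min d (e / (2 * K)).
have d'0 : 0 < d' by rewrite lt_min d0 divr_gt0// mulr_gt0.
exists d' => // x y hx hy.
have hxd : `|x - p.1| < d by apply: lt_le_trans hx _; rewrite ge_min lexx.
have hyd : `|y - p.2| < d by apply: lt_le_trans hy _; rewrite ge_min lexx.
have d'e : d' * (2 * K) <= e by rewrite -ler_pdivlMr ?mulr_gt0// ge_min lexx orbT.
have := hd x y hxd hyd; rewrite mul1r => h.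
have h1 : `|fx p * (x - p.1) + fy p * (y - p.2)| <= `|fx p| * d' + `|fy p| * d'.
  by apply: le_trans (ler_normD _ _) _; rewrite !normrM lerD// ler_wpM2l// ltW.
have h2 : `|f (x, y) - f p| <= `|f (x, y) - f p - (fx p * (x - p.1) + fy p * (y - p.2))| +
    `|fx p * (x - p.1) + fy p * (y - p.2)|.
  by rewrite -[in leLHS](subrK (fx p * (x - p.1) + fy p * (y - p.2)) (f (x, y) - f p)) ler_normD.
have a1 := mulr_ge0 (normr_ge0 (fx p)) (ltW d'0).
have a2 := mulr_ge0 (normr_ge0 (fy p)) (ltW d'0).
rewrite /K in d'e; nra.
Qed.

Lemma grad_chain f fx fy (a b : R -> R) (t da db : R) : has_grad f fx fy ->
  unit_disc (a t, b t) -> is_derive t 1 a da -> is_derive t 1 b db ->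
  is_derive t 1 (fun s => f (a s, b s)) (da * fx (a t, b t) + db * fy (a t, b t)).
Proof.
move=> hf dp ha hb.
set L := da * _ + db * _.
suff h : h^-1 *: (f (a (h *: (1:R) + t), b (h *: (1:R) + t)) - f (a t, b t)) @[h --> (0:R)^'] --> L.
  by apply: DeriveDef; [apply/cvg_ex; exists L|apply: cvg_lim].
apply/(@cvgrPdist_lt _ R^o) => e e0.
pose X := fx (a t, b t); pose Y := fy (a t, b t).
pose K := `|da| + `|db| + 2.
have K0 : 0 < K by rewrite /K ltr_wpDl// addr_ge0.
have e1 : 0 < e / (4 * K) by rewrite divr_gt0// mulr_gt0.
have [d d0 hd] := grad_increment hf dp e1.
pose M := 1 + `|X| + `|Y|.
have M0 : 0 < M by rewrite /M -addrA ltr_pwDl// addr_ge0.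
have e2 : 0 < Num.min 1 (e / (4 * M)) by rewrite lt_min ltr01 divr_gt0// mulr_gt0.
have [d1 d10 hd1] := is_derive_epsilon ha e2.
have [d2 d20 hd2] := is_derive_epsilon hb e2.
have [d3 d30 hd3] := continuous_epsilon (is_derive_continuous ha) d0.
have [d4 d40 hd4] := continuous_epsilon (is_derive_continuous hb) d0.
near=> h.
have h0 : h != 0 by near: h; exact: nbhs_dnbhs_neq.
have s1 : `|h| < d1 by near: h; apply: dnbhs0_lt.
have s2 : `|h| < d2 by near: h; apply: dnbhs0_lt.
have s3 : `|h| < d3 by near: h; apply: dnbhs0_lt.
have s4 : `|h| < d4 by near: h; apply: dnbhs0_lt.
have th : t + h - t = h by ring.
rewrite /= /GRing.scale/= mulr1 [h + t]addrC.
have /= := hd (a (t + h)) (b (t + h)) (hd3 _ _) (hd4 _ _).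
rewrite !th => /(_ s3 s4); rewrite -/X -/Y.
have := hd1 h h0 s1; have := hd2 h h0 s2.
set A := (a (t + h) - a t) / h; set B := (b (t + h) - b t) / h.
have -> : a (t + h) - a t = A * h by rewrite divfK.
have -> : b (t + h) - b t = B * h by rewrite divfK.
clearbody A B.
rewrite !lt_min => /andP[B1 B2] /andP[A1 A2] H.
have hA : `|A| <= `|da| + 1.
  by rewrite -[A](subrK da) (le_trans (ler_normD _ _))// addrC lerD2l ltW.
have hB : `|B| <= `|db| + 1.
  by rewrite -[B](subrK db) (le_trans (ler_normD _ _))// addrC lerD2l ltW.
have hn : 0 < `|h| by rewrite normr_gt0.
set D := f _ - f _ in H *.
have H2 : `|D / h - (X * A + Y * B)| <= e / 4.
  have -> : D / h - (X * A + Y * B) = (D - (X * (A * h) + Y * (B * h))) / h by field.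
  rewrite normrM normfV ler_pdivrMr//; apply: (le_trans H).
  rewrite !normrM -mulrDl mulrA ler_wpM2r//.
  have -> : e / 4 = e / (4 * K) * K by field; rewrite gt_eqF.
  by rewrite ler_wpM2l ?(ltW e1)//; rewrite /K; lra.
have -> : L - h^-1 * D = X * (da - A) + Y * (db - B) - (D / h - (X * A + Y * B)).
  by rewrite /L -/X -/Y [h^-1 * D]mulrC; ring.
apply: le_lt_trans (ler_normB _ _) _.
have : `|X * (da - A) + Y * (db - B)| <= (`|X| + `|Y|) * (e / (4 * M)).
  apply: le_trans (ler_normD _ _) _; rewrite !normrM mulrDl lerD// ler_wpM2l// distrC ltW//.
have : (`|X| + `|Y|) * (e / (4 * M)) <= e / 4.
  have -> : e / 4 = M * (e / (4 * M)) by field; rewrite gt_eqF.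
  by rewrite ler_wpM2r ?divr_ge0 ?mulr_ge0 ?(ltW e0) ?(ltW M0)//; rewrite /M; lra.
lra.
Unshelve. all: by end_near.
Qed.

(** Applied to (u_x, u_y) for the radial derivative r u_r = x u_x + y u_y, and to (u_y, - u_x) for
    the angular derivative x u_y - y u_x. *)
Lemma grad_coord_comb f fx fy g gx gy : has_grad f fx fy -> has_grad g gx gy ->
  has_grad (fun p => p.1 * f p + p.2 * g p)
    (fun p => f p + p.1 * fx p + p.2 * gx p) (fun p => p.1 * fy p + (g p + p.2 * gy p)).
Proof.
move=> hf hg p dp; have [f1 f2 f3 f4] := hf p dp; have [g1 g2 g3 g4] := hg p dp.
have cf := grad_continuous hf dp; have cg := grad_continuous hg dp.
have c1 : {for p, continuous (fun q : R * R => q.1)} by exact: cvg_fst.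
have c2 : {for p, continuous (fun q : R * R => q.2)} by exact: cvg_snd.
split.
- move: f1 g1 => /is_derive_dir_x f1 /is_derive_dir_x g1; apply/is_derive_dir_x => /=.
  apply: is_derive_eq (dadd (dmul (did p.1) f1) (dscale p.2 g1)) _.
  by rewrite /= mul1r -surjective_pairing.
- move: f2 g2 => /is_derive_dir_y f2 /is_derive_dir_y g2; apply/is_derive_dir_y => /=.
  apply: is_derive_eq (dadd (dscale p.1 f2) (dmul (did p.2) g2)) _.
  by rewrite /= mul1r -surjective_pairing.
- apply: cvgD; [apply: cvgD => //|]; exact: cvgM.
- by apply: cvgD; [exact: cvgM|apply: cvgD => //; exact: cvgM].
Qed.

Lemma grad_opp f fx fy : has_grad f fx fy ->
  has_grad (fun p => - f p) (fun p => - fx p) (fun p => - fy p).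
Proof.
move=> hf p dp; have [f1 f2 f3 f4] := hf p dp; split.
- by move: f1 => /is_derive_dir_x f1; apply/is_derive_dir_x; exact: dopp f1.
- by move: f2 => /is_derive_dir_y f2; apply/is_derive_dir_y; exact: dopp f2.
- exact: cvgN.
- exact: cvgN.
Qed.

End plane_calculus.

(** * Angular Fourier coefficients on circles *)

Section polar_calculus.
Context {R : realType}.
Implicit Types (f fx fy : R * R -> R) (r t : R).

Lemma circle_uniform (P : R -> R -> Prop) (r : R) :
  (forall t0, 0 <= t0 <= 2 * pi -> exists2 d, 0 < d &
     forall x t, `|x - r| < d -> `|t - t0| < d -> P x t) ->
  exists2 d, 0 < d & forall x t, `|x - r| < d -> 0 <= t <= 2 * pi -> P x t.
Proof.
move=> h.
have := (compact_near_coveringP `[0, 2 * pi :> R]%classic).1 (@segment_compact R 0 (2 * pi)).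
move/(_ R (nbhs r) P _).
have hh : forall t, `[0, 2 * pi]%classic t -> \forall t' \near t & x \near r, P x t'.
  move=> t /=; rewrite in_itv/= => ht; have [d d0 hd] := h t ht.
  exists ([set y | `|y - t| < d], [set y | `|y - r| < d]).
    by split; apply/(@nbhs_ballP R R); exists d => // y; rewrite -ball_normE/= distrC.
  by move=> [y x] [/= hy hx]; exact: hd.
move/(_ hh) => /nbhs_ballP[d /= d0 hd]; exists d => // x t hx ht.
apply: (hd x); first by rewrite -ball_normE/= distrC.
by rewrite /= in_itv.
Qed.

Lemma abs_fst_le (p : R * R) : `|p.1| <= enorm p.
Proof.
rewrite -(ler_pXn2r (n := 2)) ?nnegrE ?enorm_ge0//.
by rewrite enorm_sqr real_normK ?num_real// lerDl sqr_ge0.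
Qed.

Lemma abs_snd_le (p : R * R) : `|p.2| <= enorm p.
Proof.
rewrite -(ler_pXn2r (n := 2)) ?nnegrE ?enorm_ge0//.
by rewrite enorm_sqr real_normK ?num_real// lerDr sqr_ge0.
Qed.

Lemma pt_near r t0 (e : R) : 0 < e -> exists2 d, 0 < d & forall x t,
  `|x - r| < d -> `|t - t0| < d ->
  `|(pt x t).1 - (pt r t0).1| < e /\ `|(pt x t).2 - (pt r t0).2| < e.
Proof.
move=> e0; have K0 : 0 < 2 + `|r| by rewrite ltr_pwDl.
exists (e / (2 + `|r|)); first by rewrite divr_gt0.
move=> x t; set d := e / _ => hx ht.
have d0 : 0 < d by rewrite divr_gt0.
have hd : d * (2 + `|r|) = e by rewrite divfK// gt_eqF.
have hc (c c0 : R) : `|c| <= 1 -> `|c - c0| <= `|t - t0| -> `|x * c - r * c0| < e.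
  move=> c1 cc; have -> : x * c - r * c0 = (x - r) * c + r * (c - c0) by ring.
  apply: le_lt_trans (ler_normD _ _) _; rewrite !normrM -hd.
  have : `|x - r| * `|c| <= d * 1 by rewrite ler_pM// ltW.
  have : `|r| * `|c - c0| <= `|r| * d by rewrite ler_wpM2l// (le_trans cc)// ltW.
  lra.
have := @pt_arc_le R 1 t t0 ler01; rewrite mul1r => h.
move: h (abs_fst_le (pt 1 t - pt 1 t0)) (abs_snd_le (pt 1 t - pt 1 t0)).
rewrite /pt /= !mul1r => h h1 h2; split; apply: hc.
- by rewrite ler_norml cos_geN1 cos_le1.
- exact: le_trans h1 h.
- by rewrite ler_norml sin_geN1 sin_le1.
- exact: le_trans h2 h.
Qed.

Lemma pt_in_disc r t : `|r| < 1 -> unit_disc (pt r t).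
Proof.
move=> r1; rewrite /unit_disc /pt/= !exprMn -mulrDr cos2Dsin2 mulr1.
by rewrite -real_normK ?num_real// expr_lt1.
Qed.

Lemma circle_uniform_continuous f r (e : R) : (forall p, unit_disc p -> {for p, continuous f}) ->
  `|r| < 1 -> 0 < e -> exists2 d, 0 < d & forall x t, `|x - r| < d -> 0 <= t <= 2 * pi ->
    `|f (pt x t) - f (pt r t)| < e.
Proof.
move=> cf r1 e0; apply: circle_uniform => t0 _.
have e20 : 0 < e / 2 by rewrite divr_gt0.
have [d d0 hd] := continuous2_epsilon (cf _ (pt_in_disc t0 r1)) e20.
have [d' d'0 hd'] := pt_near r t0 d0.
exists d' => // x t hx ht.
have [a1 a2] := hd' x t hx ht.
have [|b1 b2] := hd' r t _ ht; first by rewrite subrr normr0.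
have A := hd _ _ a1 a2; have B := hd _ _ b1 b2.
have -> : f (pt x t) - f (pt r t) = (f (pt x t) - f (pt r t0)) - (f (pt r t) - f (pt r t0)) by ring.
apply: le_lt_trans (ler_normB _ _) _; rewrite [ltRHS](splitr e); exact: ltrD.
Qed.

Lemma continuous_pt f r : (forall p, unit_disc p -> {for p, continuous f}) -> `|r| < 1 ->
  continuous (fun t => f (pt r t)).
Proof.
move=> cf r1 t0; apply/(@cvgrPdist_lt _ R^o) => e e0.
have [d d0 hd] := continuous2_epsilon (cf _ (pt_in_disc t0 r1)) e0.
have [d' d'0 hd'] := pt_near r t0 d0.
suff : nbhs t0 [set t | `|f (pt r t0) - f (pt r t)| < e] by [].
apply/(@nbhs_ballP R R); exists d' => // t; rewrite -ball_normE/= distrC => ht.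
have [|b1 b2] := hd' r t _ ht; first by rewrite subrr normr0.
by rewrite distrC; apply: hd.
Qed.

Lemma is_derive_pt_radial f fx fy r t : has_grad f fx fy -> `|r| < 1 ->
  is_derive r 1 (fun x => f (pt x t)) (cos t * fx (pt r t) + sin t * fy (pt r t)).
Proof.
move=> hf r1; apply: (grad_chain (a := fun x => x * cos t) (b := fun x => x * sin t) hf).
- exact: pt_in_disc.
- by apply: is_derive_eq (dmul (did r) (dcst (cos t) r)) _; rewrite mulr0 addr0 mul1r.
- by apply: is_derive_eq (dmul (did r) (dcst (sin t) r)) _; rewrite mulr0 addr0 mul1r.
Qed.

Lemma is_derive_pt_angular f fx fy r t : has_grad f fx fy -> `|r| < 1 ->
  is_derive t 1 (fun s => f (pt r s))
    ((pt r t).1 * fy (pt r t) - (pt r t).2 * fx (pt r t)).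
Proof.
move=> hf r1.
have := grad_chain (a := fun s => r * cos s) (b := fun s => r * sin s) hf (pt_in_disc t r1)
  (dscale r (is_derive_cos t)) (dscale r (is_derive_sin t)).
move/is_derive_eq; apply.
by rewrite /pt/=; ring.
Qed.

Lemma derive_circle_coeff f fx fy (e : R -> R) r : has_grad f fx fy -> continuous e ->
  (forall t, `|e t| <= 1) -> 0 < r < 1 ->
  is_derive r 1 (fun x => circle_int (fun t => f (pt x t) * e t))
    (circle_int (fun t => ((pt r t).1 * fx (pt r t) + (pt r t).2 * fy (pt r t)) * e t) / r).
Proof.
move=> hf ce e1 /andP[r0 r1].
have nr1 : `|r| < 1 by rewrite gtr0_norm.
have cfx p : unit_disc p -> {for p, continuous fx} by move=> /hf[].
have cfy p : unit_disc p -> {for p, continuous fy} by move=> /hf[].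
have cf p : unit_disc p -> {for p, continuous f} by move=> dp; exact: grad_continuous hf dp.
pose g x t := cos t * fx (pt x t) + sin t * fy (pt x t).
have cg : continuous (fun t => g r t * e t).
  move=> t; apply: cvgM; last exact: ce.
  apply: cvgD; apply: cvgM; try exact: continuous_cos; try exact: continuous_sin.
    exact: (continuous_pt cfx nr1).
  exact: (continuous_pt cfy nr1).
have -> : circle_int (fun t => ((pt r t).1 * fx (pt r t) + (pt r t).2 * fy (pt r t)) * e t) / r =
    circle_int (fun t => g r t * e t).
  rewrite (_ : (fun t => (_ + _) * e t) = (fun t => r * (g r t * e t))); last first.
    by apply/funext => t; rewrite /g /pt/=; ring.
  by rewrite circle_intZ// mulrAC divff ?mul1r// gt_eqF.
apply: derive_under_circle_int => //.
  have : \forall x \near r, `|x| < 1.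
    apply/(@nbhs_ballP R R); exists (1 - r) => /=; first by rewrite subr_gt0.
    move=> x; rewrite -ball_normE/= ltr_norml ltr_norml => /andP[h1 h2]; apply/andP; split; lra.
  apply: filterS => x x1 t; apply: cvgM; last exact: ce.
  exact: (continuous_pt cf x1).
move=> eps eps0; have eps2 : 0 < eps / 2 by rewrite divr_gt0.
have [d1 d10 h1] := circle_uniform_continuous cfx nr1 eps2.
have [d2 d20 h2] := circle_uniform_continuous cfy nr1 eps2.
exists (Num.min (1 - r) (Num.min d1 d2)); first by rewrite !lt_min subr_gt0 r1 d10 d20.
move=> x t; rewrite !lt_min => /and3P[x0 x1 x2] ht.
have -> : f (pt x t) * e t - f (pt r t) * e t - (x - r) * (g r t * e t) =
  (f (pt x t) - f (pt r t) - g r t * (x - r)) * e t by ring.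
rewrite normrM -[leRHS]mulr1 ler_pM//.
apply: (@mvt_increment R (fun z => f (pt z t)) (fun z => g z t)) => z hz.
  apply: is_derive_pt_radial => //.
  have := le_lt_trans hz x0; rewrite !ltr_norml => /andP[? ?]; apply/andP; split; lra.
have -> : g z t - g r t = cos t * (fx (pt z t) - fx (pt r t)) + sin t * (fy (pt z t) - fy (pt r t)).
  by rewrite /g; ring.
apply: le_lt_trans (ler_normD _ _) _; rewrite !normrM [ltRHS](splitr eps).
have hc : `|cos t| <= 1 by rewrite ler_norml cos_geN1 cos_le1.
have hs : `|sin t| <= 1 by rewrite ler_norml sin_geN1 sin_le1.
apply: ltrD.
  by apply: le_lt_trans (h1 _ _ (le_lt_trans hz x1) ht); rewrite ler_piMl.
by apply: le_lt_trans (h2 _ _ (le_lt_trans hz x2) ht); rewrite ler_piMl.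
Qed.

Variables (u ux uy uxx uxy uyx uyy : R * R -> R) (mu : R).
Hypotheses (gu : has_grad u ux uy) (gux : has_grad ux uxx uxy) (guy : has_grad uy uyx uyy).
Hypothesis lapu : forall p, unit_disc p -> - (uxx p + uyy p) = mu ^+ 2 * u p.

Variables (k : R) (e de : R -> R).
Hypotheses (he : forall x : R, is_derive x 1 e (de x))
  (hde : forall x : R, is_derive x 1 de (- k ^+ 2 * e x))
  (e0 : e 0 = e (2 * pi)) (de0 : de 0 = de (2 * pi)) (e1 : forall t, `|e t| <= 1).

(** [v] is r u_r, so that [E] is r C' and the pair (C, E) satisfies a first order system. *)
Let v p := p.1 * ux p + p.2 * uy p.
Let C r := circle_int (fun t => u (pt r t) * e t).
Let E r := circle_int (fun t => v (pt r t) * e t).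

Let ce : continuous e.
Proof. by move=> t; exact: is_derive_continuous (he t). Qed.

Let cu p : unit_disc p -> {for p, continuous u}.
Proof. by move=> dp; exact: grad_continuous gu dp. Qed.

Let gv := grad_coord_comb gux guy.

Lemma circle_coeff_ode1 r : 0 < r < 1 -> is_derive r 1 C (E r / r).
Proof. by move=> hr; exact: derive_circle_coeff gu ce e1 hr. Qed.

(* (r d/dr)^2 + (d/dt)^2 = r^2 Laplacian. *)
Lemma circle_coeff_ode2 r : 0 < r < 1 -> is_derive r 1 E ((k ^+ 2 - mu ^+ 2 * r ^+ 2) / r * C r).
Proof.
move=> hr; have /andP[r0 r1] := hr; have nr1 : `|r| < 1 by rewrite gtr0_norm.
apply: is_derive_eq (derive_circle_coeff gv ce e1 hr) _.
rewrite mulrAC; congr (_ / r).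
have gw := grad_coord_comb guy (grad_opp gux).
pose g t := u (pt r t).
pose dg t := (pt r t).1 * uy (pt r t) + (pt r t).2 * - ux (pt r t).
pose ddg t := (pt r t).1 * ((pt r t).1 * uyy (pt r t) + (- ux (pt r t) + (pt r t).2 * - uxy (pt r t)))
  - (pt r t).2 * (uy (pt r t) + (pt r t).1 * uyx (pt r t) + (pt r t).2 * - uxx (pt r t)).
have hg t : is_derive t 1 g (dg t).
  by apply: is_derive_eq (is_derive_pt_angular t gu nr1) _; rewrite /dg mulrN.
have hdg t : is_derive t 1 dg (ddg t) by exact: is_derive_pt_angular t gw nr1.
have pt2pi : pt r 0 = pt r (2 * pi).
  by rewrite /pt cos0 sin0 [2 * pi]mulr_natl cos2pi sin2pi.
have g02 : g 0 = g (2 * pi) by rewrite /g pt2pi.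
have dg02 : dg 0 = dg (2 * pi) by rewrite /dg pt2pi.
have [G hG GE] := circle_int_parts hg hdg g02 dg02 he hde e0 de0.
have [|H hH HE] := @circle_intP R (fun t => g t * e t).
  move=> t; apply: cvgM; last exact: ce.
  exact: is_derive_continuous (hg t).
apply: circle_intE; exists (fun t => (k ^+ 2 - mu ^+ 2 * r ^+ 2) * H t - G t).
  move=> t ht; apply: is_derive_eq (dsub (dscale _ (hH t ht)) (hG t ht)) _.
  have := lapu (pt_in_disc t nr1).
  have : r ^+ 2 = (pt r t).1 ^+ 2 + (pt r t).2 ^+ 2.
    by rewrite /pt/= !exprMn -mulrDr cos2Dsin2 mulr1.
  rewrite /ddg /g; move: (pt r t) => p -> hl.
  have -> : (k ^+ 2 - mu ^+ 2 * (p.1 ^+ 2 + p.2 ^+ 2)) * (u p * e t) =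
    k ^+ 2 * (u p * e t) - (p.1 ^+ 2 + p.2 ^+ 2) * (mu ^+ 2 * u p) * e t by ring.
  by rewrite -hl; ring.
by rewrite /C HE -/g; lra.
Qed.

(** This is what excludes the singular solutions of Bessel's equation; the factor r in the bound of
    [E] comes from [v]. *)
Lemma circle_coeff_bounds : exists rho B, 0 < rho /\
  forall r, 0 < r < rho -> `|C r| <= B /\ `|E r| <= B * r.
Proof.
have z1 : `|0 : R| < 1 by rewrite normr0.
have bnd f : (forall p, unit_disc p -> {for p, continuous f}) ->
    exists rho B, [/\ 0 < rho, 0 <= B & forall r t, 0 < r < rho -> 0 <= t <= 2 * pi -> `|f (pt r t)| <= B].
  move=> cf; have [d d0 hd] := circle_uniform_continuous cf z1 ltr01.
  exists d, (`|f (0, 0)| + 1); split; [by []|by apply: addr_ge0|].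
  move=> r t /andP[r0 rd] ht; have := hd r t; rewrite subr0 gtr0_norm// => /(_ rd ht).
  rewrite {2}/pt !mul0r => h.
  rewrite -[f (pt r t)](subrK (f (0, 0))); apply: le_trans (ler_normD _ _) _.
  by rewrite addrC lerD2l ltW.
have [d1 [B1 [d10 B10 h1]]] := bnd u cu.
have [|d2 [B2 [d20 B20 h2]]] := bnd ux; first by move=> p /gu[].
have [|d3 [B3 [d30 B30 h3]]] := bnd uy; first by move=> p /gu[].
have cv p : unit_disc p -> {for p, continuous v} by move=> dp; exact: grad_continuous gv dp.
have p0 := pi_gt0 R.
exists (Num.min 1 (Num.min d1 (Num.min d2 d3))), (2 * pi * (B1 + B2 + B3)).
split=> [|r]; first by rewrite !lt_min ltr01 d10 d20.
rewrite !lt_min => /andP[r0 /and4P[r1 rd1 rd2 rd3]].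
have nr1 : `|r| < 1 by rewrite gtr0_norm.
split.
  apply: circle_int_abs; first by move=> t; apply: cvgM; [exact: (continuous_pt cu nr1)|exact: ce].
  move=> t ht; rewrite normrM -[leRHS]mulr1 ler_pM//.
  by apply: le_trans (h1 r t _ ht) _; [rewrite r0|lra].
have -> : 2 * pi * (B1 + B2 + B3) * r = 2 * pi * ((B1 + B2 + B3) * r) by rewrite mulrA.
apply: circle_int_abs; first by move=> t; apply: cvgM; [exact: (continuous_pt cv nr1)|exact: ce].
move=> t ht; rewrite normrM -[leRHS]mulr1 ler_pM//.
have -> : v (pt r t) = r * (cos t * ux (pt r t) + sin t * uy (pt r t)) by rewrite /v /pt/=; ring.
rewrite normrM (gtr0_norm r0) mulrC ler_wpM2r ?(ltW r0)//.
have hc : `|cos t| <= 1 by rewrite ler_norml cos_geN1 cos_le1.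
have hs : `|sin t| <= 1 by rewrite ler_norml sin_geN1 sin_le1.
apply: le_trans (ler_normD _ _) _; rewrite !normrM.
have hr2 : `|ux (pt r t)| <= B2 by apply: h2 => //; rewrite r0.
have hr3 : `|uy (pt r t)| <= B3 by apply: h3 => //; rewrite r0.
have : `|cos t| * `|ux (pt r t)| <= 1 * B2 by rewrite ler_pM.
have : `|sin t| * `|uy (pt r t)| <= 1 * B3 by rewrite ler_pM.
lra.
Qed.

Hypothesis bu : {within closed_unit_disc, continuous u}.
Hypothesis u0 : forall p, unit_circle p -> u p = 0.

(** [u] is only continuous up to the boundary, so the Dirichlet condition reaches the coefficient as
    a limit for r tending to 1, uniformly in the angle by compactness. *)
Lemma circle_coeff_boundary eps : 0 < eps -> exists2 d, 0 < d &
  forall r, 0 < r < 1 -> 1 - d < r -> `|C r| <= eps.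
Proof.
move=> eps0; have p0 := pi_gt0 R.
have e'0 : 0 < eps / (2 * pi) by rewrite divr_gt0// mulr_gt0.
have [|d d0 hd] := @circle_uniform (fun x t => `|x| <= 1 -> `|u (pt x t)| < eps / (2 * pi)) 1.
  move=> t0 _.
  have hc : unit_circle (pt 1 t0) by rewrite /unit_circle/= !mul1r cos2Dsin2.
  have hcc : closed_unit_disc (pt 1 t0) by rewrite /closed_unit_disc/= hc.
  have hw : within closed_unit_disc (nbhs (pt 1 t0)) [set q | `|u q| < eps / (2 * pi)].
    rewrite nbhs_subspace_in//.
    have /(@cvgrPdist_lt _ R^o) /(_ _ e'0) := bu (x := pt 1 t0).
    by apply: filterS => q; rewrite /= /from_subspace (u0 hc) sub0r normrN.
  move: hw => /(@nbhs_ballP R (R * R)%type)[d /= d0 hd].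
  have [d' d'0 hd'] := pt_near 1 t0 d0.
  exists d' => // x t hx ht x1; have [a1 a2] := hd' x t hx ht.
  apply: (hd (pt x t)).
    by split; rewrite -ball_normE/= distrC.
  rewrite /closed_unit_disc/= !exprMn -mulrDr cos2Dsin2 mulr1.
  by rewrite -real_normK ?num_real// expr_le1.
exists d => // r /andP[r0 r1] rd.
have nr1 : `|r| < 1 by rewrite gtr0_norm.
have -> : eps = 2 * pi * (eps / (2 * pi)) by rewrite mulrC divfK// gt_eqF// mulr_gt0.
apply: circle_int_abs; first by move=> t; apply: cvgM; [exact: (continuous_pt cu nr1)|exact: ce].
move=> t ht; rewrite normrM -[leRHS]mulr1 ler_pM// ltW//; apply: hd => //; last exact: ltW.
by rewrite ltr_norml; apply/andP; split; lra.
Qed.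

End polar_calculus.

(** * Bounded solutions of Bessel's equation *)

Section bessel_ode.
Context {R : realType}.

Lemma continuous_bj_everywhere k (x : R) : {for x, continuous (bj k)}.
Proof.
have h2 := dmul (did x) (dcst 2^-1 x).
have [l hl] : exists l, is_derive (x / 2) 1 (jz k) l.
  by case: k => [|k]; eexists; [exact: is_derive_jz0|exact: is_derive_jzS].
have h : is_derive x 1 (bj k) _ := dcomp (g := fun y => y / 2) hl h2.
exact: is_derive_continuous h.
Qed.

Lemma bj_at0 k : bj k.+1 (0 : R) = 0.
Proof. by rewrite /bj /jz mul0r expr0n/= mul0r. Qed.

Lemma bj0_at0 : bj 0 (0 : R) = 1.
Proof. by rewrite /bj /jz mul0r !expr0n/= mul1r bh0 fact0 invr1. Qed.

Lemma continuous_ebj_everywhere k (x : R) : {for x, continuous (ebj k)}.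
Proof.
apply: cvgB; apply: cvgM; try exact: continuous_bj_everywhere; try exact: cvg_cst.
exact: cvg_id.
Qed.

Lemma ebj_at0 k : ebj k (0 : R) = 0.
Proof. by rewrite /ebj mul0r subr0; case: k => [|k]; rewrite ?mul0r// bj_at0 mulr0. Qed.

Variables (k : nat) (mu : R) (C E : R -> R).
Hypothesis mu0 : 0 < mu.
Hypothesis hC : forall r : R, 0 < r < 1 -> is_derive r 1 C (E r / r).
Hypothesis hE : forall r : R, 0 < r < 1 ->
  is_derive r 1 E ((k%:R ^+ 2 - mu ^+ 2 * r ^+ 2) / r * C r).
Hypothesis hbound : exists rho B, 0 < rho /\
  forall r : R, 0 < r < rho -> `|C r| <= B /\ `|E r| <= B * r.

Let y r := bj k (mu * r).
Let e r := ebj k (mu * r).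

Let hy (r : R) : 0 < r -> is_derive r 1 y (e r / r).
Proof.
move=> r0; have mr : mu * r != 0 by rewrite gt_eqF// mulr_gt0.
have h : is_derive r 1 y _ := dcomp (g := fun x => mu * x) (is_derive_bj k mr) (dscale mu (did r)).
apply: (is_derive_eq h).
by rewrite /e mulr1; move: (ebj _ _) => z; field; rewrite !gt_eqF.
Qed.

Let he (r : R) : 0 < r -> is_derive r 1 e ((k%:R ^+ 2 - mu ^+ 2 * r ^+ 2) / r * y r).
Proof.
move=> r0; have mr : mu * r != 0 by rewrite gt_eqF// mulr_gt0.
have h : is_derive r 1 e _ := dcomp (g := fun x => mu * x) (is_derive_ebj k mr) (dscale mu (did r)).
apply: (is_derive_eq h).
by rewrite /y mulr1; move: (bj _ _) => z; field; rewrite !gt_eqF.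
Qed.

Let constant_on01 (f : R -> R) : (forall r : R, 0 < r < 1 -> is_derive r 1 f 0) ->
  forall a b : R, 0 < a < 1 -> 0 < b < 1 -> f a = f b.
Proof.
move=> hf; have key (a b : R) : 0 < a < 1 -> 0 < b < 1 -> a <= b -> f a = f b.
  move=> /andP[a0 a1] /andP[b0 b1] ab; apply: derive_eq0_eq => // x /andP[ax xb].
  by apply: hf; rewrite (lt_le_trans a0 ax) (le_lt_trans xb b1).
move=> a b ha hb; have [ab|/ltW ba] := leP a b; first exact: key.
by rewrite (key b a).
Qed.

(* The Wronskian r (C' y - C y') is constant, and it tends to 0 at the origin. *)
Lemma wronskian_eq0 r : 0 < r < 1 -> E r * y r = C r * e r.
Proof.
move=> hr; pose W x := E x * y x - C x * e x.
have dW (x : R) : 0 < x < 1 -> is_derive x 1 W 0.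
  move=> hx; have /andP[x0 x1] := hx.
  apply: is_derive_eq (dsub (dmul (hE hx) (hy x0)) (dmul (hC hx) (he x0))) _.
  by move: (y x) (e x) (C x) (E x) => *; field; rewrite gt_eqF.
suff : W r = 0 by move/eqP; rewrite subr_eq0 => /eqP.
apply/eqP/negPn/negP => w0.
have aw0 : 0 < `|W r| by rewrite normr_gt0.
have [rho [B [rho0 hB]]] := hbound.
have B0 : 0 <= B.
  have hr2 : 0 < rho / 2 < rho by apply/andP; split; lra.
  by have [h _] := hB _ hr2; exact: le_trans h.
have cy : {for (0 : R), continuous y}.
  by apply: continuous_comp; [exact: is_derive_continuous (dscale mu (did 0))|exact: continuous_bj_everywhere].
have ce : {for (0 : R), continuous e}.
  by apply: continuous_comp; [exact: is_derive_continuous (dscale mu (did 0))|exact: continuous_ebj_everywhere].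
have [d1 d10 h1] := continuous_epsilon cy ltr01.
have ee : 0 < `|W r| / (2 * (B + 1)) by rewrite divr_gt0// mulr_gt0//; lra.
have [d2 d20 h2] := continuous_epsilon ce ee.
pose K := B * (`|y 0| + 1) + 1.
have K0 : 0 < K by rewrite /K ltr_wpDl// mulr_ge0// addr_ge0.
pose q := Num.min (Num.min 1 rho) (Num.min (Num.min d1 d2) (`|W r| / (2 * K))).
have q0 : 0 < q by rewrite /q !lt_min ltr01 rho0 d10 d20 divr_gt0// mulr_gt0.
pose x := q / 2.
have x0 : 0 < x by rewrite divr_gt0.
have xq : x < q by rewrite /x; lra.
have : x < q by []; rewrite {1}/q !lt_min => /andP[/andP[x1 xrho] /andP[/andP[xd1 xd2] xK]].
have [|hCx hEx] := hB x; first by rewrite x0.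
have WE : W r = W x by apply: constant_on01 => //; rewrite x0.
have ax : `|x - 0| = x by rewrite subr0 gtr0_norm.
have := h1 x; rewrite ax => /(_ xd1) y1; have := h2 x; rewrite ax => /(_ xd2).
rewrite {2}/e mulr0 ebj_at0 subr0 => e1.
have yb : `|y x| <= `|y 0| + 1.
  by rewrite -[y x](subrK (y 0)) (le_trans (ler_normD _ _))// addrC lerD2l ltW.
have t1 : `|E x * y x| <= x * K.
  rewrite normrM; apply: (@le_trans _ _ (B * x * (`|y 0| + 1))); first by rewrite ler_pM.
  by rewrite mulrAC mulrC ler_wpM2l ?(ltW x0)// /K lerDl.
have t2 : `|C x * e x| <= B * (`|W r| / (2 * (B + 1))) by rewrite normrM ler_pM// ltW.
have t3 : x * K < `|W r| / 2.
  have -> : `|W r| / 2 = `|W r| / (2 * K) * K by field; rewrite gt_eqF.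
  by rewrite ltr_pM2r.
have t4 : B * (`|W r| / (2 * (B + 1))) <= `|W r| / 2.
  have B1 : B + 1 != 0 by rewrite gt_eqF//; lra.
  have -> : `|W r| / 2 = (B + 1) * (`|W r| / (2 * (B + 1))) by field.
  by rewrite ler_wpM2r ?(ltW ee)//; lra.
have : `|W r| <= `|E x * y x| + `|C x * e x| by rewrite {1}WE ler_normB.
lra.
Qed.

(* [(C, E)] is parallel to [(y, e)], and the ratio has zero derivative. *)
Lemma bessel_ode_bounded_solution :
  exists kap, forall r, 0 < r < 1 -> C r = kap * bj k (mu * r).
Proof.
(* It has no positive zero, since the zeros of J_k are simple; dividing by it defines the ratio
   [kap] also at the zeros of [y]. *)
pose Q x := y x ^+ 2 + e x ^+ 2.
have Q0 (x : R) : 0 < x -> Q x != 0.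
  move=> x0; rewrite /Q paddr_eq0 ?sqr_ge0// !sqrf_eq0; apply/negP => /andP[/eqP y0 /eqP e0].
  have mx : 0 < mu * x by rewrite mulr_gt0.
  by have := bj_simple_root mx y0; rewrite -/(e x) e0 eqxx.
pose kap x := (C x * y x + E x * e x) / Q x.
have rep (x : R) : 0 < x < 1 -> C x = kap x * y x /\ E x = kap x * e x.
  move=> hx; have /andP[x0 _] := hx; have w := wronskian_eq0 hx; have q := Q0 _ x0.
  rewrite /kap; split; apply: (mulIf q); rewrite mulrAC divfK// /Q.
    have -> : (C x * y x + E x * e x) * y x = C x * y x ^+ 2 + (E x * y x) * e x by ring.
    by rewrite w; ring.
  have -> : (C x * y x + E x * e x) * e x = (C x * e x) * y x + E x * e x ^+ 2 by ring.
  by rewrite -w; ring.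
have dk (x : R) : 0 < x < 1 -> is_derive x 1 kap 0.
  move=> hx; have /andP[x0 _] := hx; have q := Q0 _ x0; have [rC rE] := rep x hx.
  have dQ := dadd (dpow 2 (hy x0)) (dpow 2 (he x0)).
  have dN := dadd (dmul (hC hx) (hy x0)) (dmul (hE hx) (he x0)).
  apply: is_derive_eq (dmul dN (dinv q dQ)) _.
  rewrite rC rE -/(Q x) /=; move: q; rewrite /Q; move: (kap x) (y x) (e x) => a b c q.
  by field; rewrite q gt_eqF.
exists (kap (1 / 2)) => r hr; have [-> _] := rep r hr; congr (_ * _).
by apply: constant_on01 => //; apply/andP; split; lra.
Qed.

End bessel_ode.

(** * Uniqueness of Fourier coefficients *)

Section fourier_uniqueness.
Context {R : realType}.
Implicit Types f g : R -> R.

Definition fourier_null g := forall k : nat,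
  circle_int (fun t => g t * cos (k%:R * t)) = 0 /\ circle_int (fun t => g t * sin (k%:R * t)) = 0.

Lemma continuous_cosM (k : R) : continuous (fun t => cos (k * t)).
Proof. by move=> t; exact: is_derive_continuous (dcomp (is_derive_cos (k * t)) (dscale k (did t))). Qed.

Lemma continuous_sinM (k : R) : continuous (fun t => sin (k * t)).
Proof. by move=> t; exact: is_derive_continuous (dcomp (is_derive_sin (k * t)) (dscale k (did t))). Qed.

Lemma continuous_mulM (f g : R -> R) : continuous f -> continuous g -> continuous (fun t => f t * g t).
Proof. by move=> cf cg t; apply: cvgM; [exact: cf|exact: cg]. Qed.

Lemma continuous_scale (a : R) (f : R -> R) : continuous f -> continuous (fun t => a * f t).
Proof. by move=> cf t; apply: cvgM; [exact: cvg_cst|exact: cf]. Qed.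

Lemma fourier_null_lin (a b : R) f g : continuous f -> continuous g ->
  fourier_null f -> fourier_null g -> fourier_null (fun t => a * f t + b * g t).
Proof.
move=> cf cg hf hg k; split.
  have cfc := continuous_mulM cf (@continuous_cosM k%:R).
  have cgc := continuous_mulM cg (@continuous_cosM k%:R).
  have -> : circle_int (fun t => (a * f t + b * g t) * cos (k%:R * t)) =
      circle_int (fun t => a * (f t * cos (k%:R * t)) + b * (g t * cos (k%:R * t))).
    by apply: eq_circle_int => t; ring.
  rewrite circle_intD; [|exact: continuous_scale..].
  by rewrite !circle_intZ// (hf k).1 (hg k).1 !mulr0 addr0.
have cfc := continuous_mulM cf (@continuous_sinM k%:R).
have cgc := continuous_mulM cg (@continuous_sinM k%:R).
have -> : circle_int (fun t => (a * f t + b * g t) * sin (k%:R * t)) =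
    circle_int (fun t => a * (f t * sin (k%:R * t)) + b * (g t * sin (k%:R * t))).
  by apply: eq_circle_int => t; ring.
rewrite circle_intD; [|exact: continuous_scale..].
by rewrite !circle_intZ// (hf k).2 (hg k).2 !mulr0 addr0.
Qed.

(** Product formulas lead back to the orders k - 1 and k + 1. By iteration, g may be multiplied by
    powers of a + cos (t - t0). *)
Lemma fourier_null_shift g : continuous g -> fourier_null g ->
  fourier_null (fun t => g t * cos t) /\ fourier_null (fun t => g t * sin t).
Proof.
move=> cg hg.
have gc (j : nat) := continuous_mulM cg (@continuous_cosM j%:R).
have gs (j : nat) := continuous_mulM cg (@continuous_sinM j%:R).
have comb (f1 f2 : R -> R) (a : R) (h : R -> R) : continuous f1 -> continuous f2 ->
    circle_int f1 = 0 -> circle_int f2 = 0 -> (forall t, h t = 1 / 2 * f1 t + a * f2 t) ->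
    circle_int h = 0.
  move=> c1 c2 z1 z2 hE; rewrite (eq_circle_int hE) circle_intD; [|exact: continuous_scale..].
  by rewrite !circle_intZ// z1 z2 !mulr0 addr0.
have lo (t : R) (j : nat) : j%:R * t = j.+1%:R * t - t by rewrite -natr1 mulrDl mul1r addrK.
have hi (t : R) (j : nat) : j.+2%:R * t = j.+1%:R * t + t by rewrite -[j.+2%:R]natr1 mulrDl mul1r.
have E1 (t : R) : 1%:R * t = t by rewrite mul1r.
split=> -[|k]; split.
- apply: (comb _ _ (1 / 2) _ (gc 1%N) (gc 1%N) (hg 1%N).1 (hg 1%N).1) => t.
  by rewrite mul0r cos0 E1; field.
- apply: (comb _ _ 0 _ (gs 0%N) (gs 0%N) (hg 0%N).2 (hg 0%N).2) => t.
  by rewrite mul0r sin0 !mulr0 addr0.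
- apply: (comb _ _ (1 / 2) _ (gc k) (gc k.+2) (hg k).1 (hg k.+2).1) => t.
  by rewrite (lo _ k) hi cosB cosD; field.
- apply: (comb _ _ (1 / 2) _ (gs k) (gs k.+2) (hg k).2 (hg k.+2).2) => t.
  by rewrite (lo _ k) hi sinB sinD; field.
- apply: (comb _ _ (1 / 2) _ (gs 1%N) (gs 1%N) (hg 1%N).2 (hg 1%N).2) => t.
  by rewrite mul0r cos0 E1; field.
- apply: (comb _ _ 0 _ (gs 0%N) (gs 0%N) (hg 0%N).2 (hg 0%N).2) => t.
  by rewrite mul0r sin0 !mulr0 addr0.
- apply: (comb _ _ (- (1 / 2)) _ (gs k.+2) (gs k) (hg k.+2).2 (hg k).2) => t.
  by rewrite (lo _ k) hi sinB sinD; field.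
- apply: (comb _ _ (- (1 / 2)) _ (gc k) (gc k.+2) (hg k).1 (hg k.+2).1) => t.
  by rewrite (lo _ k) hi cosB cosD; field.
Qed.

Lemma fourier_null_kernel g (a t0 : R) n : continuous g -> fourier_null g ->
  fourier_null (fun t => g t * (a + cos (t - t0)) ^+ n) /\
  continuous (fun t => g t * (a + cos (t - t0)) ^+ n).
Proof.
move=> cg hg; elim: n => [|n [hn cn]].
  have -> : (fun t => g t * (a + cos (t - t0)) ^+ 0) = g by apply/funext => t; rewrite expr0 mulr1.
  by split.
set gn := (fun t => _) in hn cn.
have -> : (fun t => g t * (a + cos (t - t0)) ^+ n.+1) =
    (fun t => 1 * (a * gn t + cos t0 * (gn t * cos t)) + sin t0 * (gn t * sin t)).
  by apply/funext => t; rewrite /gn exprS cosB; ring.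
have cc : continuous (fun t => gn t * cos t) by apply: continuous_mulM => // ?; exact: continuous_cos.
have cs : continuous (fun t => gn t * sin t) by apply: continuous_mulM => // ?; exact: continuous_sin.
have c1 : continuous (fun t => a * gn t + cos t0 * (gn t * cos t)).
  by move=> t; apply: cvgD; [exact: (continuous_scale cn)|exact: (continuous_scale cc)].
have [h1 h2] := fourier_null_shift cn hn.
split; last by move=> t; apply: cvgD; [exact: (continuous_scale c1)|exact: (continuous_scale cs)].
by apply: fourier_null_lin => //; exact: fourier_null_lin.
Qed.

(* The kernel [(1 - cos eta + cos (t - t0))^n] is at most 1 in absolute value away
   from [t0] and grows exponentially near [t0]. *)
Lemma fourier_null_le0 g (t0 : R) : continuous g -> fourier_null g -> 0 < t0 < 2 * pi -> g t0 <= 0.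
Proof.
move=> cg hg /andP[t00 t01]; rewrite leNgt; apply/negP => gt0.
have p0 := pi_gt0 R.
have [B hB] : exists B : R, forall t, 0 <= t <= 2 * pi -> `|g t| <= B.
  have [||c _ hc] := @EVT_max R (fun t => `|g t|) 0 (2 * pi); first lra.
    apply: continuous_subspaceT => t; apply: (@cvg_norm _ R^o); exact: cg.
  by exists `|g c| => t ht; apply: hc; rewrite in_itv.
have g20 : 0 < g t0 / 2 by rewrite divr_gt0.
have [d d0 hd] := continuous_epsilon (cg t0) g20.
pose eta := Num.min d (Num.min t0 (2 * pi - t0)).
have eta0 : 0 < eta by rewrite !lt_min d0 t00 subr_gt0.
have eta1 : eta <= d by rewrite !ge_min lexx.
have eta2 : eta <= t0 by rewrite !ge_min lexx !orbT.
have eta3 : eta <= 2 * pi - t0 by rewrite !ge_min lexx !orbT.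
clearbody eta.
pose q t := 1 - cos eta + cos (t - t0).
pose del := cos (eta / 2) - cos eta.
have del0 : 0 < del.
  rewrite /del subr_gt0 ltr_cos ?in_itv/=; [lra| |]; apply/andP; split; lra.
have q_far t : 0 <= t <= 2 * pi -> eta <= `|t - t0| -> `|q t| <= 1.
  move=> /andP[ta tb] h; have := cos_geN1 (t - t0); have := cos_geN1 eta; have := cos_le1 eta.
  have : cos (t - t0) <= cos eta.
    by apply: cos_le_away => //; [exact: ltW|rewrite ler_norml; apply/andP; split; lra].
  by rewrite /q ler_norml => *; apply/andP; split; lra.
have cos_near (x c : R) : 0 <= c -> c <= pi -> `|x| <= c -> cos c <= cos x.
  move=> c0 cp xc; rewrite -(cos_norm x); apply: cos_le_away => //; rewrite (ger0_norm c0)//; lra.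
have q_mid t : `|t - t0| <= eta -> 1 <= q t.
  by move=> h; have := cos_near (t - t0) eta; rewrite /q => /(_ (ltW eta0) _ h); lra.
have q_near t : `|t - t0| <= eta / 2 -> 1 + del <= q t.
  by move=> h; have := cos_near (t - t0) (eta / 2); rewrite /q /del => /(_ _ _ h); lra.
have g_near t : `|t - t0| < eta -> g t0 / 2 <= g t.
  by move=> h; have := hd t (lt_le_trans h eta1); rewrite ltr_norml => /andP[]; lra.
have B0 : 0 <= B by apply: le_trans (hB t0 _); rewrite ?normr_ge0// (ltW t00) ltW.
pose a := t0 - eta / 2; pose b := t0 + eta / 2.
(* By Bernoulli's inequality the power n.+1 makes the contribution of |t - t0| <= eta / 2 exceed 2
   pi B, the most that the rest can take away. *)
pose n := Num.trunc (2 * pi * B / (g t0 / 2 * eta * del)).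
have big : 2 * pi * B < g t0 / 2 * eta * (1 + del) ^+ n.+1.
  have bern m : 1 + m%:R * del <= (1 + del) ^+ m.
    elim: m => [|m IH]; first by rewrite mul0r addr0 expr0.
    rewrite exprS -natr1; apply: (@le_trans _ _ ((1 + del) * (1 + m%:R * del))).
      have : 0 <= m%:R * (del * del) by rewrite !mulr_ge0// ltW.
      have -> : (1 + del) * (1 + m%:R * del) = 1 + (m%:R + 1) * del + m%:R * (del * del) by ring.
      lra.
    by rewrite ler_wpM2l//; lra.
  have K0 : 0 < g t0 / 2 * eta by rewrite mulr_gt0.
  apply: lt_le_trans (_ : g t0 / 2 * eta * (n.+1%:R * del) <= _).
    rewrite [n.+1%:R * _]mulrC mulrA [ltRHS]mulrC -ltr_pdivrMr ?mulr_gt0//.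
    exact: truncnS_gt.
  by rewrite ler_pM2l//; apply: le_trans (bern _); lra.
have [hn cn] := fourier_null_kernel (1 - cos eta) t0 n.+1 cg hg.
have [F hF FE] := circle_intP cn.
have z : F (2 * pi) - F 0 = 0.
  have := (hn 0%N).1; rewrite -FE => <-; apply: eq_circle_int => t.
  by rewrite mul0r cos0 mulr1.
have low (x y c : R) : 0 <= x -> x <= y -> y <= 2 * pi ->
    (forall t, x < t < y -> c <= g t * q t ^+ n.+1) -> F x + c * (y - x) <= F y.
  move=> x0 xy y1 hc.
  have := @derive_ge0_le R (fun t => F t - c * t) (fun t => g t * q t ^+ n.+1 - c) x y xy.
  suff h : forall t : R, x <= t <= y -> is_derive t 1 (fun t => F t - c * t) (g t * q t ^+ n.+1 - c).
    have h0 t : x < t < y -> 0 <= g t * q t ^+ n.+1 - c by move=> /hc; rewrite subr_ge0.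
    by move=> /(_ h h0); lra.
  move=> t /andP[t1 t2]; apply: is_derive_eq (dsub (hF t _) (dscale c (did t))) _.
    by apply/andP; split; lra.
  by rewrite mulr1.
have outer t : 0 <= t <= 2 * pi -> - B <= g t * q t ^+ n.+1.
  move=> ht; have [h|h] := leP eta `|t - t0|.
    have : `|g t * q t ^+ n.+1| <= B.
      rewrite normrM normrX -[leRHS]mulr1 ler_pM ?hB ?exprn_ge0//.
      by apply: exprn_ile1 => //; exact: q_far.
    by rewrite ler_norml => /andP[].
  apply: (@le_trans _ _ 0); first by rewrite oppr_le0.
  rewrite mulr_ge0//; first exact: le_trans (ltW g20) (g_near _ h).
  by rewrite exprn_ge0// (le_trans ler01)// q_mid// ltW.
have h1 : F 0 + - B * (a - 0) <= F a.
  by apply: low; rewrite /a; [lra..|move=> t /andP[? ?]; apply: outer; apply/andP; split; lra].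
have h2 : F b + - B * (2 * pi - b) <= F (2 * pi).
  by apply: low; rewrite /b; [lra..|move=> t /andP[? ?]; apply: outer; apply/andP; split; lra].
have h3 : F a + g t0 / 2 * (1 + del) ^+ n.+1 * (b - a) <= F b.
  apply: low; rewrite /a /b; [lra..|move=> t /andP[t1 t2]].
  have ht : `|t - t0| <= eta / 2 by rewrite ler_norml; apply/andP; split; lra.
  have d10 : 0 <= 1 + del by lra.
  rewrite ler_pM//; [exact: ltW|exact: exprn_ge0| |].
    by apply: g_near; apply: le_lt_trans ht _; lra.
  by rewrite lerXn2r ?nnegrE//; [apply: le_trans (q_near _ ht)|exact: q_near].
have : B * (a + (2 * pi - b)) <= B * (2 * pi) by rewrite ler_wpM2l// /a /b; lra.
have e1 : g t0 / 2 * (1 + del) ^+ n.+1 * (b - a) = g t0 / 2 * eta * (1 + del) ^+ n.+1.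
  have -> : b - a = eta by rewrite /a /b; lra.
  by rewrite mulrAC.
rewrite e1 in h3; lra.
Qed.

(** The one-sided bound is applied to g and to - g; the end point 0, which it leaves out, follows by
    continuity. *)
Lemma fourier_uniqueness g (t : R) : continuous g -> fourier_null g -> 0 <= t < 2 * pi -> g t = 0.
Proof.
move=> cg hg /andP[t0 t1].
have z (s : R) : 0 < s < 2 * pi -> g s = 0.
  move=> hs; apply/eqP; rewrite eq_le fourier_null_le0//=.
  have cN : continuous (fun t => -1 * g t + 0 * g t).
    by move=> x; apply: cvgD; apply: cvgM; try exact: cvg_cst; exact: cg.
  have := fourier_null_le0 cN (fourier_null_lin (-1) 0 cg cg hg hg) hs; lra.
move: t0; rewrite le_eqVlt => /predU1P[<-|t0]; last by apply: z; rewrite t0.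
apply/eqP/negPn/negP => g0.
have [|d d0 hd] := continuous_epsilon (cg 0) (e := `|g 0|); first by rewrite normr_gt0.
have p2 := pi_ge2 R.
have m0 : 0 < Num.min d 1 by rewrite lt_min d0 ltr01.
have m1 : Num.min d 1 <= d by rewrite ge_min lexx.
have m2 : Num.min d 1 <= 1 by rewrite ge_min lexx orbT.
have := hd (Num.min d 1 / 2); rewrite subr0 gtr0_norm ?divr_gt0// z; last by apply/andP; split; lra.
by rewrite sub0r normrN ltxx => h; suff : false by []; apply: h; lra.
Qed.

End fourier_uniqueness.

(** * Eigenfunctions are products in polar coordinates *)

Section classification.
Context {R : realType}.

Lemma continuous_zero_right (f : R -> R) : {for (0 : R), continuous f} ->
  (forall x, 0 < x < 1 -> f x = 0) -> f 0 = 0.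
Proof.
move=> cf z; apply/eqP/negPn/negP => f0.
have f0' : 0 < `|f 0| by rewrite normr_gt0.
have [d d0 hd] := continuous_epsilon cf f0'.
have m0 : 0 < Num.min d 1 by rewrite lt_min d0 ltr01.
have m1 : Num.min d 1 <= d by rewrite ge_min lexx.
have m2 : Num.min d 1 <= 1 by rewrite ge_min lexx orbT.
have := hd (Num.min d 1 / 2); rewrite subr0 gtr0_norm ?divr_gt0// z; last by apply/andP; split; lra.
by rewrite sub0r normrN ltxx => h; suff : false by []; apply: h; lra.
Qed.

Lemma periodic_eq (t : R) : exists2 s, 0 <= s < 2 * pi & forall h : R -> R,
    (forall t, h (t + 2 * pi) = h t) -> h t = h s.
Proof.
have p0 : 0 < 2 * pi :> R by rewrite mulr_gt0 ?pi_gt0.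
pose z := Num.floor (t / (2 * pi)).
have h1 : z%:~R * (2 * pi) <= t by rewrite -ler_pdivlMr// floor_le.
have h2 : t < (z%:~R + 1) * (2 * pi).
  by rewrite -ltr_pdivrMr// -[1]/(1%:~R) -rmorphD/= floorD1_gt.
exists (t - z%:~R * (2 * pi)); first by apply/andP; split; lra.
move=> h hp.
have shift (s : R) (n : nat) : h (s + n%:R * (2 * pi)) = h s.
  elim: n => [|n IH]; first by rewrite mul0r addr0.
  have -> : s + n.+1%:R * (2 * pi) = s + n%:R * (2 * pi) + 2 * pi by rewrite -natr1; ring.
  by rewrite hp.
case: (intP z) => [|n|n]; first by rewrite mulr0z mul0r subr0.
  by have := shift (t - n.+1%:R * (2 * pi)) n.+1; rewrite subrK.
by rewrite rmorphN/= mulNr opprK shift.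
Qed.

Lemma cos_periodic (k : nat) (t : R) : cos (k%:R * (t + 2 * pi)) = cos (k%:R * t) /\
  sin (k%:R * (t + 2 * pi)) = sin (k%:R * t).
Proof.
rewrite mulrDr; elim: k => [|k [IH1 IH2]]; first by rewrite !mul0r addr0.
have -> : k.+1%:R * t + k.+1%:R * (2 * pi) = (k%:R * t + k%:R * (2 * pi) + t) + pi *+ 2.
  by rewrite -natr1; ring.
have -> : k.+1%:R * t = k%:R * t + t by rewrite -natr1 mulrDl mul1r.
move: IH1 IH2; move: (k%:R * t + k%:R * (2 * pi)) => X IH1 IH2.
by rewrite cosD2pi sinD2pi !cosD !sinD IH1 IH2.
Qed.

Definition is_harmonic (k : R) (e de : R -> R) := [/\ forall x : R, is_derive x 1 e (de x),
  forall x : R, is_derive x 1 de (- k ^+ 2 * e x), e 0 = e (2 * pi), de 0 = de (2 * pi)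
  & forall t, `|e t| <= 1].

Lemma is_derive_cosM (k t : R) : is_derive t 1 (fun t => cos (k * t)) (- k * sin (k * t)).
Proof.
by apply: is_derive_eq (dcomp (is_derive_cos (k * t)) (dscale k (did t))) _; ring.
Qed.

Lemma is_derive_sinM (k t : R) : is_derive t 1 (fun t => sin (k * t)) (k * cos (k * t)).
Proof.
by apply: is_derive_eq (dcomp (is_derive_sin (k * t)) (dscale k (did t))) _; ring.
Qed.

Lemma harmonic_cos (k : nat) : is_harmonic k%:R (fun t => cos (k%:R * t)) (fun t => - k%:R * sin (k%:R * t)).
Proof.
have [h1 h2] := cos_periodic k 0; rewrite add0r in h1 h2; split.
- by move=> x; exact: is_derive_cosM.
- move=> x; apply: is_derive_eq (dscale (- k%:R) (is_derive_sinM k%:R x)) _; ring.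
- by rewrite h1.
- by rewrite h2.
- by move=> t; rewrite ler_norml cos_geN1 cos_le1.
Qed.

Lemma harmonic_sin (k : nat) : is_harmonic k%:R (fun t => sin (k%:R * t)) (fun t => k%:R * cos (k%:R * t)).
Proof.
have [h1 h2] := cos_periodic k 0; rewrite add0r in h1 h2; split.
- by move=> x; exact: is_derive_sinM.
- move=> x; apply: is_derive_eq (dscale (k%:R) (is_derive_cosM k%:R x)) _; ring.
- by rewrite h2.
- by rewrite h1.
- by move=> t; rewrite ler_norml sin_geN1 sin_le1.
Qed.

Lemma harmonic_orthogonal (k l : R) e de f df : k ^+ 2 != l ^+ 2 ->
  is_harmonic k e de -> is_harmonic l f df -> circle_int (fun t => f t * e t) = 0.
Proof.
move=> kl [e1 e2 e3 e4 _] [f1 f2 f3 f4 _].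
have kl' : k ^+ 2 - l ^+ 2 != 0 by rewrite subr_eq0.
have [G hG GE] := circle_int_parts f1 f2 f3 f4 e1 e2 e3 e4.
apply: circle_intE; exists (fun t => (k ^+ 2 - l ^+ 2)^-1 * G t); last by rewrite -mulrBr -GE mulr0.
move=> x hx; apply: is_derive_eq (dscale _ (hG x hx)) _.
by move: (f x) (e x) => a b; field.
Qed.

Lemma circle_int_cos_sin (k : nat) : (0 < k)%N ->
  [/\ circle_int (fun t : R => cos (k%:R * t) * cos (k%:R * t)) = pi,
      circle_int (fun t : R => sin (k%:R * t) * sin (k%:R * t)) = pi &
      circle_int (fun t : R => cos (k%:R * t) * sin (k%:R * t)) = 0 :> R].
Proof.
move=> k0; have kn : k%:R != 0 :> R by rewrite pnatr_eq0 -lt0n.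
have [h1 h2] := cos_periodic k 0; rewrite add0r mulr0 cos0 sin0 in h1 h2.
have dsc x := dmul (is_derive_sinM k%:R x) (is_derive_cosM k%:R x).
split; apply: circle_intE.
- exists (fun t => 1 / 2 * t + (2 * k%:R)^-1 * (sin (k%:R * t) * cos (k%:R * t))).
    move=> x _; apply: is_derive_eq (dadd (dscale _ (did x)) (dscale _ (dsc x))) _.
    have := cos2Dsin2 (k%:R * x); move: (cos _) (sin _) => a b h.
    have -> : 1 / 2 * 1 = 1 / 2 * (a ^+ 2 + b ^+ 2) :> R by rewrite h.
    by field.
  by rewrite h1 h2 !mulr0 sin0 cos0; field.
- exists (fun t => 1 / 2 * t - (2 * k%:R)^-1 * (sin (k%:R * t) * cos (k%:R * t))).
    move=> x _; apply: is_derive_eq (dsub (dscale _ (did x)) (dscale _ (dsc x))) _.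
    have := cos2Dsin2 (k%:R * x); move: (cos _) (sin _) => a b h.
    have -> : 1 / 2 * 1 = 1 / 2 * (a ^+ 2 + b ^+ 2) :> R by rewrite h.
    by field.
  by rewrite h1 h2 !mulr0 sin0 cos0; field.
- exists (fun t => (2 * k%:R)^-1 * (sin (k%:R * t) * sin (k%:R * t))).
    move=> x _; apply: is_derive_eq (dscale _ (dmul (is_derive_sinM k%:R x) (is_derive_sinM k%:R x))) _.
    by move: (cos _) (sin _) => a b; field.
  by rewrite h2 !mulr0 sin0 !mulr0 subrr.
Qed.

Variables (lam : R) (u : R * R -> R).
Hypotheses (lam0 : 0 < lam) (hu : dirichlet_eigenfunction lam u).
Let mu := Num.sqrt lam.

Let mu0 : 0 < mu. Proof. by rewrite sqrtr_gt0. Qed.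
Let mu2 : mu ^+ 2 = lam. Proof. by rewrite sqr_sqrtr// ltW. Qed.

Let C1_grad (f : R * R -> R) : C1_on unit_disc f -> has_grad f ('D_dir_x f) ('D_dir_y f).
Proof.
move=> hf p dp; have [h1 h2] := hf p dp dir_x (or_introl erefl).
have [h3 h4] := hf p dp dir_y (or_intror erefl).
by split; [exact: derivableP h1|exact: derivableP h3|exact: h2|exact: h4].
Qed.

Let gu : has_grad u ('D_dir_x u) ('D_dir_y u).
Proof. by case: hu => -[h _ _] _ _ _ _; exact: C1_grad. Qed.

Let cu (p : R * R) : unit_disc p -> {for p, continuous u}.
Proof. by move=> dp; exact: grad_continuous gu dp. Qed.

(** Letting r tend to 1 turns the boundary condition into kap J_k(mu) = 0. *)
Lemma harmonic_coeff (k : nat) e de : is_harmonic k%:R e de ->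
  exists kap, kap * bj k mu = 0 /\
    forall r, 0 < r < 1 -> circle_int (fun t => u (pt r t) * e t) = kap * bj k (mu * r).
Proof.
move=> [e1 e2 e3 e4 e5]; have [[_ hx hy] cb hl hb _] := hu.
have hl' p : unit_disc p -> - ('D_dir_x ('D_dir_x u) p + 'D_dir_y ('D_dir_y u) p) = mu ^+ 2 * u p.
  by move=> dp; rewrite mu2 -hl.
have o1 := circle_coeff_ode1 gu e1 e5.
have o2 := circle_coeff_ode2 gu (C1_grad hx) (C1_grad hy) hl' e1 e2 e3 e4 e5.
have o3 := circle_coeff_bounds gu (C1_grad hx) (C1_grad hy) e1 e5.
have [kap hk] := bessel_ode_bounded_solution mu0 o1 o2 o3.
exists kap; split => //; apply/eqP/negPn/negP => c0.
have c0' : 0 < `|kap * bj k mu| / 4 by rewrite divr_gt0 ?normr_gt0.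
have [d d0 hd] := circle_coeff_boundary gu e1 e5 cb hb c0'.
have cf : {for (1 : R), continuous (fun r => kap * bj k (mu * r))}.
  apply: cvgM; first exact: cvg_cst.
  apply: (@continuous_comp _ _ _ (fun r => mu * r) (bj k)); last exact: continuous_bj_everywhere.
  exact: is_derive_continuous (dscale mu (did 1)).
have [d2 d20 hd2] := continuous_epsilon cf c0'.
have m0 : 0 < Num.min 1 (Num.min d d2) by rewrite !lt_min ltr01 d0 d20.
pose q := Num.min 1 (Num.min d d2) / 2.
have m1 : Num.min 1 (Num.min d d2) <= 1 by rewrite ge_min lexx.
have m2 : Num.min 1 (Num.min d d2) <= d by rewrite !ge_min lexx !orbT.
have m3 : Num.min 1 (Num.min d d2) <= d2 by rewrite !ge_min lexx !orbT.
have q0 : 0 < q by rewrite divr_gt0.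
have hr : 0 < 1 - q < 1 by apply/andP; split; rewrite /q; lra.
have := hd (1 - q) hr; rewrite hk// => /(_ _) h1.
have := hd2 (1 - q); have -> : 1 - q - 1 = - q by ring.
rewrite mulr1 normrN (gtr0_norm q0) => /(_ _) h2.
have {}h1 : `|kap * bj k (mu * (1 - q))| <= `|kap * bj k mu| / 4 by apply: h1; rewrite /q; lra.
have {}h2 : `|kap * bj k (mu * (1 - q)) - kap * bj k mu| < `|kap * bj k mu| / 4.
  by apply: h2; rewrite /q; lra.
have := ler_normB (kap * bj k (mu * (1 - q))) (kap * bj k (mu * (1 - q)) - kap * bj k mu).
by rewrite opprB addrCA subrr addr0; have := normr_gt0 (kap * bj k mu); rewrite c0; lra.
Qed.

Lemma eigenfunction_not_radially_zero : (forall r t, 0 < r < 1 -> u (pt r t) = 0) -> False.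
Proof.
move=> z; case: hu => _ _ _ _ [p dp]; apply/negP/negPn/eqP.
have [t _ pE] := polar_exists 0 p.
have n1 : enorm p < 1.
  by rewrite -(ltr_pXn2r (n := 2)) ?nnegrE ?enorm_ge0// expr1n enorm_sqr.
have := enorm_ge0 p; rewrite le_eqVlt => /predU1P[e0|e0]; last by rewrite pE z// e0.
rewrite pE -e0; apply: (@continuous_zero_right (fun r => u (pt r t))); last by move=> x; exact: z.
apply: is_derive_continuous (is_derive_pt_radial t gu _).
by rewrite normr0.
Qed.

Theorem eigenfunction_classification : exists k s (a b : R),
  [/\ mu = bjz k s, a != 0 \/ ((0 < k)%N /\ b != 0) &
   forall r t, 0 <= r < 1 ->
     u (pt r t) = (a * cos (k%:R * t) + b * sin (k%:R * t)) * bj k (mu * r)].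
Proof.
have hp := @pi_gt0 R.
have cur r : 0 < r < 1 -> continuous (fun t => u (pt r t)).
  by move=> /andP[r0 r1]; apply: continuous_pt cu _; rewrite gtr0_norm.
have uper r t : u (pt r (t + 2 * pi)) = u (pt r t).
  by rewrite /pt [2 * pi]mulr_natl cosD2pi sinD2pi.
have [[k0 k0z]|nok] := pselect (exists k, bj k mu = 0); last first.
  (* If mu is a zero of no J_k, all Fourier coefficients vanish, and u = 0. *)
  exfalso; apply: eigenfunction_not_radially_zero => r t hr.
  have [s hs hper] := periodic_eq t; rewrite (hper (fun t => u (pt r t)) (uper r)).
  apply: (@fourier_uniqueness R (fun t => u (pt r t))) => //; first exact: cur.
  have nz k kap : kap * bj k mu = 0 -> kap = 0.
    by move/eqP; rewrite mulf_eq0 => /orP[/eqP//|/eqP h]; case: nok; exists k.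
  move=> k; have [kc [/nz -> ->//]] := harmonic_coeff (harmonic_cos k).
  by have [ks [/nz -> ->//]] := harmonic_coeff (harmonic_sin k); rewrite !mul0r.
have [kc [_ hkc]] := harmonic_coeff (harmonic_cos k0).
have [ks [_ hks]] := harmonic_coeff (harmonic_sin k0).
(* The integral of cos^2 (k t) over a period is 2 pi for k = 0 and pi otherwise; for k = 0 there is
   no sine term. *)
pose a := if k0 is 0%N then kc / (2 * pi) else kc / pi.
pose b := if k0 is 0%N then 0 else ks / pi.
have ch (k : nat) : continuous (fun t : R => cos (k%:R * t)) by exact: continuous_cosM.
have sh (k : nat) : continuous (fun t : R => sin (k%:R * t)) by exact: continuous_sinM.
have main r t : 0 < r < 1 ->
    u (pt r t) = (a * cos (k0%:R * t) + b * sin (k0%:R * t)) * bj k0 (mu * r).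
  move=> hr; pose Y := bj k0 (mu * r).
  pose g (t : R) := 1 * u (pt r t) + (- Y) * (a * cos (k0%:R * t) + b * sin (k0%:R * t)).
  suff : g t = 0 by rewrite /g mul1r mulNr => /eqP; rewrite subr_eq0 => /eqP ->; rewrite mulrC.
  have gper (t' : R) : g (t' + 2 * pi) = g t'.
    by rewrite /g uper; have [-> ->] := cos_periodic k0 t'.
  have [s hs hper] := periodic_eq t; rewrite (hper g gper).
  have ck : continuous (fun t : R => a * cos (k0%:R * t) + b * sin (k0%:R * t)).
    by move=> x; apply: cvgD; [exact: (continuous_scale (ch k0))|exact: (continuous_scale (sh k0))].
  have cg : continuous g.
    by move=> x; apply: cvgD; [exact: (continuous_scale (cur _ hr))|exact: (continuous_scale ck)].
  apply: fourier_uniqueness cg _ hs => k.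
  have int3 (h : R -> R) : continuous h -> circle_int (fun t => g t * h t) =
      circle_int (fun t => u (pt r t) * h t) - Y * (a * circle_int (fun t : R => cos (k0%:R * t) * h t)
        + b * circle_int (fun t : R => sin (k0%:R * t) * h t)).
    move=> chh.
    have c1 := continuous_mulM (cur _ hr) chh.
    have c2 := continuous_mulM (ch k0) chh.
    have c3 := continuous_mulM (sh k0) chh.
    rewrite -(circle_intZ a c2) -(circle_intZ b c3).
    rewrite -circle_intD; [|exact: continuous_scale..].
    have c4 : continuous (fun t : R => a * (cos (k0%:R * t) * h t) + b * (sin (k0%:R * t) * h t)).
      by move=> x; apply: cvgD; [exact: (continuous_scale c2)|exact: (continuous_scale c3)].
    rewrite -(circle_intZ Y c4) -circle_intB//; last exact: continuous_scale.
    by apply: eq_circle_int => x; rewrite /g; ring.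
  rewrite !int3//.
  have [kk|kk] := eqVneq k k0.
    subst k; rewrite hkc// hks// -/Y; case: (posnP k0) => k00.
      rewrite /a /b k00 /=.
      have -> : circle_int (fun t : R => cos (0%:R * t) * cos (0%:R * t)) = 2 * pi :> R.
        apply: circle_intE; exists (fun x => x); last by rewrite subr0.
        by move=> x _; apply: is_derive_eq (did x) _; rewrite mul0r cos0 mulr1.
      have z2 (h : R -> R) : circle_int (fun t : R => h t * sin (0%:R * t)) = 0.
        apply: circle_intE; exists (fun=> 0); last by rewrite subr0.
        by move=> x _; apply: is_derive_eq (dcst 0 x) _; rewrite mul0r sin0 mulr0.
      have ks0 : ks * Y = 0.
        by rewrite -hks// k00 z2.
      by rewrite !z2 ks0 !mul0r !mulr0 !addr0 mulr0 subr0 divfK ?gt_eqF ?mulr_gt0// mulrC subrr.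
    have [i1 i2 i3] := @circle_int_cos_sin k0 k00.
    have i4 : circle_int (fun t : R => sin (k0%:R * t) * cos (k0%:R * t)) = 0 :> R.
      by rewrite -[RHS]i3; apply: eq_circle_int => x; rewrite mulrC.
    rewrite i1 i2 i3 i4; have -> : a = kc / pi by rewrite /a; case: (k0) k00.
    have -> : b = ks / pi by rewrite /b; case: (k0) k00.
    by rewrite !mulr0 addr0 add0r !divfK ?gt_eqF// ![Y * _]mulrC !subrr.
  (* Bourget's hypothesis enters here: mu is not a zero of J_k for k <> k0. *)
  have nz kap : kap * bj k mu = 0 -> kap = 0.
    move/eqP; rewrite mulf_eq0 => /orP[/eqP//|/eqP h].
    by move: kk; rewrite (bj_order_inj mu0 h k0z) eqxx.
  have kl : k%:R ^+ 2 != k0%:R ^+ 2 :> R by rewrite eqrXn2// eqr_nat.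
  have [c1 [/nz -> ->//]] := harmonic_coeff (harmonic_cos k).
  have [c2 [/nz -> ->//]] := harmonic_coeff (harmonic_sin k).
  rewrite (harmonic_orthogonal kl (harmonic_cos k) (harmonic_cos k0)).
  rewrite (harmonic_orthogonal kl (harmonic_cos k) (harmonic_sin k0)).
  rewrite (harmonic_orthogonal kl (harmonic_sin k) (harmonic_cos k0)).
  rewrite (harmonic_orthogonal kl (harmonic_sin k) (harmonic_sin k0)).
  by rewrite !mul0r !mulr0 addr0 mulr0 subr0.
have [s sE] := bj_root_bjz mu0 k0z.
exists k0, s, a, b; split => //.
  have [a0|] := eqVneq a 0; last by left.
  have [b0|bn0] := eqVneq b 0.
    exfalso; apply: eigenfunction_not_radially_zero => r t hr.
    by rewrite main// a0 b0 !mul0r addr0 mul0r.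
  by right; split => //; move: bn0; rewrite /b; case: (k0) => //; rewrite eqxx.
move=> r t /andP[]; rewrite le_eqVlt => /predU1P[<- _|r0 r1]; last by apply: main; rewrite r0.
apply/eqP; rewrite -subr_eq0; apply/eqP.
apply: (@continuous_zero_right (fun r => u (pt r t) - _ * bj k0 (mu * r))); last first.
  by move=> x hx; rewrite main// subrr.
apply: cvgB.
  by apply: is_derive_continuous (is_derive_pt_radial t gu _); rewrite normr0.
apply: cvgM; first exact: cvg_cst.
apply: (@continuous_comp _ _ _ (fun r => mu * r) (bj k0)); last exact: continuous_bj_everywhere.
exact: is_derive_continuous (dscale mu (did 0)).
Qed.

End classification.

(** * Nodal lengths *)

Section nodal_length.
Context {R : realType}.

Lemma sin_natpi (n : nat) : sin (n%:R * pi) = 0 :> R.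
Proof.
elim: n => [|n IH]; first by rewrite mul0r sin0.
by rewrite -natr1 mulrDl mul1r sinDpi IH oppr0.
Qed.

Lemma cos_natpi_pihalf (n : nat) : cos (n%:R * pi + pi / 2) = 0 :> R.
Proof. by rewrite cosDpihalf sin_natpi oppr0. Qed.

Lemma sin_eq0_natpi (x : R) : 0 <= x -> sin x = 0 -> exists n : nat, x = n%:R * pi.
Proof.
move=> x0 sx; have p0 := pi_gt0 R.
have h0 : 0 <= x / pi by rewrite divr_ge0// ltW.
have := truncn_itv h0 => /andP[]; set n := Num.trunc _ => h1 h2.
rewrite ler_pdivlMr// in h1; rewrite ltr_pdivrMr// -natr1 mulrDl mul1r in h2.
have shift m (y : R) : sin (y + m%:R * pi) = 0 -> sin y = 0.
  elim: m => [|m IH]; first by rewrite mul0r addr0.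
  rewrite -natr1 mulrDl mul1r addrA sinDpi => /eqP; rewrite oppr_eq0 => /eqP; exact: IH.
have := shift n (x - n%:R * pi); rewrite subrK => /(_ sx) s0.
exists n; apply/eqP; rewrite eq_le h1 andbT leNgt; apply/negP => h.
have : 0 < sin (x - n%:R * pi) by apply: sin_gt0_pi; apply/andP; split; lra.
by rewrite s0 ltxx.
Qed.

Definition is_polar_form (k : nat) (a b mu : R) (u : R * R -> R) := forall r t, 0 <= r < 1 ->
  u (pt r t) = (a * cos (k%:R * t) + b * sin (k%:R * t)) * bj k (mu * r).

(** In amplitude and phase form the function is rho cos (k t - phi). Its zeros are spaced by pi / k,
    starting from [al] = (phi + pi / 2) / k, so a half-open turn contains 2 k of them. The maximum
    with 1 keeps the step meaningful for k = 0, where there are none. *)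
Lemma trig_zeros (k : nat) (a b : R) : a != 0 \/ ((0 < k)%N /\ b != 0) ->
  exists al, forall t, al <= t < al + 2 * pi ->
    (a * cos (k%:R * t) + b * sin (k%:R * t) = 0 <->
     exists2 j, (j < 2 * k)%N & t = al + j%:R * (2 * pi / (maxn (2 * k) 1)%:R)).
Proof.
move=> hab; have p0 := pi_gt0 R.
case: (posnP k) => [k0|k0].
  exists 0 => t _; rewrite k0 mul0r cos0 sin0 mulr1 mulr0 addr0; split=> [a0|[]//].
  by case: hab => [|[]]; rewrite ?k0// a0 eqxx.
have kp : 0 < k%:R :> R by rewrite ltr0n.
have [phi _ abE] := polar_exists 0 (a, b).
pose rho := enorm (a, b).
have [aE bE] : a = rho * cos phi /\ b = rho * sin phi by case: abE.
have rho0 : rho != 0.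
  apply/eqP => r0; move: hab; rewrite aE bE r0 !mul0r eqxx.
  by case=> // -[].
have form t : a * cos (k%:R * t) + b * sin (k%:R * t) = rho * cos (k%:R * t - phi).
  by rewrite cosB aE bE; ring.
exists ((phi + pi / 2) / k%:R) => t /andP[t0 t1].
set al := (phi + pi / 2) / k%:R in t0 t1 *.
have -> : maxn (2 * k) 1 = (2 * k)%N by apply/maxn_idPl; rewrite muln_gt0.
have hh : 2 * pi / (2 * k)%:R = pi / k%:R :> R by rewrite natrM; field; rewrite gt_eqF.
have kal : k%:R * al = phi + pi / 2 by rewrite /al; field; rewrite gt_eqF.
rewrite form hh; split.
  move/eqP; rewrite mulf_eq0 (negbTE rho0)/= => /eqP c0.
  have tau0 : 0 <= k%:R * (t - al) by rewrite mulr_ge0 ?(ltW kp)// subr_ge0.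
  have [|j jE] := @sin_eq0_natpi (k%:R * (t - al)) tau0.
    have e : k%:R * t - phi = k%:R * (t - al) + pi / 2 by rewrite mulrBr kal; ring.
    by move: c0; rewrite e cosDpihalf => /eqP; rewrite oppr_eq0 => /eqP.
  exists j.
    have h1 : k%:R * (t - al) < k%:R * (2 * pi) by rewrite ltr_pM2l//; lra.
    rewrite -(ltr_nat R) -(ltr_pM2r p0) -jE natrM.
    by apply: lt_le_trans h1 _; rewrite mulrA [k%:R * 2]mulrC.
  by rewrite mulrA -jE; field; rewrite gt_eqF.
move=> [j _ ->]; have -> : k%:R * (al + j%:R * (pi / k%:R)) - phi = j%:R * pi + pi / 2.
  rewrite mulrDr kal; field; rewrite gt_eqF//.
by rewrite cos_natpi_pihalf mulr0.
Qed.

(** Being stated for any function with this polar form, it serves arbitrary eigenfunctions as well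
    as [disc_eigenfunction] and [disc_mode]. *)
Lemma nodal_ratio_polar_form k s (a b : R) u : a != 0 \/ ((0 < k)%N /\ b != 0) ->
  is_polar_form k a b (bjz k s) u -> nodal_ratio (bjz k s ^+ 2) u = (disc_ratio k s)%:E.
Proof.
move=> hab hu; have p0 := pi_gt0 R.
set mu := bjz k s in hu *; have mu0 : 0 < mu := bjz_gt0 k s.
have [al hal] := trig_zeros hab.
pose M := maxn (2 * k) 1.
have M0 : (0 < M)%N by rewrite leq_max orbT.
pose h : R := 2 * pi / M%:R.
have hM : M%:R * h = 2 * pi by rewrite /h mulrC divfK// pnatr_eq0 -lt0n.
pose r n : R := if n is i.+1 then bjz k i / mu else 0.
have r1 : r s.+1 = 1 by rewrite /r divff// gt_eqF.
have rS i : (i <= s)%N -> r i < r i.+1.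
  move=> _; case: i => [|i]; rewrite /r; first by rewrite divr_gt0// bjz_gt0.
  by rewrite ltr_pM2r ?invr_gt0// bjz_lt.
have NE p : nodal_set u p <-> (exists2 i, (i < s)%N & enorm p = r i.+1) \/
    (exists j x, [/\ (j < 2 * k)%N, 0 <= x < 1 & p = pt x (al + j%:R * h)]).
  have lt1 : unit_disc p <-> enorm p < 1.
    rewrite /unit_disc/= -enorm_sqr -[X in _ < X](expr1n _ 2).
    by rewrite ltr_pXn2r ?nnegrE ?enorm_ge0.
  split.
    move=> [/lt1 p1 /= up]; have [t ht pE] := polar_exists al p.
    have en : 0 <= enorm p < 1 by rewrite enorm_ge0.
    move: up; rewrite {1}pE hu// => /eqP; rewrite mulf_eq0 => /orP[/eqP e|/eqP e].
      move/(hal t ht): e => [j jk tE]; right; exists j, (enorm p); split => //.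
      by rewrite /h -tE.
    have := enorm_ge0 p; rewrite le_eqVlt => /predU1P[e0|e0].
      (* A zero at the origin forces k > 0 because J_0(0) = 1, so the radius j = 0 exists and
         contains the origin. *)
      rewrite -e0 mulr0 in e; right; exists 0%N, 0; split.
      - by case: (k) e => //; rewrite bj0_at0 => /eqP; rewrite oner_eq0.
      - by rewrite lexx ltr01.
      - by rewrite pE -e0 /pt !mul0r.
    have me : 0 < mu * enorm p by rewrite mulr_gt0.
    have [n nE] := bj_root_bjz me e; left; exists n.
      have : (bjz k n : R) < bjz k s by rewrite -nE -[ltRHS]mulr1 ltr_pM2l.
      by apply: contraTltn => sn; rewrite -leNgt bjz_mono.
    by rewrite /r -nE mulrAC divff ?mul1r// gt_eqF.
  move=> [[i si pE]|[j [x [jk x01 ->]]]].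
    have ri : r i.+1 < 1.
      rewrite /r ltr_pdivrMr// mul1r lt_neqAle bjz_le ?(ltnW si)// andbT.
      by apply/eqP => e; have := @bjz_mono R k s i; rewrite -/mu e lexx leqNgt si.
    have p1 : enorm p < 1 by rewrite pE.
    split; first exact/lt1.
    have [t _ pE'] := polar_exists al p.
    rewrite /= pE' hu ?enorm_ge0 ?p1// pE /r [mu * _]mulrC divfK ?gt_eqF//.
    by rewrite bjz_root mulr0.
  have /andP[x0 x1] := x01.
  split; first by apply: pt_in_disc; rewrite ger0_norm.
  rewrite /= hu//; suff -> : a * cos (k%:R * (al + j%:R * h)) + b * sin (k%:R * (al + j%:R * h)) = 0.
    by rewrite mul0r.
  apply/hal; last by exists j.
  have jM : (j%:R : R) < M%:R by rewrite ltr_nat (leq_trans jk)// leq_maxl.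
  have h0 : 0 < h by rewrite /h divr_gt0 ?mulr_gt0// ltr0n.
  by rewrite lerDl mulr_ge0 ?(ltW h0)//= ltrD2l -hM ltr_pM2r.
rewrite /nodal_ratio (@hausdorff1_circles_rays R s (2 * k) M r al h (nodal_set u))//; last exact: leq_maxl.
rewrite sqrtr_sqr gtr0_norm// -EFinM; congr (_%:E).
rewrite /disc_ratio -/mu /r -mulr_suml natrM.
by move: (\sum_(i < s) _) => S; field; rewrite gt_eqF.
Qed.

End nodal_length.

Section explicit_eigenfunction_ratio.
Context {R : realType}.

Lemma cos_sin_mult_eq (s t : R) : cos s = cos t -> sin s = sin t -> forall k : nat,
  cos (k%:R * s) = cos (k%:R * t) /\ sin (k%:R * s) = sin (k%:R * t).
Proof.
move=> hc hs; elim=> [|k [IH1 IH2]]; first by rewrite !mul0r.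
by rewrite -natr1 !mulrDl !mul1r !cosD !sinD IH1 IH2 hc hs.
Qed.

(** Addition formula for sin (k t + theta0). [polar_angle] agrees with t only modulo 2 pi, which is
    harmless as k is an integer; at the origin, J_k(0) = 0 or k = 0. *)
Lemma nodal_ratio_disc_eigenfunction k s (theta0 : R) : (k = 0%N -> sin theta0 != 0) ->
  nodal_ratio (disc_eigenvalue k s.+1) (disc_eigenfunction k s.+1 theta0) = (disc_ratio k s)%:E.
Proof.
move=> hk; rewrite /disc_eigenvalue bessel_zero_bjz.
apply: (@nodal_ratio_polar_form R k s (sin theta0) (cos theta0)).
  case: (posnP k) => [/hk|k0]; first by left.
  have [s0|] := eqVneq (sin theta0) 0; last by left.
  right; split => //; apply/eqP => c0; have := cos2Dsin2 theta0.
  by rewrite s0 c0 expr0n/= addr0 => /eqP; rewrite eq_sym oner_eq0.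
move=> r t /andP[r0 r1].
rewrite /disc_eigenfunction /disc_eigenvalue bessel_zero_bjz sqrtr_sqr gtr0_norm ?bjz_gt0//.
rewrite enorm_pt// besselJE -/(bj k _).
move: r0; rewrite le_eqVlt => /predU1P[<-|r0].
  rewrite mulr0; case: (k) => [|k']; last by rewrite bj_at0 mulr0 mul0r.
  by rewrite !mul0r add0r cos0 sin0 mulr1 mulr0 addr0 mulrC.
have [_ ptE] : [set t' | 0 <= t' < 2 * pi /\ pt r t = (enorm (pt r t) * cos t', enorm (pt r t) * sin t')]
    (polar_angle (pt r t)).
  apply: xgetPex; have [t' ht' tE] := polar_exists 0 (pt r t).
  by exists t'; rewrite add0r in ht'; split.
move: ptE; rewrite enorm_pt ?(ltW r0)// /pt; move: (polar_angle _) => A [/esym e1 /esym e2].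
have [c s'] := cos_sin_mult_eq (mulfI (lt0r_neq0 r0) e1) (mulfI (lt0r_neq0 r0) e2) k.
by rewrite sinD c s'; ring.
Qed.

End explicit_eigenfunction_ratio.

(** * A smooth eigenfunction for every zero *)

Section explicit_eigenfunction.
Context {R : realType}.
Implicit Types (f g fx fy gx gy : R * R -> R).

Definition D1 f fx fy := forall p, is_derive p dir_x f (fx p) /\ is_derive p dir_y f (fy p).

Lemma D1_eq f fx fy gx gy : D1 f fx fy -> (forall p, fx p = gx p) -> (forall p, fy p = gy p) ->
  D1 f gx gy.
Proof. by move=> h /funext <- /funext <-. Qed.

Lemma D1_fst : D1 (fun p => p.1) (fun=> 1) (fun=> 0).
Proof. by move=> p; split; [apply/is_derive_dir_x; exact: did|apply/is_derive_dir_y; exact: dcst]. Qed.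

Lemma D1_snd : D1 (fun p => p.2) (fun=> 0) (fun=> 1).
Proof. by move=> p; split; [apply/is_derive_dir_x; exact: dcst|apply/is_derive_dir_y; exact: did]. Qed.

Lemma D1_add f fx fy g gx gy : D1 f fx fy -> D1 g gx gy ->
  D1 (fun p => f p + g p) (fun p => fx p + gx p) (fun p => fy p + gy p).
Proof.
move=> hf hg p; have [f1 f2] := hf p; have [g1 g2] := hg p; split.
  by move: f1 g1 => /is_derive_dir_x f1 /is_derive_dir_x g1; apply/is_derive_dir_x; exact: dadd f1 g1.
by move: f2 g2 => /is_derive_dir_y f2 /is_derive_dir_y g2; apply/is_derive_dir_y; exact: dadd f2 g2.
Qed.

Lemma D1_sub f fx fy g gx gy : D1 f fx fy -> D1 g gx gy ->
  D1 (fun p => f p - g p) (fun p => fx p - gx p) (fun p => fy p - gy p).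
Proof.
move=> hf hg p; have [f1 f2] := hf p; have [g1 g2] := hg p; split.
  by move: f1 g1 => /is_derive_dir_x f1 /is_derive_dir_x g1; apply/is_derive_dir_x; exact: dsub f1 g1.
by move: f2 g2 => /is_derive_dir_y f2 /is_derive_dir_y g2; apply/is_derive_dir_y; exact: dsub f2 g2.
Qed.

Lemma D1_scale c f fx fy : D1 f fx fy ->
  D1 (fun p => c * f p) (fun p => c * fx p) (fun p => c * fy p).
Proof.
move=> hf p; have [f1 f2] := hf p; split.
  by move: f1 => /is_derive_dir_x f1; apply/is_derive_dir_x; exact: dscale f1.
by move: f2 => /is_derive_dir_y f2; apply/is_derive_dir_y; exact: dscale f2.
Qed.

Lemma D1_mul f fx fy g gx gy : D1 f fx fy -> D1 g gx gy ->
  D1 (fun p => f p * g p) (fun p => fx p * g p + f p * gx p) (fun p => fy p * g p + f p * gy p).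
Proof.
move=> hf hg p; have [f1 f2] := hf p; have [g1 g2] := hg p; split.
  move: f1 g1 => /is_derive_dir_x f1 /is_derive_dir_x g1; apply/is_derive_dir_x.
  by apply: is_derive_eq (dmul f1 g1) _; rewrite /= -surjective_pairing.
move: f2 g2 => /is_derive_dir_y f2 /is_derive_dir_y g2; apply/is_derive_dir_y.
by apply: is_derive_eq (dmul f2 g2) _; rewrite /= -surjective_pairing.
Qed.

Lemma D1_C1 f fx fy : D1 f fx fy -> continuous fx -> continuous fy ->
  [/\ C1_on unit_disc f, 'D_dir_x f = fx & 'D_dir_y f = fy].
Proof.
move=> hf cx cy.
have ex : 'D_dir_x f = fx by apply/funext => p; have [[_ h] _] := hf p.
have ey : 'D_dir_y f = fy by apply/funext => p; have [_ [_ h]] := hf p.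
split => // p _ e [] ->; rewrite ?ex ?ey; have [[h1 _] [h2 _]] := hf p; split=> //.
  exact: cx.
exact: cy.
Qed.

(* Real and imaginary parts of (x + iy)^k. *)
Fixpoint zpow (k : nat) (p : R * R) : R * R := if k is k'.+1
  then (p.1 * (zpow k' p).1 - p.2 * (zpow k' p).2, p.1 * (zpow k' p).2 + p.2 * (zpow k' p).1)
  else (1, 0).

Let zr k p := (zpow k p).1.
Let zi k p := (zpow k p).2.

Lemma zpow_pt k r t : zpow k (pt r t) = pt (r ^+ k) (k%:R * t).
Proof.
elim: k => [|k IH]; first by rewrite /pt mul0r cos0 sin0 expr0 mulr1 mulr0.
have e : k.+1%:R * t = k%:R * t + t by rewrite -natr1 mulrDl mul1r.
by rewrite /= IH /pt /= e cosD sinD exprS; congr pair; ring.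
Qed.

Lemma zpow_D1 k : D1 (zr k) (fun p => k%:R * zr k.-1 p) (fun p => - k%:R * zi k.-1 p) /\
  D1 (zi k) (fun p => k%:R * zi k.-1 p) (fun p => k%:R * zr k.-1 p).
Proof.
elim: k => [|k [IHr IHi]].
  split; move=> p; split; rewrite ?oppr0 mul0r;
    first [apply/is_derive_dir_x; exact: dcst|apply/is_derive_dir_y; exact: dcst].
have step p : k%:R * (p.1 * zr k.-1 p - p.2 * zi k.-1 p) = k%:R * zr k p /\
    k%:R * (p.1 * zi k.-1 p + p.2 * zr k.-1 p) = k%:R * zi k p.
  by case: (k) => [|k']; rewrite ?mul0r.
split.
  apply: D1_eq (D1_sub (D1_mul D1_fst IHr) (D1_mul D1_snd IHi)) _ _ => p;
    have [s1 s2] := step p; rewrite -natr1.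
    by rewrite [RHS]mulrDl -s1; ring.
  have -> : - (k%:R + 1) * zi k.+1.-1 p = - (k%:R * zi k p) - zi k p by rewrite /=; ring.
  by rewrite -s2; ring.
apply: D1_eq (D1_add (D1_mul D1_fst IHi) (D1_mul D1_snd IHr)) _ _ => p;
  have [s1 s2] := step p; rewrite -natr1.
  by rewrite [RHS]mulrDl -s2; ring.
by rewrite [RHS]mulrDl -s1; ring.
Qed.

Lemma continuous_zpow k : continuous (zr k) /\ continuous (zi k).
Proof.
elim: k => [|k [IHr IHi]]; first by split=> p; exact: cvg_cst.
split=> p; [apply: cvgB|apply: cvgD]; apply: cvgM; try exact: IHr; try exact: IHi;
  try exact: cvg_fst; exact: cvg_snd.
Qed.

Variables (k s : nat).
Let mu : R := bjz k s.
Let c := mu ^+ 2 / 4.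
Let G j (p : R * R) := bh j (c * (p.1 ^+ 2 + p.2 ^+ 2)).

Let G_D1 j : D1 (G j) (fun p => -2 * c * (p.1 * G j.+1 p)) (fun p => -2 * c * (p.2 * G j.+1 p)).
Proof.
move=> p; split.
  apply/is_derive_dir_x.
  have h : is_derive p.1 1 (fun x => c * (x ^+ 2 + p.2 ^+ 2)) _ :=
    dscale c (dadd (dpow 2 (did p.1)) (dcst (p.2 ^+ 2) p.1)).
  have := dcomp (f := bh j) (g := fun x => c * (x ^+ 2 + p.2 ^+ 2)) (is_derive_bh j _) h.
  by move/is_derive_eq; apply; rewrite /G /=; ring.
apply/is_derive_dir_y.
have h : is_derive p.2 1 (fun y => c * (p.1 ^+ 2 + y ^+ 2)) _ :=
  dscale c (dadd (dcst (p.1 ^+ 2) p.2) (dpow 2 (did p.2))).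
have := dcomp (f := bh j) (g := fun y => c * (p.1 ^+ 2 + y ^+ 2)) (is_derive_bh j _) h.
by move/is_derive_eq; apply; rewrite /G /=; ring.
Qed.

Let cG j : continuous (G j).
Proof.
move=> p; apply: (@continuous_comp _ _ _ (fun p : R * R => c * (p.1 ^+ 2 + p.2 ^+ 2)) (bh j)).
  apply: cvgM; first exact: cvg_cst.
  by apply: cvgD; [under eq_fun do rewrite expr2|under eq_fun do rewrite expr2];
     rewrite /= expr2; apply: cvgM; try exact: cvg_fst; exact: cvg_snd.
exact: is_derive_continuous (is_derive_bh j _).
Qed.

(** Up to a constant factor, J_k(mu r) cos (k t), written as Re (x + i y)^k times an entire function
    of x^2 + y^2 so that smoothness at the origin is plain. It supplies the members of
    [nodal_ratios_from] that come close to the limits. *)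
Definition disc_mode p := zr k p * G k p.

Let ux p := k%:R * zr k.-1 p * G k p + zr k p * (-2 * c * (p.1 * G k.+1 p)).
Let uy p := - k%:R * zi k.-1 p * G k p + zr k p * (-2 * c * (p.2 * G k.+1 p)).
Let uxx p := k%:R * (k.-1%:R * zr k.-2 p) * G k p + k%:R * zr k.-1 p * (-2 * c * (p.1 * G k.+1 p))
  + (k%:R * zr k.-1 p * (-2 * c * (p.1 * G k.+1 p))
     + zr k p * (-2 * c * (1 * G k.+1 p + p.1 * (-2 * c * (p.1 * G k.+2 p))))).
Let uxy p := k%:R * (- k.-1%:R * zi k.-2 p) * G k p + k%:R * zr k.-1 p * (-2 * c * (p.2 * G k.+1 p))
  + (- k%:R * zi k.-1 p * (-2 * c * (p.1 * G k.+1 p))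
     + zr k p * (-2 * c * (0 * G k.+1 p + p.1 * (-2 * c * (p.2 * G k.+2 p))))).
Let uyx p := - k%:R * (k.-1%:R * zi k.-2 p) * G k p + - k%:R * zi k.-1 p * (-2 * c * (p.1 * G k.+1 p))
  + (k%:R * zr k.-1 p * (-2 * c * (p.2 * G k.+1 p))
     + zr k p * (-2 * c * (0 * G k.+1 p + p.2 * (-2 * c * (p.1 * G k.+2 p))))).
Let uyy p := - k%:R * (k.-1%:R * zr k.-2 p) * G k p + - k%:R * zi k.-1 p * (-2 * c * (p.2 * G k.+1 p))
  + (- k%:R * zi k.-1 p * (-2 * c * (p.2 * G k.+1 p))
     + zr k p * (-2 * c * (1 * G k.+1 p + p.2 * (-2 * c * (p.2 * G k.+2 p))))).

Let mode_D1 : D1 disc_mode ux uy.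
Proof. exact: (D1_mul (zpow_D1 k).1 (G_D1 k)). Qed.

Let mode_x_D1 : D1 ux uxx uxy.
Proof.
exact: (D1_add (D1_mul (D1_scale k%:R (zpow_D1 k.-1).1) (G_D1 k))
    (D1_mul (zpow_D1 k).1 (D1_scale (-2 * c) (D1_mul D1_fst (G_D1 k.+1))))).
Qed.

Let mode_y_D1 : D1 uy uyx uyy.
Proof.
exact: (D1_add (D1_mul (D1_scale (- k%:R) (zpow_D1 k.-1).2) (G_D1 k))
    (D1_mul (zpow_D1 k).1 (D1_scale (-2 * c) (D1_mul D1_snd (G_D1 k.+1))))).
Qed.

Let cts (f : R * R -> R) := continuous f.
Let cts_mul f g : cts f -> cts g -> cts (fun p => f p * g p).
Proof. by move=> cf cg p; apply: cvgM; [exact: cf|exact: cg]. Qed.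
Let cts_add f g : cts f -> cts g -> cts (fun p => f p + g p).
Proof. by move=> cf cg p; apply: cvgD; [exact: cf|exact: cg]. Qed.
Let cts_cst (a : R) : cts (fun=> a). Proof. by move=> p; exact: cvg_cst. Qed.
Let cts_fst : cts (fun p => p.1). Proof. by move=> p; exact: cvg_fst. Qed.
Let cts_snd : cts (fun p => p.2). Proof. by move=> p; exact: cvg_snd. Qed.
Let cts_zr j : cts (fun p => zr j p). Proof. exact: (continuous_zpow j).1. Qed.
Let cts_zi j : cts (fun p => zi j p). Proof. exact: (continuous_zpow j).2. Qed.
Let cts_G j : cts (fun p => G j p). Proof. exact: cG. Qed.

Ltac cont := cbv beta; lazymatch goal with
  | |- cts (fun p => zr ?j p) => exact (@cts_zr j)
  | |- cts (fun p => zi ?j p) => exact (@cts_zi j)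
  | |- cts (fun p => G ?j p) => exact (@cts_G j)
  | |- cts (fun p => fst p) => exact cts_fst
  | |- cts (fun p => snd p) => exact cts_snd
  | |- cts (fun p => @?f p * @?g p) => refine (@cts_mul f g _ _); cont
  | |- cts (fun p => @?f p + @?g p) => refine (@cts_add f g _ _); cont
  | _ => exact (@cts_cst _)
  end.

Let D1_smooth f fx fy : D1 f fx fy -> cts fx -> cts fy ->
  [/\ C1_on unit_disc f, 'D_dir_x f = fx & 'D_dir_y f = fy].
Proof. exact: D1_C1. Qed.

Lemma disc_mode_polar : is_polar_form k ((2 / mu) ^+ k) 0 mu disc_mode.
Proof.
move=> r t /andP[r0 r1]; have mu0 : 0 < mu by exact: bjz_gt0.
rewrite mul0r addr0 /disc_mode /zr /G zpow_pt /pt /bj /jz /=.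
have -> : (r * cos t) ^+ 2 + (r * sin t) ^+ 2 = r ^+ 2.
  by rewrite !exprMn -mulrDr cos2Dsin2 mulr1.
have -> : c * r ^+ 2 = (mu * r / 2) ^+ 2 by rewrite /c; field.
have -> : r ^+ k = (2 / mu) ^+ k * (mu * r / 2) ^+ k.
  by rewrite -exprMn; congr (_ ^+ _); field; rewrite gt_eqF.
by ring.
Qed.

(** Re (x + i y)^k is harmonic and homogeneous of degree k, so Euler's relation reduces the
    eigenvalue equation to [bh_rec]. *)
Lemma disc_mode_eigenfunction : dirichlet_eigenfunction (mu ^+ 2) disc_mode.
Proof.
have mu0 : 0 < mu by exact: bjz_gt0.
have cux : cts ux by rewrite /ux; cont.
have cuy : cts uy by rewrite /uy; cont.
have cuxx : cts uxx by rewrite /uxx; cont.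
have cuxy : cts uxy by rewrite /uxy; cont.
have cuyx : cts uyx by rewrite /uyx; cont.
have cuyy : cts uyy by rewrite /uyy; cont.
have cu : cts disc_mode by rewrite /disc_mode; cont.
have [c1 ex ey] := D1_smooth mode_D1 cux cuy.
have [c2 exx _] := D1_smooth mode_x_D1 cuxx cuxy.
have [c3 _ eyy] := D1_smooth mode_y_D1 cuyx cuyy.
split.
- split; [exact: c1|rewrite ex; exact: c2|rewrite ey; exact: c3].
- exact: (continuous_subspaceT cu).
- move=> p _.
  have -> : laplacian disc_mode p = uxx p + uyy p.
    congr (_ + _).
      exact: (etrans (congr1 (fun f : R * R -> R => 'D_dir_x f p) ex) (congr1 (fun f => f p) exx)).
    exact: (etrans (congr1 (fun f : R * R -> R => 'D_dir_y f p) ey) (congr1 (fun f => f p) eyy)).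
  have rec := bh_rec k (c * (p.1 ^+ 2 + p.2 ^+ 2)).
  rewrite -/(G k p) -/(G k.+1 p) -/(G k.+2 p) in rec.
  have muE : mu ^+ 2 = 4 * c by rewrite /c; field.
  have euler : k%:R * (p.1 * zr k.-1 p - p.2 * zi k.-1 p) = k%:R * zr k p.
    by case: (k) => [|k']; rewrite ?mul0r.
  rewrite muE /disc_mode /uxx /uyy.
  have kk : G k p = k.+1%:R * G k.+1 p - c * (p.1 ^+ 2 + p.2 ^+ 2) * G k.+2 p.
    by rewrite rec; ring.
  transitivity (4 * c * ((k%:R * (p.1 * zr k.-1 p - p.2 * zi k.-1 p)) * G k.+1 p
     + zr k p * G k.+1 p - c * (p.1 ^+ 2 + p.2 ^+ 2) * G k.+2 p * zr k p)); first by ring.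
  by rewrite euler [in RHS]kk -natr1; ring.
- move=> p; rewrite /unit_circle /= -enorm_sqr => p1.
  have en : enorm p = 1.
    by apply/eqP; rewrite -(eqrXn2 (n := 2)) ?enorm_ge0// p1 expr1n.
  have [t _ ->] := polar_exists 0 p.
  rewrite en /disc_mode /zr /G zpow_pt /pt /=.
  have -> : (1 * cos t) ^+ 2 + (1 * sin t) ^+ 2 = 1 :> R by rewrite !mul1r cos2Dsin2.
  have := @bjz_root R k s; rewrite -/mu /bj /jz.
  have -> : (mu / 2) ^+ 2 = c * 1 by rewrite /c; field.
  move/eqP; rewrite mulf_eq0 expf_eq0 mulf_eq0 invr_eq0 gt_eqF// pnatr_eq0 andbF/= => /eqP ->.
  by rewrite mulr0.
- have [d d0 hd] := @bj_gt0_near0 R k.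
  pose r := Num.min (1 / 2) (d / mu / 2).
  have dm : 0 < d / mu by rewrite divr_gt0.
  have r0 : 0 < r by rewrite lt_min !divr_gt0.
  have r12 : r <= 1 / 2 by rewrite ge_min lexx.
  have r1 : r < 1 by lra.
  have rd : mu * r < d.
    have : r <= d / mu / 2 by rewrite ge_min lexx orbT.
    by move=> h; rewrite mulrC -ltr_pdivlMr//; lra.
  exists (pt r 0); first by apply: pt_in_disc; rewrite gtr0_norm.
  rewrite disc_mode_polar ?(ltW r0)// mulr0 cos0 mulr1 mul0r addr0 mulf_neq0//.
    by rewrite expf_neq0// mulf_neq0// invr_eq0 gt_eqF.
  by rewrite gt_eqF// hd// mulr_gt0.
Qed.

End explicit_eigenfunction.

(** * Passage to the limits *)

Section limits.
Context {R : realType}.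

Lemma cvg_EFin_epsilon (T : Type) (F : set_system T) (FF : Filter F) (f : T -> \bar R) (l : R) :
  (forall e, 0 < e -> \forall x \near F, ((l - e)%:E <= f x <= (l + e)%:E)%E) ->
  f @ F --> l%:E.
Proof.
move=> h; apply/fine_cvgP; split.
  apply: filterS (h 1 ltr01) => x /andP[h1 h2]; rewrite fin_numE; apply/andP; split.
    by apply/eqP => e; rewrite e in h1.
  by apply/eqP => e; rewrite e in h2.
apply/(@cvgrPdist_le _ R^o) => e e0; apply: filterS (h e e0) => x /=.
case: (f x) => [y||] /andP[h1 h2]; [rewrite !lee_fin in h1 h2|by []|by []].
rewrite /= in h1 h2 *; rewrite distrC ler_norml; apply/andP; split; lra.
Qed.

Lemma nodal_ratio_eigenfunction lam u : 0 < lam -> dirichlet_eigenfunction lam u ->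
  exists k s, Num.sqrt lam = bjz k s :> R /\ nodal_ratio lam u = (disc_ratio k s)%:E.
Proof.
move=> lam0 hu; have [k [s [a [b [muE hab hpol]]]]] := eigenfunction_classification lam0 hu.
exists k, s; split => //; rewrite -(sqr_sqrtr (ltW lam0)) muE.
by apply: nodal_ratio_polar_form hab _; rewrite -muE.
Qed.

Lemma nodal_ratio_attained k s (Lam : R) : Lam <= bjz k s ^+ 2 ->
  nodal_ratios_from Lam (disc_ratio k s)%:E.
Proof.
move=> h; exists (bjz k s ^+ 2), (disc_mode k s); split => //.
  exact: disc_mode_eigenfunction.
rewrite (nodal_ratio_polar_form _ (@disc_mode_polar R k s))//.
by left; rewrite expf_neq0// mulf_neq0// invr_eq0 gt_eqF// bjz_gt0.
Qed.

Lemma bjz_tends (L : R) k : exists S, forall s, (S <= s)%N -> L <= bjz k s.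
Proof.
have [n hn] := bjz_cofinal k L; exists n => s ns.
by apply: le_trans (ltW hn) _; exact: bjz_le.
Qed.

End limits.

Theorem theorem1 (R : realType) :
  [/\ ereal_inf (@nodal_ratios_from R Lam) @[Lam --> +oo%R] --> 1%:E,
      (forall theta0 : R, 0 <= theta0 < 2 * pi -> sin theta0 != 0 ->
        nodal_ratio (disc_eigenvalue 0 s) (disc_eigenfunction 0 s theta0)
          @[s --> \oo] --> 1%:E),
      ereal_sup (@nodal_ratios_from R Lam) @[Lam --> +oo%R] --> 2%:E
    & (forall theta0 : R, 0 <= theta0 < 2 * pi ->
        nodal_ratio (disc_eigenvalue k 1) (disc_eigenfunction k 1 theta0)
          @[k --> \oo] --> 2%:E)].
Proof.
have sq_large (L Lam s : R) : 0 <= s -> L ^+ 2 <= Lam -> Lam <= s ^+ 2 -> L <= s.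
  move=> s0 h1 h2; have [L0|/ltW L0] := leP 0 L; last exact: le_trans s0.
  by rewrite -(ler_pXn2r (n := 2)) ?nnegrE// (le_trans h1).
split.
- apply: cvg_EFin_epsilon => e e0.
  have [L1 hL1] := @disc_ratio_ge R e e0; have [L2 hL2] := @disc_ratio0_le R e e0.
  near=> Lam.
  have Lam0 : 0 < Lam by near: Lam; exact: nbhs_pinfty_gt.
  have LamL : L1 ^+ 2 <= Lam by near: Lam; apply: nbhs_pinfty_ge; exact: num_real.
  apply/andP; split.
    apply: le_ereal_inf_tmp => _ [lam [u [hl hu ->]]].
    have lam0 := lt_le_trans Lam0 hl.
    have [k [s [muE ->]]] := nodal_ratio_eigenfunction lam0 hu.
    rewrite lee_fin; apply: hL1; rewrite -muE.
    by apply: (sq_large _ Lam) => //; rewrite sqr_sqrtr// ltW.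
  (* The 1 in the maximum gives mu^2 >= mu >= Lam for mu = [bjz 0 S]. *)
  have [S hS] := @bjz_tends R (Num.max L2 (Num.max 1 Lam)) 0.
  have := hS S (leqnn S); rewrite !ge_max => /and3P[s1 s2 s3].
  apply: (@le_trans _ _ (disc_ratio 0 S)%:E).
    apply: ereal_inf_lbound; apply: nodal_ratio_attained.
    by apply: le_trans s3 _; rewrite expr2 ler_peMr// (le_trans ler01).
  by rewrite lee_fin; exact: hL2.
- move=> theta0 _ st; apply: cvg_EFin_epsilon => e e0.
  have [L1 hL1] := @disc_ratio_ge R e e0; have [L2 hL2] := @disc_ratio0_le R e e0.
  have [S hS] := @bjz_tends R (Num.max L1 L2) 0.
  (* Index 0 carries the default value of [bessel_zero] and is skipped; index [s.+1] there is [s] in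
     [bjz]. *)
  exists S.+1 => // -[//|s] /= Ss; rewrite nodal_ratio_disc_eigenfunction//.
  have := hS s Ss; rewrite ge_max => /andP[/hL1 h1 /hL2 h2].
  by rewrite !lee_fin h1 h2.
- apply: cvg_EFin_epsilon => e e0.
  have [K hK] := @disc_ratio_first R e e0.
  near=> Lam.
  have Lam0 : 0 < Lam by near: Lam; exact: nbhs_pinfty_gt.
  apply/andP; split; last first.
    apply: ge_ereal_sup => _ [lam [u [hl hu ->]]].
    have lam0 := lt_le_trans Lam0 hl.
    have [k [s [muE ->]]] := nodal_ratio_eigenfunction lam0 hu.
    by rewrite lee_fin (le_trans (disc_ratio_le2 k s))// lerDl ltW.
  (* j_{k,1} > k >= Lam + 1 brings the eigenvalue above Lam, and k >= K brings the ratio to at least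
     2 - e. *)
  pose k := maxn K (Num.trunc (Lam + 1)).+1.
  have kL : Lam + 1 <= k%:R.
    apply: le_trans (_ : (Num.trunc (Lam + 1)).+1%:R <= _); last by rewrite ler_nat leq_maxr.
    by apply: ltW; exact: truncnS_gt.
  apply: (@le_trans _ _ (disc_ratio k 0)%:E).
    by rewrite lee_fin; apply: hK; exact: leq_maxl.
  apply: ereal_sup_ubound; apply: nodal_ratio_attained.
  have kb := ltW (@bjz_gt_order R k 0).
  have b1 : Lam + 1 <= bjz k 0 by apply: le_trans kb.
  have b2 : Lam <= bjz k 0 by lra.
  by apply: le_trans b2 _; rewrite expr2 ler_peMr//; lra.
- move=> theta0 _; apply: cvg_EFin_epsilon => e e0.
  have [K hK] := @disc_ratio_first R e e0.
  (* [K.+1] keeps k positive; the condition on sin theta0 in the ratio formula concerns k = 0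
     only. *)
  exists K.+1 => // k /= Kk; rewrite nodal_ratio_disc_eigenfunction; last by move=> k0; rewrite k0 in Kk.
  rewrite !lee_fin hK ?(ltnW Kk)//=.
  by rewrite (le_trans (disc_ratio_le2 k 0))// lerDl ltW.
Unshelve. all: by end_near.
Qed.
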